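(* Let $f:\mathbb{R}^d\to\mathbb{R}$ be a $C^2$-smooth Gaussian field that is stationary, has zero mean and unit variance, and whose covariance kernel $r(t)=\mathbb{E}[f(0)f(t)]$ satisfies $r(t)\to 0$ as $\|t\|\to\infty$. For $n\in\mathbb{N}$ let $I_n=[0,n]^d\cap\mathbb{Z}^d$, let $D=[-1/2,1/2]^d$ and $D_t=t+D$ for $t\in I_n$. Fix $\alpha>1$, let $u(n)=\sqrt{2\alpha d\log n}$, and let $X=(X_t)_{t\in I_n}$ be the $\{0,1\}$-valued process $$X_t=X_{t,n}=\mathbf{1}\left[\max_{x\in D_t}f(x)>u(n)\right].$$ Let $X'\equiv 0$ be the zero process on $I_n$. Then, for some constant $c_0>0$, $$\frac{\|\mathcal{L}(X)-\mathcal{L}(X')\|_{TV}}{n^{(1-\alpha)d}(\log n)^{(d-1)/2}}\to c_0\quad\text{as }n\to\infty.$$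
   Context: $\mathcal{L}(X)$ denotes the law of $X$ as a random element of $\{0,1\}^{I_n}$, and $\|P-Q\|_{TV}=\sup_A|P(A)-Q(A)|$ is the total variation distance. The constant $c_0$ does not depend on $n$. *)

(* Defs.v *)
From HB Require Import structures.
From mathcomp Require Import all_boot all_order all_algebra.
From mathcomp Require Import all_classical all_reals all_analysis.
Set Implicit Arguments.
Unset Strict Implicit.
Unset Printing Implicit Defensive.
Import Order.TTheory GRing.Theory Num.Theory.
Import numFieldNormedType.Exports.
Local Open Scope classical_set_scope.
Local Open Scope ring_scope.

Definition basis_vec (R : realType) (d : nat) (i : 'I_d) : 'rV[R]_d :=
  delta_mx 0 i.

(* C^k regularity: all partial derivatives of order at most k exist
   everywhere and are continuous. *)
Fixpoint is_C (R : realType) (d k : nat) (g : 'rV[R]_d -> R) : Prop :=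
  continuous g /\
  if k is k'.+1 then
    forall i : 'I_d, (forall x, derivable g x (basis_vec R i)) /\
                     is_C k' (fun x => 'D_(basis_vec R i) g x)
  else True.

(* The normal law with mean m and standard deviation s.  The case s = 0 is
   separated because normal_prob m 0 is not the point mass at m. *)
Definition gaussian_law (R : realType) (m s : R) (A : set R) : \bar R :=
  if s == 0 then \d_m A else normal_prob m s A.

Definition is_gaussian (disp : measure_display) (Omega : measurableType disp)
    (R : realType) (P : probability Omega R) (Y : Omega -> R) : Prop :=
  exists m s : R, 0 <= s /\
    forall A : set R, measurable A -> pushforward P Y A = gaussian_law m s A.

Section RandomField.
Context (disp : measure_display) (Omega : measurableType disp) (R : realType).
Context (P : probability Omega R) (d : nat) (f : 'rV[R]_d -> {RV P >-> R}).

(* Every finite-dimensional marginal is a (possibly degenerate) Gaussian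
   vector, i.e. all its linear combinations are Gaussian. *)
Definition gaussian_field : Prop :=
  forall (k : nat) (x : 'I_k -> 'rV[R]_d) (a : 'I_k -> R),
    is_gaussian P (fun w => \sum_(i < k) a i * f (x i) w).

Definition marginal (k : nat) (x : 'I_k -> 'rV[R]_d) (w : Omega) :
    k.-tuple R :=
  [tuple f (x i) w | i < k].

Definition stationary : Prop :=
  forall (h : 'rV[R]_d) (k : nat) (x : 'I_k -> 'rV[R]_d)
         (A : set (k.-tuple R)), measurable A ->
    pushforward P (marginal (fun i => x i + h)) A
    = pushforward P (marginal x) A.

Definition smooth_paths (k : nat) : Prop :=
  forall w : Omega, is_C k (fun x => f x w).

Definition cov_kernel (t : 'rV[R]_d) : R :=
  fine 'E_P[(fun w => f 0 w * f t w)%R]%E.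

End RandomField.

(* The filter of the limits as the norm tends to infinity; `|t| is the sup
   norm, but all norms on R^d give the same filter. *)
Definition norm_infty (R : realType) (d : nat) : set_system 'rV[R]_d :=
  filter_from [set: R] (fun M => [set t : 'rV[R]_d | M < `|t|]).
Arguments norm_infty R d : clear implicits.

(* I_n = [0, n]^d \cap Z^d. *)
Definition grid (d n : nat) : Type := {ffun 'I_d -> 'I_n.+1}.
HB.instance Definition _ (d n : nat) := Finite.on (grid d n).

Definition grid_pt (R : realType) (d n : nat) (t : grid d n) : 'rV[R]_d :=
  \row_i (t i)%:R.

Definition unit_cube (R : realType) (d : nat) : set 'rV[R]_d :=
  [set y | forall i, - 2^-1 <= y 0 i <= 2^-1].
Arguments unit_cube R d : clear implicits.

Definition cube_at (R : realType) (d n : nat) (t : grid d n) : set 'rV[R]_d :=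
  [set grid_pt R t + y | y in unit_cube R d].
Arguments cube_at R {d n} t.

Definition config (d n : nat) : Type := {ffun grid d n -> bool}.
HB.instance Definition _ (d n : nat) := Finite.on (config d n).
HB.instance Definition _ (d n : nat) :=
  isPointed.Build (config d n) [ffun=> false].
HB.instance Definition _ (d n : nat) :=
  @isMeasurable.Build default_measure_display (config d n)
    discrete_measurable discrete_measurable0
    discrete_measurableC discrete_measurableU.

Definition level (R : realType) (alpha : R) (d n : nat) : R :=
  Num.sqrt (2 * alpha * d%:R * ln n%:R).

(* For continuous paths the supremum over the compact cube is a maximum. *)
Definition exceedance (disp : measure_display) (Omega : measurableType disp)
    (R : realType) (P : probability Omega R) (d : nat)
    (f : 'rV[R]_d -> {RV P >-> R}) (alpha : R) (n : nat) (w : Omega) :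
    config d n :=
  [ffun t => level alpha d n < sup [set f x w | x in cube_at R t]].

Definition zero_process (disp : measure_display)
    (Omega : measurableType disp) (d n : nat) (w : Omega) : config d n :=
  [ffun=> false].
Arguments zero_process {disp} Omega d n w.

Definition tv_dist (disp : measure_display) (S : measurableType disp)
    (R : realType) (mu nu : set S -> \bar R) : R :=
  sup [set `|fine (mu A) - fine (nu A)| | A in @measurable _ S].

(* Main.v *)
(* Since X' vanishes, the total variation distance is P(X <> 0), the probability
   that f exceeds u = u(n) somewhere on the cube [-1/2, n + 1/2]^d.

   On a lattice of mesh delta with u delta -> a, split by the lexicographically
   last exceedance.  Given f(x) > u, the values at the neighbouring points are
   governed by f(x) and by increments of f independent of f(x), at the scale
   1/u a linear form in the gradient; this yields the limit of the probability
   that x is a last exceedance within a box of K^d lattice points, divided by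
   the normal tail psi(u).  Pairs of exceedances farther apart are negligible
   as K grows: 1 - r(h) >= c |h|^2 on bounded sets, and for distant pairs
   r(h) -> 0 suffices since their number is too small when alpha > 1.

   A dyadic chaining by second differences shows that an exceedance of
   u + eta / u on the cube forces an exceedance of u on the lattice, up to a
   negligible probability, as soon as a^2 is small with respect to eta: f(y) is
   negatively correlated with its second difference at y, so that f(y) > u
   together with a very negative second difference has probability much smaller
   than psi(u).  Hence P(X <> 0) / (n^d u^d psi(u)) lies asymptotically between
   B(a) and exp(2 eta) B(a), and converges; for large a almost every exceedance
   is isolated, which makes B(a), and thus the limit, positive. *)
From HB Require Import structures.
Require Import Defs.
From mathcomp Require Import all_boot all_order all_algebra.
From mathcomp Require Import all_classical all_reals all_analysis.
From mathcomp Require Import measurable_realfun.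
From mathcomp Require Import ring lra zify.
Set Implicit Arguments.
Unset Strict Implicit.
Unset Printing Implicit Defensive.
Import Order.TTheory GRing.Theory Num.Theory.
Import numFieldNormedType.Exports.
Local Open Scope classical_set_scope.
Local Open Scope ring_scope.

(** * The standard normal law *)

(** The assumptions concern the law of each linear combination separately and the smoothness of
    paths. No joint density, no regularity of the covariance kernel and no nondegeneracy of the
    gradient is given; three substitutes shape the proof. Independence of orthogonal variables comes
    from factorising expectations of cosines and approximating indicators by trigonometric
    polynomials. Pathwise limits become limits of variances because E cos X = exp(- Var X / 2) for a
    centred Gaussian X and cosines are bounded: this yields the expansion of r at 0 and the h^4
    bound for the variance of a second difference. The quadratic lower bound on 1 - r comes from the
    decay of r, through 1 - r(m h) <= m^2 (1 - r(h)). There are about (n u)^d lattice points, and a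
    pair of distant points costs psi(u) exp(- kappa u^2) with kappa < 1/2. The sum over such pairs
    is negligible when kappa > 1 / (2 alpha), and alpha > 1 leaves room between the two bounds. *)

Lemma seq_cvgM (R : realType) (u v : nat -> R) (a b : R) :
  u @ \oo --> a -> v @ \oo --> b -> (fun n => u n * v n) @ \oo --> a * b.
Proof. by move=> ? ?; apply: cvgM. Qed.

Lemma seq_cvgD (R : realType) (u v : nat -> R) (a b : R) :
  u @ \oo --> a -> v @ \oo --> b -> (fun n => u n + v n) @ \oo --> a + b.
Proof. by move=> ? ?; apply: cvgD. Qed.

Lemma seq_cvgB (R : realType) (u v : nat -> R) (a b : R) :
  u @ \oo --> a -> v @ \oo --> b -> (fun n => u n - v n) @ \oo --> a - b.
Proof. by move=> ? ?; apply: cvgB. Qed.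

Lemma eq_near_cvg (R : realType) (u v : nat -> R) (l : R) :
  (\forall n \near \oo, u n = v n) -> u @ \oo --> l -> v @ \oo --> l.
Proof. by move=> uv; apply: cvg_trans; exact: near_eq_cvg. Qed.

Section RealIntegral.
Context (disp : measure_display) (T : measurableType disp) (R : realType).
Context (mu : {measure set T -> \bar R}).

Lemma dominated_cvg_Rintegral (f_ : nat -> T -> R) (f g : T -> R) :
  (forall n, measurable_fun setT (f_ n)) -> measurable_fun setT f ->
  (forall x, f_ ^~ x @ \oo --> f x) ->
  mu.-integrable setT (EFin \o g) ->
  (forall n x, `|f_ n x| <= g x) ->
  (\int[mu]_x f_ n x) @[n --> \oo] --> (\int[mu]_x f x).
Proof.
move=> mf_ mf cvf ig fg.
have [i_f _ c] : [/\ mu.-integrable setT (EFin \o f),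
  [sequence \int[mu]_(x in setT) (`|(f_ n x)%:E - (f x)%:E|)%E ]_n @ \oo --> 0%E &
  [sequence \int[mu]_(x in setT) ((f_ n x)%:E) ]_n @ \oo --> \int[mu]_(x in setT) ((f x)%:E)]%E.
  apply: (@dominated_convergence _ _ _ mu setT measurableT
     (fun n x => (f_ n x)%:E) (fun x => (f x)%:E) (fun x => (g x)%:E)) => //.
  - by move=> n; apply/measurable_EFinP.
  - exact/measurable_EFinP.
  - by apply: aeW => x _; apply: cvg_EFin; [exact: nearW|exact: cvf].
  - by apply: aeW => x n _; rewrite /= lee_fin.
rewrite /Rintegral; apply: fine_cvg; rewrite fineK//.
exact: integrable_fin_num.
Qed.

Lemma le_integrable_norm (f g : T -> R) : measurable_fun setT f ->
  (forall x, `|f x| <= g x) -> mu.-integrable setT (EFin \o g) ->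
  mu.-integrable setT (EFin \o f).
Proof.
move=> mf fg; apply: le_integrable => //; first exact/measurable_EFinP.
by move=> x _ /=; rewrite lee_fin (le_trans (fg x))// ler_norm.
Qed.

End RealIntegral.

Lemma cvg_inv_pinfty (R : realType) (u : nat -> R) : u @ \oo --> +oo ->
  (fun n => (u n)^-1) @ \oo --> (0 : R).
Proof.
by move=> uoo; apply/gtr0_cvgV0 => //; near=> n; near: n; exact: (cvgryPgt _).1.
Unshelve. all: by end_near. Qed.

Lemma cvg_invn0 (R : realType) : (n%:R^-1 : R) @[n --> \oo] --> (0 : R).
Proof. exact/cvg_inv_pinfty/cvgr_idn. Qed.

Section StandardNormal.
Context (R : realType).
Notation mu := (@lebesgue_measure R).
Notation phi := (@normal_pdf R 0 1).
Implicit Types x z v : R.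

Definition normal_tail v : R := fine (normal_prob 0 1 `]v, +oo[).

Lemma normal_pdf01E x : phi x = normal_peak 1 * expR (- x ^+ 2 / 2).
Proof.
by rewrite normal_pdfE ?oner_neq0// /normal_fun subr0 expr1n mulr2n.
Qed.

Lemma normal_pdf01_gt0 x : 0 < phi x.
Proof. by rewrite normal_pdf01E mulr_gt0 ?expR_gt0 ?normal_peak_gt0 ?oner_neq0. Qed.

Lemma is_derive_normal_pdf01 x : is_derive x 1 phi (- x * phi x).
Proof.
have -> : phi = fun y => normal_peak 1 * expR (- y ^+ 2 / 2).
  by apply/funext => y; rewrite normal_pdf01E.
apply: is_derive_eq.
by rewrite /GRing.scale /=; field.
Qed.

(** A wider Gaussian density absorbs polynomial weights: with y = x^2 / 8 the claim reads 1 + 8 y <=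
    8 exp(3 y). It supplies all the integrability needed against the normal density. *)
Lemma normal_pdf01_sqr_bound x : (1 + x ^+ 2) * phi x <= 16 * normal_pdf 0 2 x.
Proof.
rewrite normal_pdf01E normal_pdfE// /normal_fun /normal_peak subr0.
have -> : Num.sqrt (2 ^+ 2 * pi *+ 2) = 2 * Num.sqrt (1 ^+ 2 * pi *+ 2) :> R.
  rewrite expr1n mul1r -mulrnAr sqrtrM ?sqr_ge0// sqrtr_sqr.
  by rewrite ger0_norm.
set s := Num.sqrt _; have s0 : 0 < s.
  by rewrite sqrtr_gt0 expr1n mul1r mulrn_wgt0// pi_gt0.
have -> : - x ^+ 2 / (2 ^+ 2 *+ 2) = - (x ^+ 2 / 8) :> R.
  by rewrite -mulr_natr; field.
set y := x ^+ 2 / 8.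
have -> : - x ^+ 2 / 2 = - y - y - y - y by rewrite /y; field.
have y0 : 0 <= y by rewrite /y divr_ge0// sqr_ge0.
have -> : x ^+ 2 = 8 * y by rewrite /y; field.
rewrite -!addrA expRD -opprD -opprD expRN.
have h := expR_ge1Dx (y + (y + y)).
rewrite -expRN; have E0 := expR_gt0 (- y); rewrite invfM.
rewrite [X in _ <= X](_ : _ = s^-1 * (8 * expR (- y))); last by field; lra.
rewrite [X in X <= _](_ : _ = s^-1 * ((1 + 8 * y) / expR (y + (y + y)) * expR (- y))); last first.
  by rewrite -expRN; ring.
rewrite ler_pM2l ?invr_gt0// ler_pM2r//.
by rewrite ler_pdivrMr ?expR_gt0//; lra.
Qed.

Lemma continuous_normal_pdf01 : continuous phi.
Proof. by apply: continuous_normal_pdf; rewrite oner_neq0. Qed.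

Lemma integrable_normal_pdf_sqr :
  mu.-integrable setT (fun x => ((1 + x ^+ 2) * phi x)%:E).
Proof.
apply: (@le_integrable_norm _ (measurableTypeR R) R mu (fun x : R => (1 + x ^+ 2) * phi x)
  (fun x : R => 16 * normal_pdf 0 2 x)).
- apply: measurable_funM; last exact: measurable_normal_pdf.
  by apply: measurable_funD => //; exact: measurable_funX.
- move=> x; rewrite ger0_norm ?normal_pdf01_sqr_bound//.
  by rewrite mulr_ge0 ?normal_pdf_ge0// addr_ge0// sqr_ge0.
- rewrite /comp; under eq_fun do rewrite EFinM.
  by apply: integrableZl => //; exact: integrable_normal_pdf.
Qed.

Lemma integrable_normal_pdfM (h : R -> R) (C : R) : measurable_fun setT h ->
  (forall x, `|h x| <= C * (1 + x ^+ 2)) ->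
  mu.-integrable setT (fun x => (h x * phi x)%:E).
Proof.
move=> mh hC.
apply: (@le_integrable_norm _ (measurableTypeR R) R mu (fun x : R => h x * phi x)
  (fun x : R => C * ((1 + x ^+ 2) * phi x))).
- by apply: measurable_funM => //; exact: measurable_normal_pdf.
- by move=> x; rewrite normrM (ger0_norm (normal_pdf_ge0 _ _ _)) mulrA ler_wpM2r// normal_pdf_ge0.
- rewrite /comp; under eq_fun do rewrite EFinM.
  by apply: integrableZl => //; exact: integrable_normal_pdf_sqr.
Qed.

(** The fundamental theorem of calculus on [-n, n], with dominated convergence for the integral. *)
Lemma Rintegral_derive_eq0 (F f : R -> R) :
  (forall x, is_derive x 1 F (f x)) -> continuous f ->
  mu.-integrable setT (EFin \o f) ->
  F n%:R @[n --> \oo] --> (0 : R) -> F (- n%:R) @[n --> \oo] --> (0 : R) ->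
  \int[mu]_x f x = 0.
Proof.
move=> dF cf intf F1 F2.
have cF : continuous F.
  by move=> x; apply: differentiable_continuous; apply/derivable1_diffP; case: (dF x).
have mf : measurable_fun setT f by exact: continuous_measurable_fun.
have h1 : (\int[mu]_x (f \_ `[- n%:R, n%:R]) x) @[n --> \oo] --> \int[mu]_x f x.
  apply: (@dominated_cvg_Rintegral _ (measurableTypeR R) _ mu _ _ (fun x => `|f x|)) => //.
  - by move=> n; apply/(measurable_restrict _ _ _).1 => //; exact: measurable_funS mf.
  - move=> x; apply: cvg_near_cst.
    near=> n; rewrite patchE mem_set//= in_itv/= -ler_norml.
    by near: n; exact: nbhs_infty_ger.
  - by have := integrable_norm intf.
  - by move=> n x; rewrite patchE; case: ifP => // _; rewrite normr0.
have h2 : (\int[mu]_x (f \_ `[- n%:R, n%:R]) x) @[n --> \oo] --> (0 : R).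
  have -> : (0 : R) = 0 - 0 by rewrite subr0.
  apply: cvg_trans; last exact: (cvgB F1 F2).
  apply: near_eq_cvg; near=> n.
  rewrite -Rintegral_mkcond /Rintegral (@continuous_FTC2 _ f F)//.
  - rewrite -subr_gt0 opprK addr_gt0// ltr0n; near: n; exact: nbhs_infty_gt.
  - exact: continuous_subspaceT.
  - by split; [move=> x _; case: (dF x) | apply: cvg_at_right_filter; exact: cF
     | apply: cvg_at_left_filter; exact: cF].
  - by move=> x _; rewrite derive1E; case: (dF x).
by rewrite -(cvg_lim _ h1)// (cvg_lim _ h2).
Unshelve. all: by end_near. Qed.

(** The sign [s] is 1 or -1, so that one statement serves both ends of the line. *)
Lemma cvg_MnormalpdfN (h : R -> R) (s : R) (C : R) : s ^+ 2 = 1 ->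
  (forall x, `|h x| <= C * (1 + `|x|)) ->
  h (s * n%:R) * phi (s * n%:R) @[n --> \oo] --> (0 : R).
Proof.
move=> s1 hC.
have C0 : 0 <= C.
  by have := hC 0; rewrite normr0 addr0 mulr1; apply: le_trans.
have hp : (4 * C * normal_peak 1) * (n%:R^-1 : R) @[n --> \oo] --> (0 : R).
  rewrite -[X in _ --> X](mulr0 (4 * C * normal_peak 1)).
  by apply: cvgMr; exact: cvg_invn0.
have hn : - ((4 * C * normal_peak 1) * (n%:R^-1 : R)) @[n --> \oo] --> (0 : R).
  by rewrite -[X in _ --> X]oppr0; exact: cvgN.
apply: (squeeze_cvgr _ hn hp).
near=> n; rewrite -ler_norml normrM (ger0_norm (normal_pdf_ge0 _ _ _)).
have n1 : 1 <= n%:R :> R by rewrite ler1n; near: n; exact: nbhs_infty_gt.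
have ns : `|s * n%:R| = n%:R.
  rewrite normrM (ger0_norm (_ : 0 <= n%:R))//.
  have /eqP := s1; rewrite -(real_normK (num_real s)) sqrp_eq1// => /eqP ->; rewrite mul1r//.
rewrite normal_pdf01E exprMn s1 mul1r.
have e1 : expR (- n%:R ^+ 2 / 2) <= 2 / n%:R ^+ 2 :> R.
  rewrite mulNr expRN -[leRHS]invf_div lef_pV2 ?posrE ?expR_gt0//; last first.
    by rewrite divr_gt0// exprn_gt0//; lra.
  by apply: le_trans (expR_ge1Dx _); rewrite lerDr.
have := hC (s * n%:R); rewrite ns => h1.
apply: (@le_trans _ _ (C * (1 + n%:R) * (normal_peak 1 * (2 / n%:R ^+ 2)))).
  by apply: ler_pM => //; [rewrite mulr_ge0 ?normal_peak_ge0 ?expR_ge0|rewrite ler_pM2l ?normal_peak_gt0 ?oner_neq0].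
have -> : C * (1 + n%:R) * (normal_peak 1 * (2 / n%:R ^+ 2))
   = (2 * C * normal_peak 1 / n%:R) * ((1 + n%:R) / n%:R).
  by field; lra.
have -> : 4 * C * normal_peak 1 / n%:R = (2 * C * normal_peak 1 / n%:R) * 2 :> R.
  by field; lra.
rewrite ler_wpM2l//; first by rewrite divr_ge0// !mulr_ge0 ?normal_peak_ge0.
by rewrite ler_pdivrMr; lra.
Unshelve. all: by end_near. Qed.

(** Gaussian integration by parts: the derivative of h phi is (h' - x h) phi, and h phi vanishes at
    both ends. *)
Lemma normal_stein (h h' : R -> R) (C : R) :
  (forall x, is_derive x 1 h (h' x)) -> continuous h' ->
  (forall x, `|h x| <= C * (1 + `|x|)) -> (forall x, `|h' x| <= C) ->
  \int[mu]_x (x * h x * phi x) = \int[mu]_x (h' x * phi x).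
Proof.
move=> dh ch' hC h'C.
have ch : continuous h.
  by move=> x; apply: differentiable_continuous; apply/derivable1_diffP; case: (dh x).
have C0 : 0 <= C by have := h'C 0; apply: le_trans.
have i1 : mu.-integrable setT (fun x => (x * h x * phi x)%:E).
  apply: (@integrable_normal_pdfM (fun x => x * h x) (2 * C)).
    by apply: measurable_funM => //; exact: continuous_measurable_fun.
  move=> x; rewrite normrM; apply: (@le_trans _ _ (`|x| * (C * (1 + `|x|)))).
    by rewrite ler_wpM2l.
  rewrite -(real_normK (num_real x)); set y := `|x|.
  have := mulr_ge0 C0 (sqr_ge0 (y - 1)); nra.
have i2 : mu.-integrable setT (fun x => (h' x * phi x)%:E).
  apply: (@integrable_normal_pdfM h' C); first exact: continuous_measurable_fun.
  by move=> x; rewrite (le_trans (h'C x))// ler_peMr// lerDl sqr_ge0.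
apply/eqP; rewrite eq_sym -subr_eq0 -RintegralB//; apply/eqP.
apply: (@Rintegral_derive_eq0 (fun x => h x * phi x)).
- move=> x; have := @is_derive_normal_pdf01 x => dp; have dhx := dh x.
  apply: is_derive_eq; rewrite /GRing.scale /=; ring.
- move=> x; apply: cvgB; (apply: cvgM; last exact: continuous_normal_pdf01).
    exact: ch'.
  by apply: cvgM; [exact: cvg_id|exact: ch].
- rewrite /comp; under eq_fun do rewrite EFinB.
  exact: integrableB.
- have /= := @cvg_MnormalpdfN h 1 C (expr1n _ _) hC.
  by under eq_fun do rewrite mul1r.
- have /= := @cvg_MnormalpdfN h (- 1) C _ hC; rewrite sqrrN expr1n => /(_ erefl).
  by under eq_fun do rewrite mulN1r.
Qed.

Lemma Rintegral_normal_pdf01 : \int[mu]_x phi x = 1.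
Proof. by rewrite /Rintegral integral_normal_pdf. Qed.

Lemma normal_mean01 : \int[mu]_x (x * phi x) = 0.
Proof.
transitivity (\int[mu]_x (x * cst 1 x * phi x)).
  by apply: eq_Rintegral => x _; rewrite /= mulr1.
rewrite (@normal_stein _ (cst 0) 1)//.
- by rewrite /Rintegral; under eq_integral do rewrite mul0r; rewrite integral0.
- by move=> x; exact: cst_continuous.
- by move=> x; rewrite /= mul1r normr1 lerDl.
- by move=> x; rewrite /= normr0.
Qed.

Lemma normal_sqr01 : \int[mu]_x (x ^+ 2 * phi x) = 1.
Proof.
transitivity (\int[mu]_x (x * id x * phi x)); first exact: eq_Rintegral.
rewrite (@normal_stein _ (cst 1) 1)//.
- by under eq_Rintegral do rewrite mul1r; rewrite Rintegral_normal_pdf01.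
- by move=> x; exact: cst_continuous.
- by move=> x; rewrite mul1r lerDr.
- by move=> x; rewrite /= normr1.
Qed.

(** The characteristic function of the standard normal law, which is real by symmetry. *)
Definition normal_cos (t : R) : R := \int[mu]_x (cos (t * x) * phi x).

Lemma measurable_cosM (t : R) : measurable_fun setT (fun x : R => cos (t * x)).
Proof.
apply: continuous_measurable_fun => x; apply: continuous_comp; last exact: continuous_cos.
by apply: cvgM; [exact: cvg_cst|exact: cvg_id].
Qed.

(** Differentiation under the integral gives the mean of - x sin(t x), and integration by parts
    turns it into - t times the mean of cos(t x). The resulting differential equation determines the
    function. *)
Lemma is_derive_normal_cos (t : R) :
  is_derive t 1 normal_cos (- t * normal_cos t).
Proof.
pose f (l : R) (x : measurableTypeR R) : R := cos (l * x) * phi x.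
have df (l x : R) : is_derive l 1 (f ^~ x) (- x * sin (l * x) * phi x).
  rewrite /f; apply: is_derive_eq; rewrite /GRing.scale /=; ring.
have E l x : partial1of2 f l x = - x * sin (l * x) * phi x.
  by rewrite partial1of2E; case: (df l x).
have It : [set` `](t - 1), (t + 1)[] t by rewrite /= in_itv/= ltrBlDr !ltrDl ltr01.
have i1 (l : R) : mu.-integrable setT (fun x => (f l x)%:E).
  apply: (@integrable_normal_pdfM _ 1); first exact: measurable_cosM.
  by move=> x; rewrite mul1r (@le_trans _ _ 1) ?cos_max// lerDl sqr_ge0.
have ig : mu.-integrable setT (EFin \o (fun x : R => `|x| * phi x)).
  apply: (@integrable_normal_pdfM (fun x => `|x|) 1) => //.
  move=> x; rewrite normr_id mul1r -(real_normK (num_real x)).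
  by have := sqr_ge0 (`|x| - 1); nra.
have g0 (y : R) : 0 <= `|y| * phi y by rewrite mulr_ge0// normal_pdf_ge0.
have hb (x y : R) : [set` `](t - 1), (t + 1)[] x -> setT y ->
    `|partial1of2 f x y| <= `|y| * phi y.
  move=> _ _; rewrite E !normrM normrN (ger0_norm (normal_pdf_ge0 _ _ _)).
  by rewrite ler_wpM2r ?normal_pdf_ge0// ler_piMr// sin_max.
apply: DeriveDef.
  apply: (@derivable_under_integral _ _ _ mu f setT measurableT t _ _ It _ _ _ g0 ig hb) => //.
  by move=> l _; exact: i1.
rewrite -derive1E (@differentiation_under_integral _ _ _ mu f setT measurableT t _ _ It _ _ _ g0 ig hb) => //.
  2: by move=> l _; exact: i1.
transitivity (\int[mu]_x (x * (- sin (t * x)) * phi x)).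
  by apply: eq_Rintegral => x _; rewrite E; ring.
have dsin (x : R) : is_derive x 1 (fun y : R => - sin (t * y)) (- t * cos (t * x)).
  by apply: is_derive_eq; rewrite /GRing.scale /=; ring.
rewrite (@normal_stein _ _ (1 + `|t|) dsin).
- rewrite /normal_cos -RintegralZl//.
    by apply: eq_Rintegral => x _; rewrite mulrA.
  exact: i1.
- move=> x; apply: cvgM; first exact: cvg_cst.
  apply: continuous_comp; last exact: continuous_cos.
  by apply: cvgM; [exact: cvg_cst|exact: cvg_id].
- move=> x; rewrite normrN (@le_trans _ _ 1) ?sin_max//.
  have := normr_ge0 t; have := normr_ge0 x; nra.
- move=> x; rewrite normrM normrN (@le_trans _ _ `|t|)//; last lra.
  by rewrite ler_piMr// cos_max.
Qed.

Lemma normal_cosE (t : R) : normal_cos t = expR (- t ^+ 2 / 2).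
Proof.
pose g (s : R) := normal_cos s * expR (s ^+ 2 / 2).
have dg (s : R) : is_derive s 1 g 0.
  have ? := is_derive_normal_cos s.
  rewrite /g; apply: is_derive_eq.
  by rewrite /GRing.scale /=; field.
have := is_derive_0_is_cst t 0 dg.
rewrite /g expr0n mul0r expR0 mulr1.
have -> : normal_cos 0 = 1.
  rewrite /normal_cos; under eq_Rintegral do rewrite mul0r cos0 mul1r.
  exact: Rintegral_normal_pdf01.
move=> /eqP; rewrite mulNr expRN.
move=> /eqP h; rewrite -[LHS](mulfK (lt0r_neq0 (expR_gt0 (t ^+ 2 / 2)))) h.
by rewrite mul1r.
Qed.

End StandardNormal.

(** * Mills inequalities and the behaviour of the normal tail at a high level *)

Section NormalTail.
Context (R : realType).
Notation mu := (@lebesgue_measure R).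
Notation phi := (@normal_pdf R 0 1).
Notation psi := (@normal_tail R).
Implicit Types x z v : R.

Lemma normal_tail_ge0 v : 0 <= psi v.
Proof. by rewrite fine_ge0. Qed.

Lemma normal_tail_compl v : psi v = 1 - \int[mu]_(x in `]-oo, v]) phi x.
Proof.
rewrite /normal_tail -setCitvl probability_setC// fineB//.
by rewrite fin_num_measure.
Qed.

Lemma normal_tail_nincr x v : x <= v -> psi v <= psi x.
Proof.
move=> xv; apply: fine_le; rewrite ?fin_num_measure//.
apply: le_measure; rewrite ?inE//.
by apply: subset_itvr; rewrite bnd_simp.
Qed.

Lemma is_derive_normal_tail v : is_derive v 1 psi (- phi v).
Proof.
have -> : psi = fun v => 1 - \int[mu]_(x in `]-oo, v]) phi x.
  by apply/funext => w; exact: normal_tail_compl.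
have [] := @continuous_FTC1 R phi -oo%O v (v + 1).
- by rewrite ltrDl.
- exact: (integrableS measurableT _ _ (integrable_normal_pdf _ _)).
- by rewrite ltNyr.
- exact: continuous_normal_pdf01.
set F := fun v => _; move=> dF F'.
have dF' : is_derive v 1 F (phi v) by rewrite -F' derive1E; apply: DeriveDef.
have -> : - phi v = 0 - phi v by rewrite sub0r.
rewrite -/F; change (is_derive v 1 (fun w => 1 - F w) (0 - phi v)).
move: dF'; clear; clearbody F => dF'.
have := is_deriveB (is_derive_cst (1 : R) v (1 : R)) dF'.
by rewrite (_ : cst 1 - F = (fun w => 1 - F w))//; apply/funext.
Qed.

Lemma continuous_normal_tail : continuous psi.
Proof.
move=> x; apply: differentiable_continuous; apply/derivable1_diffP.
by case: (is_derive_normal_tail x).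
Qed.

Lemma normal_tail_cvg0 : psi n%:R @[n --> \oo] --> (0 : R).
Proof.
have h : (\int[mu]_x (phi \_ `]n%:R, +oo[) x) @[n --> \oo] --> \int[mu]_x cst (0 : R) x.
  apply: (@dominated_cvg_Rintegral _ (measurableTypeR R) _ mu _ _ phi) => //.
  - move=> n; apply/(measurable_restrict _ _ _).1 => //.
    by apply: measurable_funS (measurable_normal_pdf 0 1).
  - move=> x; apply: cvg_near_cst; near=> n.
    rewrite patchE memNset//= in_itv/= andbT; apply/negP; rewrite -leNgt.
    by near: n; exact: nbhs_infty_ger.
  - exact: integrable_normal_pdf.
  - move=> n x; rewrite patchE; case: ifP => _; last by rewrite normr0 normal_pdf_ge0.
    by rewrite ger0_norm ?normal_pdf_ge0.
move: h; rewrite /Rintegral integral0 /=.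
apply: cvg_trans; apply: near_eq_cvg; near=> n.
by rewrite -/(Rintegral _ _ _) -Rintegral_mkcond.
Unshelve. all: by end_near. Qed.

(** Reduces both Mills inequalities to the sign of a derivative: a difference that decreases to 0 is
    nonnegative. *)
Lemma cvg_nat_ge (F : R -> R) (l x : R) : F n%:R @[n --> \oo] --> l ->
  (forall y, x <= y -> F y <= F x) -> l <= F x.
Proof.
move=> Fl Fx.
apply: (@closed_cvg _ _ \oo _ (fun n : nat => F n%:R) [set y | y <= F x]) => //.
near=> n; apply: Fx; near: n; exact: nbhs_infty_ger.
Unshelve. all: by end_near. Qed.

Lemma mono_derive_le (F f : R -> R) : (forall x, 0 < x -> is_derive x 1 F (f x)) ->
  (forall x, 0 < x -> f x <= 0) ->
  forall x y, 0 < x -> x <= y -> F y <= F x.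
Proof.
move=> dF f0 x y x0 xy.
apply: (@ler0_derive1_nincr _ F x y) => //.
- move=> z; rewrite in_itv/= => /andP[xz _]; have := dF z (lt_trans x0 xz).
  by case.
- move=> z; rewrite in_itv/= => /andP[xz _].
  rewrite derive1E; have := dF z (lt_trans x0 xz) => -[_ ->].
  exact/f0/(lt_trans x0).
- apply: continuous_in_subspaceT => z; rewrite inE/= in_itv/= => /andP[xz _].
  apply: differentiable_continuous; apply/derivable1_diffP.
  by case: (dF z (lt_le_trans x0 xz)).
Qed.

Lemma normal_pdf_cvg0 : phi n%:R @[n --> \oo] --> (0 : R).
Proof.
have /= := @cvg_MnormalpdfN R (cst 1) 1 1 (expr1n _ _).
under eq_fun do rewrite !mul1r; apply.
by move=> x; rewrite normr1 mul1r lerDl.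
Qed.

(** The function phi(y) / y - psi(y) tends to 0 and has derivative - phi(y) / y^2. *)
Lemma mills_upper v : 0 < v -> v * psi v <= phi v.
Proof.
move=> v0; rewrite mulrC -ler_pdivlMr// -subr_ge0.
apply: (@cvg_nat_ge (fun y => phi y / y - psi y)).
  rewrite -[X in _ --> X](subr0 (0 : R)); apply: cvgB; last exact: normal_tail_cvg0.
  by rewrite -[X in _ --> X](mulr0 (0 : R)); apply: cvgM; [exact: normal_pdf_cvg0|exact: cvg_invn0].
move=> y vy; apply: (@mono_derive_le (fun y => phi y / y - psi y) (fun x => - phi x / x ^+ 2)) => //.
- move=> x x0; have := is_derive_normal_pdf01 x; have := is_derive_normal_tail x => d1 d2.
  have x00 := lt0r_neq0 x0.
  have dV : is_derive x (1 : R) (fun y : R => y^-1) (- x ^- 2 *: 1) by exact: is_deriveV.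
  apply: is_derive_eq.
  by rewrite /GRing.scale /=; field.
- by move=> x x0; rewrite mulNr oppr_le0 divr_ge0 ?normal_pdf_ge0// sqr_ge0.
Qed.

(** The function psi(y) - y phi(y) / (1 + y^2) tends to 0 and has derivative - 2 phi(y) / (1 +
    y^2)^2. *)
Lemma mills_lower v : 0 < v -> v / (1 + v ^+ 2) * phi v <= psi v.
Proof.
move=> v0; rewrite -subr_ge0.
apply: (@cvg_nat_ge (fun y => psi y - y / (1 + y ^+ 2) * phi y)).
  rewrite -[X in _ --> X](subr0 (0 : R)); apply: cvgB; first exact: normal_tail_cvg0.
  apply: (@squeeze_cvgr _ _ _ _ (cst 0) (fun n : nat => phi n%:R)).
  - near=> n; rewrite mulr_ge0 ?divr_ge0 ?normal_pdf_ge0 ?addr_ge0 ?sqr_ge0//=.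
    rewrite ler_piMl ?normal_pdf_ge0// ler_pdivrMr ?mul1r; last first.
      by rewrite ltr_pwDl// sqr_ge0.
    have := sqr_ge0 (n%:R - 1 : R); have := sqr_ge0 (n%:R : R); nra.
  - exact: cvg_cst.
  - exact: normal_pdf_cvg0.
move=> y vy; apply: (@mono_derive_le (fun y => psi y - y / (1 + y ^+ 2) * phi y) (fun x => - 2 * phi x / (1 + x ^+ 2) ^+ 2)) => //.
- move=> x x0; have := is_derive_normal_pdf01 x; have := is_derive_normal_tail x => d1 d2.
  have x00 : 1 + x ^+ 2 != 0 by rewrite gt_eqF// ltr_pwDl// sqr_ge0.
  apply: is_derive_eq.
  by rewrite /GRing.scale /=; field.
- move=> x x0; rewrite !mulNr oppr_le0; apply: divr_ge0; last exact: sqr_ge0.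
  by apply: mulr_ge0 => //; exact: normal_pdf_ge0.
Unshelve. all: by end_near. Qed.

Lemma normal_tail_gt0 v : 0 < psi v.
Proof.
have h : 0 < psi (`|v| + 1).
  apply: lt_le_trans (@mills_lower (`|v| + 1) _); last by rewrite ltr_wpDl.
  rewrite mulr_gt0 ?normal_pdf01_gt0// divr_gt0//.
apply: (lt_le_trans h); apply: normal_tail_nincr.
by rewrite (le_trans (ler_norm v))// lerDl.
Qed.

(** The upper Mills inequality says that psi(x) exp(x^2 / 2) has a nonpositive derivative. *)
Lemma normal_tail_ratio x y : 0 < x -> x <= y ->
  psi y <= psi x * expR (- (y ^+ 2 - x ^+ 2) / 2).
Proof.
move=> x0 xy.
have : psi y * expR (y ^+ 2 / 2) <= psi x * expR (x ^+ 2 / 2).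
  apply: (@mono_derive_le (fun x => psi x * expR (x ^+ 2 / 2))
     (fun x => (x * psi x - phi x) * expR (x ^+ 2 / 2))) => //.
  - move=> z z0; have := is_derive_normal_tail z => d1.
    apply: is_derive_eq.
    by rewrite /GRing.scale /=; field.
  - by move=> z z0; rewrite pmulr_lle0 ?expR_gt0// subr_le0 mills_upper.
rewrite -ler_pdivlMr ?expR_gt0// => /le_trans; apply.
by rewrite -mulrA -expRN -expRD ler_wpM2l ?normal_tail_ge0// ler_expR; lra.
Qed.

Lemma normal_tail_equiv (u : nat -> R) : u n @[n --> \oo] --> +oo ->
  u n * psi (u n) / phi (u n) @[n --> \oo] --> (1 : R).
Proof.
move=> uoo.
have u0 : \forall n \near \oo, 0 < u n by near=> n; near: n; apply: (cvgryPgt _).1.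
have c1 : 1 - (u n)^-1 @[n --> \oo] --> (1 : R).
  rewrite -[X in _ --> X]subr0; apply: cvgB; first exact: cvg_cst.
  exact: cvg_inv_pinfty.
apply: (squeeze_cvgr _ c1 (cvg_cst (1 : R))) => //.
near=> n.
have un : 0 < u n by near: n.
have un1 : 1 < u n by near: n; apply: (cvgryPgt _).1.
apply/andP; split; last first.
  by rewrite ler_pdivrMr ?normal_pdf01_gt0// mul1r mills_upper.
rewrite ler_pdivlMr ?normal_pdf01_gt0//.
have := mills_lower un; move/(ler_wpM2l (ltW un)); apply: le_trans.
rewrite mulrA ler_wpM2r ?normal_pdf_ge0//.
rewrite mulrA -expr2 -subr_ge0.
have -> : u n ^+ 2 / (1 + u n ^+ 2) - (1 - (u n)^-1) = (u n ^+ 2 - u n + 1) / (u n * (1 + u n ^+ 2)).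
  by field; nra.
by rewrite divr_ge0//; nra.
Unshelve. all: by end_near. Qed.

(** The excess over a high level u, multiplied by u, is asymptotically exponential. Replacing psi by
    phi / u at both levels leaves a quotient of densities, with exponent - w - (w / u)^2 / 2. *)
Lemma normal_tail_shift (u w : nat -> R) (l : R) : u n @[n --> \oo] --> +oo ->
  w n @[n --> \oo] --> l ->
  psi (u n + w n / u n) / psi (u n) @[n --> \oo] --> expR (- l).
Proof.
move=> uoo wl.
have u0 : \forall n \near \oo, 0 < u n by near=> n; near: n; apply: (cvgryPgt _).1.
have ui := cvg_inv_pinfty uoo.
pose v n := u n + w n / u n.
have wu : w n / u n @[n --> \oo] --> (0 : R).
  by rewrite -[X in _ --> X](mulr0 l); apply: cvgM.
have voo : v n @[n --> \oo] --> +oo.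
  apply/cvgryPge => A; near=> n.
  have : -1 <= w n / u n by near: n; apply: (cvgr_ge _ wu); rewrite ltrN10.
  have : A + 1 <= u n by near: n; apply: (cvgryPge _).1.
  rewrite /v; lra.
have v0 : \forall n \near \oo, 0 < v n by near=> n; near: n; apply: (cvgryPgt _).1.
have c1 := normal_tail_equiv uoo; have c2 := normal_tail_equiv voo.
have c3 : (u n * psi (u n) / phi (u n))^-1 @[n --> \oo] --> (1 : R).
  by rewrite -[X in _ --> X]invr1; apply: cvgV => //; exact: oner_neq0.
have c4 : (1 + w n / u n / u n)^-1 @[n --> \oo] --> (1 : R).
  rewrite -[X in _ --> X]invr1; apply: cvgV; first by rewrite oner_neq0.
  rewrite -[X in _ --> X]addr0; apply: cvgD; first exact: cvg_cst.
  by rewrite -[X in _ --> X](mul0r (0 : R)); apply: cvgM.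
have c5 : expR (- w n - (w n / u n) ^+ 2 / 2) @[n --> \oo] --> expR (- l).
  apply: (cvg_comp _ expR); last exact: continuous_expR.
  rewrite -[X in _ `=>` nbhs X]subr0; apply: cvgB; first exact: cvgN.
  rewrite -[X in _ --> X](mul0r (2^-1 : R)); apply: cvgM; last exact: cvg_cst.
  by rewrite -[X in _ --> X](mul0r (0 : R)); apply: cvgM.
have c6 := seq_cvgM (seq_cvgM (seq_cvgM c2 c3) c4) c5; rewrite !mul1r in c6.
apply: (eq_near_cvg _ c6); near=> n; rewrite /=.
have un : 0 < u n by near: n.
have vn : 0 < v n by near: n.
have pu := normal_tail_gt0 (u n); have pv := normal_tail_gt0 (v n).
have -> : expR (- w n - (w n / u n) ^+ 2 / 2) = phi (v n) / phi (u n).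
  have np := @normal_peak_gt0 R 1 (oner_neq0 _).
  rewrite !normal_pdf01E invfM mulrACA mulfV ?gt_eqF// mul1r -expRN -expRD.
  by congr expR; rewrite /v; field; lra.
have -> : 1 + w n / u n / u n = v n / u n by rewrite /v; field; lra.
rewrite -/(v n) /GRing.mul /=.
have f1 := normal_pdf01_gt0 (u n); have f2 := normal_pdf01_gt0 (v n).
rewrite -!/(GRing.mul _ _).
by field; rewrite !gt_eqF.
Unshelve. all: by end_near. Qed.

End NormalTail.

(** * Expectations of functions of a Gaussian variable *)

Section NormalExpectation.
Context (disp : measure_display) (Omega : measurableType disp) (R : realType).
Context (P : probability Omega R).
Notation mu := (@lebesgue_measure R).
Notation phi := (@normal_pdf R 0 1).

Lemma ge0_integral_normal_prob (m s : R) (g : R -> R) : measurable_fun setT g ->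
  (forall x, 0 <= g x) ->
  (\int[normal_prob m s]_x (g x)%:E = \int[mu]_x (g x * normal_pdf m s x)%:E)%E.
Proof.
move=> mg g0.
rewrite -(@Radon_Nikodym_SigmaFinite.change_of_variables _ _ _ (normal_prob m s) mu (normal_prob_dominates m s))//.
- apply: ae_eq_integral => //.
  + apply: emeasurable_funM; first exact/measurable_EFinP.
    apply: (measurable_int mu).
    exact: (Radon_Nikodym_SigmaFinite.f_integrable (normal_prob_dominates m s)).
  + by apply/measurable_EFinP/measurable_funM => //; exact: measurable_normal_pdf.
  + under [X in ae_eq _ _ _ X]eq_fun do rewrite EFinM.
    apply: ae_eqe_mul2l.
    apply: integral_ae_eq => //.
    * exact: (Radon_Nikodym_SigmaFinite.f_integrable (normal_prob_dominates m s)).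
    * by apply/measurable_EFinP; exact: measurable_normal_pdf.
    * move=> E _ mE.
      by rewrite -(Radon_Nikodym_SigmaFinite.f_integral (normal_prob_dominates m s)).
- exact/measurable_EFinP.
Qed.

Lemma normal_pdf_affine (m s z : R) : 0 < s -> normal_pdf m s (m + s * z) * s = phi z.
Proof.
move=> s0; rewrite normal_pdf01E normal_pdfE ?gt_eqF// /normal_fun /normal_peak.
rewrite -mulrnAr sqrtrM ?sqr_ge0// sqrtr_sqr (gtr0_norm s0) expr1n mul1r.
have p0 : 0 < Num.sqrt (pi *+ 2 : R) by rewrite sqrtr_gt0 mulrn_wgt0// pi_gt0.
rewrite [X in expR X](_ : _ = - z ^+ 2 / 2); last first.
  by rewrite -mulr_natr; field; lra.
by field; rewrite !gt_eqF.
Qed.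

Lemma ge0_integral_normal_affine (m s : R) (g : R -> R) : 0 < s -> continuous g ->
  (forall x, 0 <= g x) ->
  (\int[normal_prob m s]_x (g x)%:E = \int[mu]_z (g (m + s * z) * phi z)%:E)%E.
Proof.
move=> s0 cg g0; rewrite ge0_integral_normal_prob//; last exact: continuous_measurable_fun.
pose F (z : R) := m + s * z.
have dF (z : R) : is_derive z (1 : R) F s.
  by rewrite /F; apply: is_derive_eq; rewrite /GRing.scale /=; ring.
have F'E : F^`()%classic = cst s by apply/funext => z; rewrite derive1E; case: (dF z).
rewrite (@increasing_ge0_integration_by_substitutionT R F).
- apply: eq_integral => z _; rewrite F'E; congr EFin.
  by rewrite -(@normal_pdf_affine m s z s0) mulrA.
- by move=> x y xy; rewrite /F ltrD2l ltr_pM2l.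
- by rewrite F'E => ?; exact: cvg_cst.
- by rewrite F'E; exact: is_cvg_cst.
- by rewrite F'E; exact: is_cvg_cst.
- by move=> x; case: (dF x).
- rewrite /F; under eq_fun do rewrite addrC mulrC.
  apply: (@cvg_comp _ _ _ (fun z => z * s) (fun z => z + m)); last exact: cvg_addrr_Ny.
  exact: gt0_cvgMlNy.
- rewrite /F; under eq_fun do rewrite addrC mulrC.
  apply: (@cvg_comp _ _ _ (fun z => z * s) (fun z => z + m)); last exact: cvg_addrr.
  exact: gt0_cvgMly.
- move=> x; apply: cvgM; first exact: cg.
  by apply: continuous_normal_pdf; rewrite gt_eqF.
- by move=> x; rewrite mulr_ge0// normal_pdf_ge0.
Qed.

Lemma ge0_integral_law (d2 : measure_display) (T2 : measurableType d2)
    (Y : Omega -> T2) (nu : {measure set T2 -> \bar R}) (g : T2 -> R) :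
  measurable_fun setT Y -> (forall A, measurable A -> pushforward P Y A = nu A) ->
  measurable_fun setT g -> (forall x, 0 <= g x) ->
  (\int[P]_w (g (Y w))%:E = \int[nu]_x (g x)%:E)%E.
Proof.
move=> mY lY mg g0.
pose Y' : {mfun Omega >-> T2} := HB.pack Y (@isMeasurableFun.Build _ _ _ _ Y mY).
rewrite -(@ge0_integral_distribution _ _ _ _ _ P Y' (EFin \o g)).
- by apply: eq_measure_integral => A mA _; rewrite -lY.
- exact/measurable_EFinP.
- by move=> y; rewrite lee_fin.
Qed.

(** Writing the law as that of m + s Z with Z standard normal covers the degenerate case s = 0, so
    that later expectations need no case distinction. *)
Lemma is_gaussian_ge0_expectation (Y : Omega -> R) : measurable_fun setT Y ->
  is_gaussian P Y -> exists m s : R, [/\ 0 <= s,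
    (0 < s -> forall A, measurable A -> pushforward P Y A = normal_prob m s A) &
    forall g : R -> R, continuous g -> (forall x, 0 <= g x) ->
      (\int[P]_w (g (Y w))%:E = \int[mu]_z (g (m + s * z)%R * phi z)%:E)%E].
Proof.
move=> mY [m [s [s0 law]]]; exists m, s; split => //.
  by move=> s1 A mA; rewrite law// /gaussian_law gt_eqF.
move=> g cg g0; have mg : measurable_fun setT g by exact: continuous_measurable_fun.
have [s00|s1] := eqVneq s 0.
  rewrite (@ge0_integral_law _ _ Y (dirac m))//; last first.
    by move=> A mA; rewrite law// /gaussian_law s00 eqxx.
  rewrite integral_dirac//; last exact/measurable_EFinP.
  rewrite diracT mul1e.
  transitivity (\int[mu]_z ((g m)%:E * (phi z)%:E))%E.
    rewrite integralZl//; last exact: integrable_normal_pdf.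
    by rewrite integral_normal_pdf mule1.
  by apply: eq_integral => z _; rewrite s00 mul0r addr0 EFinM.
have s2 : 0 < s by rewrite lt_def s1.
rewrite (@ge0_integral_law _ (measurableTypeR R) Y (normal_prob m s))//; last first.
  by move=> A mA; have := law A mA; rewrite /gaussian_law (gt_eqF s2); exact.
exact: ge0_integral_normal_affine.
Qed.

Notation E X := (\int[P]_w X w).

Lemma Rintegral_probability_cst (r : R) : \int[P]_w cst r w = r.
Proof. by rewrite /Rintegral; have := expectation_cst P r; rewrite unlock => ->. Qed.

Lemma Rintegral_fin (Y : Omega -> R) (r : R) : (\int[P]_w (Y w)%:E = r%:E)%E ->
  E Y = r.
Proof. by rewrite /Rintegral => ->. Qed.

Lemma ge0_integrable_fin (Y : Omega -> R) (r : R) : measurable_fun setT Y ->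
  (forall w, 0 <= Y w) -> (\int[P]_w (Y w)%:E = r%:E)%E -> P.-integrable setT (EFin \o Y).
Proof.
move=> mY Y0 EY; apply/integrableP; split; first exact/measurable_EFinP.
under eq_integral do rewrite /= ger0_norm//.
by rewrite EY ltry.
Qed.

Lemma integrable_sqr_integrable (Y : Omega -> R) : measurable_fun setT Y ->
  P.-integrable setT (fun w => (Y w ^+ 2)%:E) -> P.-integrable setT (EFin \o Y).
Proof.
move=> mY iY; apply: (@le_integrable_norm _ _ _ _ _ (fun w => 1 + Y w ^+ 2)) => //.
  move=> w; have := sqr_ge0 (`|Y w| - 1); rewrite sqrrB1 real_normK ?num_real// -mulr_natl.
  have := normr_ge0 (Y w); lra.
rewrite /comp; under eq_fun do rewrite EFinD.
by apply: integrableD => //; exact: finite_measure_integrable_cst.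
Qed.

Lemma integrable_mul_sqr (Y Z : Omega -> R) : measurable_fun setT Y -> measurable_fun setT Z ->
  P.-integrable setT (fun w => (Y w ^+ 2)%:E) ->
  P.-integrable setT (fun w => (Z w ^+ 2)%:E) ->
  P.-integrable setT (fun w => (Y w * Z w)%:E).
Proof.
move=> mY mZ iY iZ; apply: (@le_integrable_norm _ _ _ _ (fun w => Y w * Z w) (fun w => Y w ^+ 2 + Z w ^+ 2)) => //.
- exact: measurable_funM.
- move=> w; rewrite normrM -(real_normK (num_real (Y w))) -(real_normK (num_real (Z w))).
  have := sqr_ge0 (`|Y w| - `|Z w|); have := normr_ge0 (Y w); have := normr_ge0 (Z w); nra.
- rewrite /comp; under eq_fun do rewrite EFinD.
  exact: integrableD.
Qed.

Lemma Rintegral_normal_quadratic (m s : R) :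
  (\int[mu]_z ((m + s * z)%R ^+ 2 * phi z)%:E = (m ^+ 2 + s ^+ 2)%:E)%E.
Proof.
have i0 : mu.-integrable setT (fun z => (m ^+ 2 * phi z)%:E).
  apply: (@integrable_normal_pdfM R (cst (m ^+ 2)) (m ^+ 2)) => // x /=.
  by rewrite ger0_norm ?sqr_ge0// ler_peMr ?sqr_ge0// lerDl sqr_ge0.
have i1 : mu.-integrable setT (fun z => (2 * m * s * (z * phi z))%:E).
  under eq_fun do rewrite EFinM; apply: integrableZl => //.
  apply: (@integrable_normal_pdfM R id 1) => // x /=.
  rewrite mul1r -(real_normK (num_real x)); have := sqr_ge0 (`|x| - 1); nra.
have i2 : mu.-integrable setT (fun z => (s ^+ 2 * (z ^+ 2 * phi z))%:E).
  under eq_fun do rewrite EFinM; apply: integrableZl => //.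
  apply: (@integrable_normal_pdfM R (fun z => z ^+ 2) 1) => //.
  by move=> x; rewrite mul1r ger0_norm ?sqr_ge0// lerDr.
have i3 : mu.-integrable setT (fun z => (m ^+ 2 * phi z + 2 * m * s * (z * phi z))%:E).
  by under eq_fun do rewrite EFinD; exact: integrableD.
transitivity (\int[mu]_z ((m ^+ 2 * phi z + 2 * m * s * (z * phi z)) + s ^+ 2 * (z ^+ 2 * phi z))%R%:E)%E.
  by apply: eq_integral => z _; congr EFin; ring.
rewrite -[LHS]fineK; last first.
  by apply: integrable_fin_num => //; under eq_fun do rewrite EFinD; exact: integrableD.
rewrite -/(Rintegral _ _ _) RintegralD// RintegralD// !RintegralZl//.
- by rewrite normal_sqr01 normal_mean01 Rintegral_normal_pdf01 mulr0 addr0 !mulr1.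
- apply: (@integrable_normal_pdfM R (fun z => z ^+ 2) 1) => //.
  by move=> x; rewrite mul1r ger0_norm ?sqr_ge0// lerDr.
- apply: (@integrable_normal_pdfM R id 1) => // x /=.
  rewrite mul1r -(real_normK (num_real x)); have := sqr_ge0 (`|x| - 1); nra.
- exact: integrable_normal_pdf.
Qed.

Lemma gaussian_sqr_integrable (Y : Omega -> R) : measurable_fun setT Y ->
  is_gaussian P Y -> P.-integrable setT (fun w => (Y w ^+ 2)%:E).
Proof.
move=> mY /(is_gaussian_ge0_expectation mY)[m [s [s0 _ h]]].
have csq : continuous (fun x : R => x ^+ 2) by move=> x; exact: sqr_continuous.
have := h _ csq (fun x => sqr_ge0 x); rewrite Rintegral_normal_quadratic.
apply: ge0_integrable_fin; first exact: measurable_funX.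
by move=> w; exact: sqr_ge0.
Qed.

(** The expectation formula holds for nonnegative functions, so m = 0 is read off by comparing the
    second moments of Y and Y + 1. *)
Lemma centered_gaussian_parameters (Y : Omega -> R) : measurable_fun setT Y ->
  is_gaussian P Y -> E Y = 0 -> exists s : R, [/\ 0 <= s, s ^+ 2 = \int[P]_w (Y w ^+ 2),
    (0 < s -> forall A, measurable A -> pushforward P Y A = normal_prob 0 s A) &
    forall g : R -> R, continuous g -> (forall x, 0 <= g x) ->
      (\int[P]_w (g (Y w))%:E = \int[mu]_z (g (s * z)%R * phi z)%:E)%E].
Proof.
move=> mY gY EY0; have i2 := gaussian_sqr_integrable mY gY.
have i1 := integrable_sqr_integrable mY i2.
have [m [s [s0 law h]]] := is_gaussian_ge0_expectation mY gY.
have csq : continuous (fun x : R => x ^+ 2) by move=> x; exact: sqr_continuous.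
have csq1 : continuous (fun x : R => (x + 1) ^+ 2).
  move=> x; apply: (@continuous_comp _ _ _ (fun x : R => x + 1) (fun x : R => x ^+ 2)).
    by apply: cvgD; [exact: cvg_id|exact: cvg_cst].
  exact: sqr_continuous.
have e2 : \int[P]_w (Y w ^+ 2) = m ^+ 2 + s ^+ 2.
  by apply: Rintegral_fin; rewrite (h _ csq (fun x => sqr_ge0 x)) Rintegral_normal_quadratic.
have e3 : \int[P]_w ((Y w + 1) ^+ 2) = (m + 1) ^+ 2 + s ^+ 2.
  apply: Rintegral_fin; rewrite (h _ csq1 (fun x => sqr_ge0 _)) -Rintegral_normal_quadratic.
  by apply: eq_integral => z _; congr (_ ^+ 2 * _)%:E; ring.
have m0 : m = 0.
  have : \int[P]_w ((Y w + 1) ^+ 2) = \int[P]_w (Y w ^+ 2) + (2 * E Y + 1).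
    transitivity (\int[P]_w (Y w ^+ 2 + (2 * Y w + 1))).
      by apply: eq_Rintegral => w _; ring.
    have i2Y : P.-integrable setT (fun w => (2 * Y w)%:E).
      by under eq_fun do rewrite EFinM; exact: integrableZl.
    have ic : P.-integrable setT (EFin \o cst (1 : R)) by exact: finite_measure_integrable_cst.
    rewrite RintegralD//; last first.
      by rewrite /comp; under eq_fun do rewrite EFinD; exact: integrableD.
    by rewrite RintegralD// RintegralZl// (Rintegral_probability_cst 1).
  rewrite e2 e3 EY0; lra.
exists s; split => //.
- by rewrite e2 m0 expr0n add0r.
- by move=> s1; rewrite -m0; exact: law.
- move=> g cg g0; rewrite h// m0; apply: eq_integral => z _; congr (g _ * _)%:E; ring.
Qed.

Lemma centered_gaussian_cos (Y : Omega -> R) : measurable_fun setT Y ->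
  is_gaussian P Y -> E Y = 0 ->
  \int[P]_w cos (Y w) = expR (- (\int[P]_w (Y w ^+ 2)) / 2).
Proof.
move=> mY gY EY; have [s [s0 <- _ h]] := centered_gaussian_parameters mY gY EY.
(* The function 1 + cos is nonnegative, as the expectation formula requires. *)
have cc : continuous (fun x : R => 1 + cos x).
  by move=> x; apply: cvgD; [exact: cvg_cst|exact: continuous_cos].
have c0 (x : R) : 0 <= 1 + cos x by have := cos_geN1 x; lra.
have mc : measurable_fun setT (fun w => cos (Y w)).
  by apply: measurableT_comp => //; apply: continuous_measurable_fun; exact: continuous_cos.
have ic : P.-integrable setT (EFin \o cst (1 : R)) by exact: finite_measure_integrable_cst.
have icos : P.-integrable setT (fun w => (cos (Y w))%:E).
  apply: (@le_integrable_norm _ _ _ _ (fun w => cos (Y w)) (cst 1)) => //.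
  by move=> w; exact: cos_max.
have inc : mu.-integrable setT (fun z => (cos (s * z) * phi z)%:E).
  apply: (@integrable_normal_pdfM R _ 1); first exact: measurable_cosM.
  by move=> x; rewrite mul1r (le_trans (cos_max _))// lerDl sqr_ge0.
have := h _ cc c0; move=> /(congr1 fine); rewrite -!/(Rintegral _ _ _).
rewrite RintegralD// (Rintegral_probability_cst 1).
under [X in _ = X -> _]eq_Rintegral do rewrite mulrDl mul1r.
rewrite RintegralD//; last exact: integrable_normal_pdf.
rewrite Rintegral_normal_pdf01 -/(normal_cos s) normal_cosE; lra.
Qed.

Lemma centered_gaussian_unit_tail (Y : Omega -> R) (t : R) : measurable_fun setT Y ->
  is_gaussian P Y -> E Y = 0 -> \int[P]_w (Y w ^+ 2) = 1 ->
  P [set w | t < Y w] = (normal_tail t)%:E.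
Proof.
move=> mY gY EY E2; have [s [s0 s2 law _]] := centered_gaussian_parameters mY gY EY.
have s1 : s = 1 by apply/eqP; rewrite -sqrp_eq1// s2 E2.
rewrite /normal_tail fineK ?fin_num_measure// -s1 -law ?s1//.
by congr (P _); apply/seteqP; split => w /=; rewrite in_itv/= andbT.
Qed.

End NormalExpectation.

(** * The Gaussian space spanned by the field *)

Section GaussianSpan.
Context (disp : measure_display) (Omega : measurableType disp) (R : realType).
Context (P : probability Omega R) (d : nat) (f : 'rV[R]_d -> {RV P >-> R}).
Context (f_gauss : gaussian_field f) (f_mean : forall x, ('E_P[f x] = 0)%E).
Notation E X := (\int[P]_w X w).
Implicit Types X Y Z : Omega -> R.

Definition field_span X := exists k (x : 'I_k -> 'rV[R]_d) (a : 'I_k -> R),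
  X = fun w => \sum_(i < k) a i * f (x i) w.

Lemma field_span_pt (t : 'rV[R]_d) : field_span (f t).
Proof.
exists 1%N, (fun=> t), (fun=> 1); apply/funext => w.
by rewrite big_ord1 mul1r.
Qed.

Lemma field_spanZ (c : R) X : field_span X -> field_span (fun w => c * X w).
Proof.
move=> [k [x [a ->]]]; exists k, x, (fun i => c * a i); apply/funext => w.
by rewrite mulr_sumr; apply: eq_bigr => i _; rewrite mulrA.
Qed.

Lemma field_spanD X Y : field_span X -> field_span Y -> field_span (fun w => X w + Y w).
Proof.
move=> [k [x [a ->]]] [l [y [b ->]]].
exists (k + l)%N, (fun i : 'I_(k + l) => match fintype.split i with inl i => x i | inr j => y j end),
  (fun i : 'I_(k + l) => match fintype.split i with inl i => a i | inr j => b j end).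
apply/funext => w; rewrite big_split_ord /=; congr (_ + _).
  by apply: eq_bigr => i _; rewrite (unsplitK (inl i)).
by apply: eq_bigr => i _; rewrite (unsplitK (inr i)).
Qed.

Lemma field_spanB X Y : field_span X -> field_span Y -> field_span (fun w => X w - Y w).
Proof.
move=> sX sY; have := field_spanD sX (field_spanZ (-1) sY).
by congr field_span; apply/funext => w; rewrite mulN1r.
Qed.

Lemma field_span0 : field_span (fun=> 0).
Proof.
exists 0%N, (fun=> 0), (fun=> 0); apply/funext => w; by rewrite big_ord0.
Qed.

Lemma field_span_measurable X : field_span X -> measurable_fun setT X.
Proof.
move=> [k [x [a ->]]]; apply: measurable_sum => i.
exact: measurable_funM.
Qed.

Lemma field_span_gaussian X : field_span X -> is_gaussian P X.
Proof. by move=> [k [x [a ->]]]; exact: f_gauss. Qed.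

Lemma field_span_sqr_integrable X : field_span X ->
  P.-integrable setT (fun w => (X w ^+ 2)%:E).
Proof.
move=> sX; apply: gaussian_sqr_integrable; first exact: field_span_measurable.
exact: field_span_gaussian.
Qed.

Lemma field_span_mul_integrable X Y : field_span X -> field_span Y ->
  P.-integrable setT (fun w => (X w * Y w)%:E).
Proof.
move=> sX sY; apply: integrable_mul_sqr; try exact: field_span_measurable;
exact: field_span_sqr_integrable.
Qed.

Lemma field_span_integrable X : field_span X -> P.-integrable setT (EFin \o X).
Proof.
move=> sX; apply: integrable_sqr_integrable; first exact: field_span_measurable.
exact: field_span_sqr_integrable.
Qed.

Lemma field_span_mean X : field_span X -> E X = 0.
Proof.
move=> [k [x [a ->]]]; elim: k x a => [|k IH] x a.
  under eq_Rintegral do rewrite big_ord0.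
  exact: Rintegral_probability_cst.
under eq_Rintegral do rewrite big_ord_recr /=.
rewrite RintegralD//.
- rewrite IH add0r RintegralZl//; last exact/field_span_integrable/field_span_pt.
  have := f_mean (x ord_max); rewrite unlock /Rintegral => -> /=.
  by rewrite mulr0.
- apply: field_span_integrable.
  by exists k, (fun i => x (widen_ord (leqnSn k) i)), (fun i => a (widen_ord (leqnSn k) i)).
- exact/field_span_integrable/field_spanZ/field_span_pt.
Qed.

(** The covariance, since every variable of the span has mean zero. *)
Definition field_ip X Y : R := \int[P]_w (X w * Y w).

Lemma field_ipC X Y : field_ip X Y = field_ip Y X.
Proof. by apply: eq_Rintegral => w _; rewrite mulrC. Qed.

Lemma field_ipDl X Y Z : field_span X -> field_span Y -> field_span Z ->
  field_ip (fun w => X w + Y w) Z = field_ip X Z + field_ip Y Z.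
Proof.
move=> sX sY sZ; rewrite /field_ip -RintegralD//; try exact: field_span_mul_integrable.
by apply: eq_Rintegral => w _; rewrite mulrDl.
Qed.

Lemma field_ipZl (c : R) X Z : field_span X -> field_span Z ->
  field_ip (fun w => c * X w) Z = c * field_ip X Z.
Proof.
move=> sX sZ; rewrite /field_ip -RintegralZl//; last exact: field_span_mul_integrable.
by apply: eq_Rintegral => w _; rewrite mulrA.
Qed.

Lemma field_ipBl X Y Z : field_span X -> field_span Y -> field_span Z ->
  field_ip (fun w => X w - Y w) Z = field_ip X Z - field_ip Y Z.
Proof.
move=> sX sY sZ; rewrite /field_ip -RintegralB//; try exact: field_span_mul_integrable.
by apply: eq_Rintegral => w _; rewrite mulrBl.
Qed.

Lemma field_ipDr X Y Z : field_span X -> field_span Y -> field_span Z ->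
  field_ip Z (fun w => X w + Y w) = field_ip Z X + field_ip Z Y.
Proof. by move=> sX sY sZ; rewrite field_ipC field_ipDl// ![field_ip _ Z]field_ipC. Qed.

Lemma field_ipZr (c : R) X Z : field_span X -> field_span Z ->
  field_ip Z (fun w => c * X w) = c * field_ip Z X.
Proof. by move=> sX sZ; rewrite field_ipC field_ipZl// [field_ip _ Z]field_ipC. Qed.

Lemma field_ipBr X Y Z : field_span X -> field_span Y -> field_span Z ->
  field_ip Z (fun w => X w - Y w) = field_ip Z X - field_ip Z Y.
Proof. by move=> sX sY sZ; rewrite field_ipC field_ipBl// ![field_ip _ Z]field_ipC. Qed.

Lemma field_ip_ge0 X : 0 <= field_ip X X.
Proof. by apply: Rintegral_ge0 => w _; rewrite -expr2 sqr_ge0. Qed.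

Lemma field_ip_sqr X : field_ip X X = \int[P]_w (X w ^+ 2).
Proof. by apply: eq_Rintegral => w _; rewrite expr2. Qed.

Lemma cauchy_schwarz_field X Y : field_span X -> field_span Y ->
  field_ip X Y ^+ 2 <= field_ip X X * field_ip Y Y.
Proof.
move=> sX sY.
have h (c e : R) : 0 <= c ^+ 2 * field_ip X X - 2 * c * e * field_ip X Y + e ^+ 2 * field_ip Y Y.
  have sc := field_spanZ c sX; have se := field_spanZ e sY.
  have := field_ip_ge0 (fun w => c * X w - e * Y w).
  rewrite field_ipBl//; last exact: field_spanB.
  rewrite !field_ipBr// !field_ipZl// !field_ipZr// (field_ipC Y X).
  by congr (0 <= _); ring.
have [y0|y0] := eqVneq (field_ip Y Y) 0.
  have [->|xy] := eqVneq (field_ip X Y) 0; first by rewrite expr0n/= y0 mulr0.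
  (* If E Y^2 = 0 while E XY is not 0, this coefficient gives the nonnegative form the value -1. *)
  have := h 1 ((field_ip X X + 1) / (2 * field_ip X Y)).
  rewrite y0 mulr0 addr0 expr1n mul1r mulr1.
  rewrite [X in _ - X](_ : _ = field_ip X X + 1); last by field.
  lra.
have yp : 0 < field_ip Y Y by rewrite lt_def y0 field_ip_ge0.
have := h (field_ip Y Y) (field_ip X Y); move=> h1.
have : 0 <= field_ip Y Y * (field_ip X X * field_ip Y Y - field_ip X Y ^+ 2).
  by apply: le_trans h1 _; rewrite le_eqVlt; apply/orP; left; apply/eqP; ring.
by rewrite pmulr_rge0// subr_ge0.
Qed.

Lemma field_span_cos X : field_span X ->
  \int[P]_w cos (X w) = expR (- field_ip X X / 2).
Proof.
move=> sX; rewrite centered_gaussian_cos.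
- by rewrite field_ip_sqr.
- exact: field_span_measurable.
- exact: field_span_gaussian.
- exact: field_span_mean.
Qed.

Lemma measurable_cosD X (th : R) : measurable_fun setT X ->
  measurable_fun setT (fun w => cos (X w + th)).
Proof.
move=> mX; apply: (@measurableT_comp _ _ _ _ _ _ cos).
  by apply: continuous_measurable_fun; exact: continuous_cos.
exact: measurable_funD.
Qed.

Lemma integrable_bounded (h : Omega -> R) (C : R) : measurable_fun setT h ->
  (forall w, `|h w| <= C) -> P.-integrable setT (EFin \o h).
Proof.
move=> mh hC; apply: (@le_integrable_norm _ _ _ _ h (cst C)) => //.
exact: finite_measure_integrable_cst.
Qed.

(** X and - X have the same variance, hence the same law, and sin is odd. *)
Lemma field_span_sin X : field_span X -> \int[P]_w sin (X w) = 0.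
Proof.
move=> sX; have sN := field_spanZ (-1) sX.
have [s [s0 s2 _ h]] := centered_gaussian_parameters (field_span_measurable sX)
  (field_span_gaussian sX) (field_span_mean sX).
have [s' [s'0 s'2 _ h']] := centered_gaussian_parameters (field_span_measurable sN)
  (field_span_gaussian sN) (field_span_mean sN).
have ss' : s = s'.
  apply/eqP; rewrite -(@eqrXn2 _ 2)// s2 s'2; apply/eqP.
  by apply: eq_Rintegral => w _; rewrite mulN1r sqrrN.
have cc : continuous (fun x : R => 1 + sin x).
  by move=> x; apply: cvgD; [exact: cvg_cst|exact: continuous_sin].
have c0 (x : R) : 0 <= 1 + sin x by have := sin_geN1 x; lra.
have := h' _ cc c0; rewrite -ss' -(h _ cc c0) => /(congr1 fine).
rewrite -!/(Rintegral _ _ _).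
have ms (Y : Omega -> R) : measurable_fun setT Y -> measurable_fun setT (fun w => sin (Y w)).
  move=> mY; apply: (@measurableT_comp _ _ _ _ _ _ sin) => //.
  by apply: continuous_measurable_fun; exact: continuous_sin.
have ic : P.-integrable setT (EFin \o cst (1 : R)) by exact: finite_measure_integrable_cst.
have i1 : P.-integrable setT (fun w => (sin (X w))%:E).
  apply: (@integrable_bounded (fun w => sin (X w)) 1) => [|w]; last exact: sin_max.
  exact/ms/field_span_measurable.
have i2 : P.-integrable setT (fun w => (sin (-1 * X w))%:E).
  apply: (@integrable_bounded (fun w => sin (-1 * X w)) 1) => [|w]; last exact: sin_max.
  exact/ms/field_span_measurable.
rewrite RintegralD// RintegralD//.
have -> : \int[P]_x sin (-1 * X x) = -1 * \int[P]_x sin (X x).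
  by rewrite -RintegralZl//; apply: eq_Rintegral => w _; rewrite !mulN1r sinN.
lra.
Qed.

Lemma field_span_cosD X (th : R) : field_span X ->
  \int[P]_w cos (X w + th) = cos th * expR (- field_ip X X / 2).
Proof.
move=> sX.
have mX := field_span_measurable sX.
have i1 : P.-integrable setT (fun w => (sin (X w))%:E).
  apply: (@integrable_bounded (fun w => sin (X w)) 1) => [|w]; last exact: sin_max.
  apply: (@measurableT_comp _ _ _ _ _ _ sin) => //.
  by apply: continuous_measurable_fun; exact: continuous_sin.
have i2 : P.-integrable setT (fun w => (cos (X w))%:E).
  apply: (@integrable_bounded (fun w => cos (X w)) 1) => [|w]; last exact: cos_max.
  have := @measurable_cosD X 0 mX.
  by congr measurable_fun; apply/funext => w; rewrite addr0.
transitivity (\int[P]_w (cos th * cos (X w) - sin th * sin (X w))).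
  by apply: eq_Rintegral => w _; rewrite cosD; ring.
rewrite RintegralB//.
- by rewrite !RintegralZl// field_span_cos// field_span_sin// mulr0 subr0.
- by rewrite /comp; under eq_fun do rewrite EFinM; exact: integrableZl.
- by rewrite /comp; under eq_fun do rewrite EFinM; exact: integrableZl.
Qed.

Lemma field_span_tail X (t : R) : field_span X -> 0 < field_ip X X ->
  P [set w | t < X w] = (normal_tail (t / Num.sqrt (field_ip X X)))%:E.
Proof.
move=> sX v0; set s := Num.sqrt _; have s0 : 0 < s by rewrite sqrtr_gt0.
have sY := field_spanZ s^-1 sX.
rewrite -(@centered_gaussian_unit_tail _ _ _ P (fun w => s^-1 * X w)).
- by congr (P _); apply/seteqP; split => w /=; rewrite (mulrC s^-1) ltr_pM2r ?invr_gt0.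
- exact: field_span_measurable.
- exact: field_span_gaussian.
- exact: field_span_mean.
- rewrite -field_ip_sqr field_ipZl// field_ipZr// mulrA -expr2 exprVn sqr_sqrtr ?ltW//.
  by rewrite mulVf ?gt_eqF.
Qed.

Context (f_var : forall x, ('V_P[f x] = 1)%E) (f_stat : stationary f).

Lemma field_ip_diag (x : 'rV[R]_d) : field_ip (f x) (f x) = 1.
Proof.
have := f_var x; rewrite /variance unlock.
rewrite f_mean /= => /(congr1 fine) /= <-; rewrite unlock.
by apply: eq_Rintegral => w _; rewrite /= !fctE /= /cst subr0.
Qed.

(** Polarisation: stationarity fixes the law of the pair, and only the nonnegative function (s +
    t)^2 of it has to be integrated. *)
Lemma field_ip_stat (x y : 'rV[R]_d) : field_ip (f x) (f y) = cov_kernel f (y - x).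
Proof.
have sx := field_span_pt x; have sy := field_span_pt y.
have s0 := field_span_pt 0; have sz := field_span_pt (y - x).
have -> : cov_kernel f (y - x) = field_ip (f 0) (f (y - x)).
  by rewrite /cov_kernel unlock.
have key : \int[P]_w ((f x w + f y w) ^+ 2) = \int[P]_w ((f 0 w + f (y - x) w) ^+ 2).
  pose p (i : 'I_2) := if i == ord0 then 0 else y - x : 'rV[R]_d.
  have mt (q : 'I_2 -> 'rV[R]_d) : measurable_fun setT (marginal f q).
    apply/measurable_fun_tnthP => i.
    rewrite (_ : _ \o _ = f (q i))//.
    by apply/funext => w /=; rewrite tnth_mktuple.
  pose g (v : 2.-tuple R) := (tnth v ord0 + tnth v ord_max) ^+ 2.
  have mg : measurable_fun setT g.
    by apply: measurable_funX; apply: measurable_funD; exact: measurable_tnth.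
  have g0 v : 0 <= g v by exact: sqr_ge0.
  have e (q : 'I_2 -> 'rV[R]_d) w : g (marginal f q w) = (f (q ord0) w + f (q ord_max) w) ^+ 2.
    by rewrite /g !tnth_mktuple.
  pose m0 : {mfun Omega >-> 2.-tuple R} := HB.pack (marginal f p) (@isMeasurableFun.Build _ _ _ _ (marginal f p) (mt p)).
  transitivity (\int[P]_w g (marginal f (fun i => p i + x) w)).
    by apply: eq_Rintegral => w _; rewrite e /p /= add0r subrK.
  transitivity (\int[P]_w g (marginal f p w)); last first.
    by apply: eq_Rintegral => w _; rewrite e /p /=.
  rewrite /Rintegral (@ge0_integral_law _ _ _ P _ _ (marginal f p) (distribution P m0) g)//.
  rewrite (@ge0_integral_law _ _ _ P _ _ _ (distribution P m0) g)//.
  by move=> A mA; rewrite f_stat.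
rewrite -!field_ip_sqr in key.
move: key; rewrite !field_ipDl ?field_ipDr//; try exact: field_spanD.
by rewrite !field_ip_diag (field_ipC (f y)) (field_ipC (f (y - x))); lra.
Qed.

End GaussianSpan.

(** * Independence of orthogonal Gaussian variables *)

Section Threshold.
Context (R : realType).

(* A polynomial approximation of the indicator of [t < 1/2] on [0, 1]. *)
Definition threshold_poly (n : nat) (t : R) : R := (1 - t ^+ n) ^+ (n * 2 ^ n).

Lemma threshold_poly_ge0 n t : 0 <= t <= 1 -> 0 <= threshold_poly n t.
Proof.
by move=> /andP[t0 t1]; rewrite exprn_ge0// subr_ge0 exprn_ile1.
Qed.

Lemma threshold_poly_le1 n t : 0 <= t <= 1 -> threshold_poly n t <= 1.
Proof.
move=> /andP[t0 t1]; rewrite exprn_ile1// ?subr_ge0 ?exprn_ile1//.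
by rewrite lerBlDr lerDl exprn_ge0.
Qed.

Lemma bernoulli_ge (x : R) k : 0 <= x <= 1 -> 1 - k%:R * x <= (1 - x) ^+ k.
Proof.
move=> /andP[x0 x1]; elim: k => [|k IH]; first by rewrite mul0r subr0 expr0.
rewrite exprS; apply: (@le_trans _ _ ((1 - x) * (1 - k%:R * x))).
  rewrite -natr1; have := mulr_ge0 (mulr_ge0 (ler0n R k) x0) x0; lra.
by rewrite ler_wpM2l// subr_ge0.
Qed.

Lemma bernoulli_le (x : R) k : 0 <= x <= 1 -> (1 - x) ^+ k * (1 + k%:R * x) <= 1.
Proof.
move=> /andP[x0 x1]; elim: k => [|k IH]; first by rewrite mul0r addr0 expr0 mulr1.
apply: le_trans IH; rewrite exprSr -mulrA ler_wpM2l ?exprn_ge0 ?subr_ge0//.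
rewrite -natr1; have := mulr_ge0 (mulr_ge0 (ler0n R k) x0) x0.
have := mulr_ge0 x0 x0; lra.
Qed.

Lemma cvg_natM_expr (x : R) : 0 <= x < 1 -> n%:R * x ^+ n @[n --> \oo] --> (0 : R).
Proof.
move=> /andP[x0 x1].
have [->|xn0] := eqVneq x 0.
  apply: cvg_near_cst; near=> n; rewrite expr0n gtn_eqF ?mulr0//.
  by near: n; exact: nbhs_infty_gt.
have xp : 0 < x by rewrite lt_def xn0.
pose y := Num.sqrt x.
have y0 : 0 < y by rewrite sqrtr_gt0.
have y1 : y < 1 by rewrite -sqrtr1 ltr_sqrt.
have yx : y ^+ 2 = x by rewrite sqr_sqrtr.
have b n : n%:R * (1 - y) * y ^+ n <= 1.
  have := @bernoulli_le (1 - y) n; rewrite subr_ge0 (ltW y1) lerBlDr lerDl (ltW y0).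
  move=> /(_ isT); rewrite opprB addrC subrK.
  apply: le_trans; rewrite [leRHS]mulrC ler_wpM2r ?exprn_ge0 ?(ltW y0)// lerDr//.
have c : (1 - y)^-1 * y ^+ n @[n --> \oo] --> (0 : R).
  rewrite -[X in _ --> X](mulr0 (1 - y)^-1); apply: seq_cvgM; first exact: cvg_cst.
  by apply: cvg_expr; rewrite ger0_norm// ltW.
apply: (squeeze_cvgr _ (cvg_cst (0 : R)) c); near=> n.
rewrite mulr_ge0 ?exprn_ge0//= ?(ltW xp)// -yx -exprM mulnC exprM expr2 mulrA.
rewrite ler_wpM2r ?exprn_ge0 ?(ltW y0)// -[leRHS]mul1r ler_pdivlMr ?subr_gt0//.
by have := b n; rewrite mulrAC.
Unshelve. all: by end_near. Qed.

(** The exponent n 2^n acts through n 2^n t^n = n (2 t)^n, which tends to 0 for t < 1/2 and is at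
    least n for t >= 1/2, the endpoint included. The Bernoulli inequalities convert this into bounds
    on the power. *)
Lemma cvg_threshold_poly (t : R) : 0 <= t <= 1 ->
  threshold_poly n t @[n --> \oo] --> ((t < 2^-1)%R%:R : R).
Proof.
move=> t01; have /andP[t0 t1] := t01.
have tn n : 0 <= t ^+ n <= 1 by rewrite exprn_ge0//= exprn_ile1.
have E n : (n * 2 ^ n)%:R * t ^+ n = n%:R * (2 * t) ^+ n :> R.
  by rewrite natrM natrX exprMn mulrA.
have [th|th] := ltP t 2^-1.
  have c : 1 - n%:R * (2 * t) ^+ n @[n --> \oo] --> (1 : R).
    rewrite -[X in _ --> X]subr0; apply: seq_cvgB; first exact: cvg_cst.
    by apply: cvg_natM_expr; lra.
  apply: (squeeze_cvgr _ c (cvg_cst (1 : R))); near=> n.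
  by rewrite threshold_poly_le1// andbT -E bernoulli_ge.
apply: (squeeze_cvgr _ (cvg_cst (0 : R)) (@cvg_invn0 R)); near=> n.
rewrite threshold_poly_ge0//=.
have n0 : 0 < n%:R :> R by rewrite ltr0n; near: n; exact: nbhs_infty_gt.
have := @bernoulli_le (t ^+ n) (n * 2 ^ n) (tn n); rewrite E -/(threshold_poly n t) => h.
rewrite -[leRHS]mul1r ler_pdivlMr//; apply: le_trans h.
rewrite ler_wpM2l ?threshold_poly_ge0//.
have : 1 <= (2 * t) ^+ n by rewrite exprn_ege1//; lra.
move=> h; apply: (@le_trans _ _ (n%:R * (2 * t) ^+ n)); last by rewrite lerDr.
by rewrite ler_peMr// ltW.
Unshelve. all: by end_near. Qed.

(** Takes values in [0, 1], and is below 1/2 exactly for x < c as long as |x - c| < pi (N + 1).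
    Polynomials in it are trigonometric polynomials in x. *)
Definition sin_level (N : nat) (c x : R) : R := (1 + sin ((x - c) / N.+1%:R)) / 2.

Lemma sin_level01 N c x : 0 <= sin_level N c x <= 1.
Proof.
by rewrite /sin_level; have := @sin_geN1 R ((x - c) / N.+1%:R);
have := @sin_le1 R ((x - c) / N.+1%:R); lra.
Qed.

Lemma sin_level_lt (c x : R) : \forall N \near \oo, (sin_level N c x < 2^-1) = (x < c).
Proof.
near=> N.
have N0 : 0 < N.+1%:R :> R by rewrite ltr0n.
have p0 := @pi_gt0 R.
have hN : `|x - c| / N.+1%:R < pi.
  rewrite ltr_pdivrMr// -ltr_pdivrMl//.
  apply: (@lt_trans _ _ N%:R); last by rewrite ltr_nat.
  by near: N; exact: nbhs_infty_gtr.
rewrite /sin_level; set y := (x - c) / N.+1%:R.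
have -> : (x < c) = (y < 0) by rewrite /y pmulr_llt0 ?invr_gt0// subr_lt0.
have yp : `|y| < pi by rewrite /y normrM (gtr0_norm (_ : 0 < N.+1%:R^-1)) ?invr_gt0.
have [y0|y0] := ltP y 0.
  have : 0 < sin (- y).
    by apply: sin_gt0_pi; rewrite oppr_gt0 y0 /=; move: yp; rewrite ltr0_norm.
  by rewrite sinN => h; apply/idP; lra.
have : 0 <= sin y.
  by apply: sin_ge0_pi; rewrite y0 /=; move: yp; rewrite ger0_norm// => /ltW.
by move=> h; apply/negbTE; rewrite -leNgt; lra.
Unshelve. all: by end_near. Qed.

End Threshold.

(** * Factorisation of expectations over orthogonal subspaces *)

Section Independence.
Context (disp : measure_display) (Omega : measurableType disp) (R : realType).
Context (P : probability Omega R) (d : nat) (f : 'rV[R]_d -> {RV P >-> R}).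
Context (f_gauss : gaussian_field f) (f_mean : forall x, ('E_P[f x] = 0)%E).
Notation E X := (\int[P]_w X w).
Notation span := (field_span f).
Notation ip := (field_ip P).
Implicit Types (X Y Z : Omega -> R) (S : (Omega -> R) -> Prop).

(** The phases let the class contain sines, and over a subspace also constants and products. *)
Inductive trig_poly S : (Omega -> R) -> Prop :=
| trig_cos c X th : S X -> trig_poly S (fun w => c * cos (X w + th))
| trig_add g h : trig_poly S g -> trig_poly S h -> trig_poly S (fun w => g w + h w).

Definition subspace S := [/\ S (fun=> 0), forall c X, S X -> S (fun w => c * X w)
  & forall X Y, S X -> S Y -> S (fun w => X w + Y w)].

Lemma trig_polyM S g h : subspace S -> trig_poly S g -> trig_poly S h ->
  trig_poly S (fun w => g w * h w).
Proof.
move=> [S0 SZ SD] Tg Th; elim: Tg => [c X th SX|g1 g2 _ IH1 _ IH2]; last first.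
  have -> : (fun w => (g1 w + g2 w) * h w) = fun w => g1 w * h w + g2 w * h w.
    by apply/funext => w; rewrite mulrDl.
  exact: trig_add.
elim: Th => [e Y ph SY|h1 h2 _ IH1 _ IH2]; last first.
  have -> : (fun w => c * cos (X w + th) * (h1 w + h2 w)) =
     fun w => c * cos (X w + th) * h1 w + c * cos (X w + th) * h2 w.
    by apply/funext => w; rewrite mulrDr.
  exact: trig_add.
have -> : (fun w => c * cos (X w + th) * (e * cos (Y w + ph))) =
   fun w => (c * e / 2) * cos ((X w + Y w) + (th + ph))
      + (c * e / 2) * cos ((X w + -1 * Y w) + (th - ph)).
  apply/funext => w.
  have -> : X w + Y w + (th + ph) = (X w + th) + (Y w + ph) by ring.
  have -> : X w + -1 * Y w + (th - ph) = (X w + th) - (Y w + ph) by ring.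
  by move: (X w + th) (Y w + ph) => A B; rewrite cosD cosB; field.
by apply: trig_add; apply: trig_cos; apply: SD => //; apply: SZ.
Qed.

Lemma trig_poly_cst S (c : R) : subspace S -> trig_poly S (fun=> c).
Proof.
move=> [S0 _ _]; have := @trig_cos S c _ 0 S0.
by congr trig_poly; apply/funext => w; rewrite addr0 cos0 mulr1.
Qed.

Lemma trig_polyX S g n : subspace S -> trig_poly S g -> trig_poly S (fun w => g w ^+ n).
Proof.
move=> sS Tg; elim: n => [|n IH]; first exact: trig_poly_cst.
have := trig_polyM sS Tg IH.
by congr trig_poly; apply/funext => w; rewrite exprS.
Qed.

Lemma trig_poly_threshold S X (c : R) (N n : nat) : subspace S -> S X ->
  trig_poly S (fun w => threshold_poly n (sin_level N c (X w))).
Proof.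
move=> sS SX; have [_ SZ SD] := sS; rewrite /threshold_poly; apply: trig_polyX => //.
have TX : trig_poly S (fun w => sin_level N c (X w) ^+ n).
  apply: trig_polyX => //.
  have h1 := trig_poly_cst 2^-1 sS.
  have h2 := @trig_cos S 2^-1 _ (- (c / N.+1%:R) - pi / 2) (SZ N.+1%:R^-1 _ SX).
  have := trig_add h1 h2; congr trig_poly; apply/funext => w.
  rewrite /sin_level addrA cosB cos_pihalf sin_pihalf mulr0 add0r mulr1.
  by rewrite (mulrC _^-1 (X w)) -mulrBl; move: (sin _) => s; field.
have := trig_add (trig_poly_cst 1 sS) (trig_polyM sS (trig_poly_cst (-1) sS) TX).
by congr trig_poly; apply/funext => w; rewrite mulN1r.
Qed.

Lemma trig_poly_measurable S g : (forall X, S X -> measurable_fun setT X) ->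
  trig_poly S g -> measurable_fun setT g.
Proof.
move=> mS; elim=> [c X th SX|g1 g2 _ IH1 _ IH2]; last exact: measurable_funD.
by apply: measurable_funM => //; apply: measurable_cosD; exact: mS.
Qed.

Lemma trig_poly_bounded S g : trig_poly S g -> exists C, forall w, `|g w| <= C.
Proof.
elim=> [c X th SX|g1 g2 _ [C1 h1] _ [C2 h2]].
  by exists `|c| => w; rewrite normrM ler_piMr// cos_max.
by exists (C1 + C2) => w; rewrite (le_trans (ler_normD _ _))// lerD.
Qed.

(** For a single cosine on each side, the product formula leaves cosines of X + Y and X - Y. By
    orthogonality both have variance Var X + Var Y, so the exponential factorises. *)
Lemma trig_poly_factor (SX SY : (Omega -> R) -> Prop) g h :
  (forall X, SX X -> span X) -> (forall Y, SY Y -> span Y) ->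
  (forall X Y, SX X -> SY Y -> ip X Y = 0) ->
  trig_poly SX g -> trig_poly SY h ->
  E (fun w => g w * h w) = E g * E h.
Proof.
move=> sX sY ort Tg Th.
have mX g' : trig_poly SX g' -> measurable_fun setT g'.
  by apply: trig_poly_measurable => X /sX; exact: field_span_measurable.
have mY g' : trig_poly SY g' -> measurable_fun setT g'.
  by apply: trig_poly_measurable => X /sY; exact: field_span_measurable.
have iX g' : trig_poly SX g' -> P.-integrable setT (EFin \o g').
  move=> Tg'; have [C hC] := trig_poly_bounded Tg'.
  by apply: (@integrable_bounded _ _ _ _ _ C) => //; exact: mX.
have iY g' : trig_poly SY g' -> P.-integrable setT (EFin \o g').
  move=> Tg'; have [C hC] := trig_poly_bounded Tg'.
  by apply: (@integrable_bounded _ _ _ _ _ C) => //; exact: mY.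
have iXY g' h' : trig_poly SX g' -> trig_poly SY h' ->
    P.-integrable setT (EFin \o (fun w => g' w * h' w)).
  move=> Tg' Th'; have [C hC] := trig_poly_bounded Tg'; have [D hD] := trig_poly_bounded Th'.
  apply: (@integrable_bounded _ _ _ _ (fun w => g' w * h' w) (C * D)).
    by apply: measurable_funM; [exact: mX|exact: mY].
  by move=> w; rewrite normrM ler_pM.
elim: Tg => [c X th SXX|g1 g2 T1 IH1 T2 IH2]; last first.
  under eq_Rintegral do rewrite mulrDl.
  rewrite (RintegralD measurableT (iXY _ _ T1 Th) (iXY _ _ T2 Th)).
  by rewrite IH1 IH2 (RintegralD measurableT (iX _ T1) (iX _ T2)) mulrDl.
have Tc : trig_poly SX (fun w => c * cos (X w + th)) by exact: trig_cos.
elim: Th => [e Y ph SYY|h1 h2 T1 IH1 T2 IH2]; last first.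
  under eq_Rintegral do rewrite mulrDr.
  rewrite (RintegralD measurableT (iXY _ _ Tc T1) (iXY _ _ Tc T2)).
  by rewrite IH1 IH2 (RintegralD measurableT (iY _ T1) (iY _ T2)) mulrDr.
have X1 := sX _ SXX; have Y1 := sY _ SYY.
have ic (Z : Omega -> R) z : span Z -> P.-integrable setT (fun w => (cos (Z w + z))%:E).
  move=> sZ; apply: (@integrable_bounded _ _ _ _ (fun w => cos (Z w + z)) 1).
    exact: (measurable_cosD _ (field_span_measurable sZ)).
  by move=> w; exact: cos_max.
have D1 := field_spanD X1 Y1; have D2 := field_spanB X1 Y1.
transitivity (\int[P]_w ((c * e / 2) * cos ((X w + Y w) + (th + ph))
   + (c * e / 2) * cos ((X w - Y w) + (th - ph)))).
  apply: eq_Rintegral => w _.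
  have -> : X w + Y w + (th + ph) = (X w + th) + (Y w + ph) by ring.
  have -> : X w - Y w + (th - ph) = (X w + th) - (Y w + ph) by ring.
  by move: (X w + th) (Y w + ph) => A B; rewrite cosD cosB; field.
rewrite RintegralD//; last 2 first.
- by rewrite /comp; under eq_fun do rewrite EFinM; apply: integrableZl => //; exact: ic.
- by rewrite /comp; under eq_fun do rewrite EFinM; apply: integrableZl => //; exact: ic.
rewrite !RintegralZl//; try exact: ic.
have oXY := ort _ _ SXX SYY.
have ep : ip (fun w => X w + Y w) (fun w => X w + Y w) = ip X X + ip Y Y.
  by rewrite (field_ipDl f_gauss)// !(field_ipDr f_gauss)// (field_ipC P Y X) oXY addr0 add0r.
have em : ip (fun w => X w - Y w) (fun w => X w - Y w) = ip X X + ip Y Y.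
  rewrite (field_ipBl f_gauss)// !(field_ipBr f_gauss)// (field_ipC P Y X) oXY.
  by rewrite subr0 sub0r opprK.
rewrite !(field_span_cosD f_gauss f_mean)// ep em.
have -> : expR (- (ip X X + ip Y Y) / 2) = expR (- ip X X / 2) * expR (- ip Y Y / 2).
  by rewrite -expRD; congr expR; lra.
by rewrite cosD cosB; field.
Qed.

Lemma factor_limit (g h : nat -> Omega -> R) (g0 h0 : Omega -> R) :
  (forall n, measurable_fun setT (g n)) -> (forall n, measurable_fun setT (h n)) ->
  measurable_fun setT g0 -> measurable_fun setT h0 ->
  (forall n w, `|g n w| <= 1) -> (forall n w, `|h n w| <= 1) ->
  (forall w, g ^~ w @ \oo --> g0 w) -> (forall w, h ^~ w @ \oo --> h0 w) ->
  (forall n, E (fun w => g n w * h n w) = E (g n) * E (h n)) ->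
  E (fun w => g0 w * h0 w) = E g0 * E h0.
Proof.
move=> mg mh mg0 mh0 g1 h1 cg ch eq.
have i1 : P.-integrable setT (EFin \o cst (1 : R)) by exact: finite_measure_integrable_cst.
have c1 : E (g n) @[n --> \oo] --> E g0 by exact: (@dominated_cvg_Rintegral _ _ _ _ _ _ (cst 1)).
have c2 : E (h n) @[n --> \oo] --> E h0 by exact: (@dominated_cvg_Rintegral _ _ _ _ _ _ (cst 1)).
have c3 : E (fun w => g n w * h n w) @[n --> \oo] --> E (fun w => g0 w * h0 w).
  apply: (@dominated_cvg_Rintegral _ _ _ P (fun n w => g n w * h n w) (fun w => g0 w * h0 w) (cst 1)) => //.
  - by move=> n; exact: measurable_funM.
  - exact: measurable_funM.
  - by move=> w; exact: seq_cvgM.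
  - by move=> n w; rewrite normrM mulr_ile1.
have c4 := seq_cvgM c1 c2.
have c5 : (fun n => E (g n) * E (h n)) @ \oo --> E (fun w => g0 w * h0 w).
  by under eq_fun do rewrite -eq.
by rewrite -(cvg_lim _ c5)// (cvg_lim _ c4).
Qed.

Lemma trig_poly_prod S k (h : 'I_k -> Omega -> R) : subspace S ->
  (forall j, trig_poly S (h j)) -> trig_poly S (fun w => \prod_j h j w).
Proof.
move=> sS; elim: k h => [|k IH] h Th.
  have := trig_poly_cst 1 sS.
  by congr trig_poly; apply/funext => w; rewrite big_ord0.
have := trig_polyM sS (IH (fun j => h (widen_ord (leqnSn k) j)) (fun j => Th _)) (Th ord_max).
by congr trig_poly; apply/funext => w; rewrite big_ord_recr.
Qed.

Lemma seq_cvg_prod k (u : nat -> 'I_k -> R) (l : 'I_k -> R) :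
  (forall j, (fun n => u n j) @ \oo --> l j) ->
  (fun n => \prod_j u n j) @ \oo --> \prod_j l j.
Proof.
elim: k u l => [|k IH] u l ul.
  rewrite big_ord0; apply: (eq_near_cvg _ (cvg_cst (1 : R))).
  by near=> n; rewrite big_ord0.
rewrite big_ord_recr /=.
have h := IH (fun n j => u n (widen_ord (leqnSn k) j)) _ (fun j => ul _).
apply: (eq_near_cvg _ (seq_cvgM h (ul ord_max))).
by near=> n; rewrite big_ord_recr.
Unshelve. all: by end_near. Qed.

Lemma measurable_threshold X (c : R) N n : measurable_fun setT X ->
  measurable_fun setT (fun w => threshold_poly n (sin_level N c (X w))).
Proof.
move=> mX; apply: measurable_funX; apply: measurable_funB => //.
apply: measurable_funX; apply: measurable_funM => //; apply: measurable_funD => //.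
apply: (@measurableT_comp _ _ _ _ _ _ sin).
  by apply: continuous_measurable_fun; exact: continuous_sin.
by apply: measurable_funM => //; exact: measurable_funB.
Qed.

Lemma measurable_ltR X (c : R) : measurable_fun setT X -> measurable [set w | X w < c].
Proof.
move=> mX; have := mX measurableT _ (measurable_itv `]-oo, c[).
by rewrite setTI; congr measurable; apply/seteqP; split => w /=; rewrite in_itv.
Qed.

Lemma measurable_gtR X (c : R) : measurable_fun setT X -> measurable [set w | c < X w].
Proof.
move=> mX; have := mX measurableT _ (measurable_itv `]c, +oo[).
by rewrite setTI; congr measurable; apply/seteqP; split => w /=; rewrite in_itv/= andbT.
Qed.

Lemma measurable_leR X (c : R) : measurable_fun setT X -> measurable [set w | X w <= c].
Proof.
move=> mX; have := mX measurableT _ (measurable_itv `]-oo, c]).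
by rewrite setTI; congr measurable; apply/seteqP; split => w /=; rewrite in_itv.
Qed.

Lemma measurable_indR (A : set Omega) : measurable A -> measurable_fun setT (\1_A : Omega -> R).
Proof. exact: measurable_indic. Qed.

(** The factorisation passes from trigonometric polynomials to indicators through two successive
    limits: n at fixed N, then N. *)
Lemma orthogonal_orthants F k (Z : 'I_k -> Omega -> R) (c0 : R) (c : 'I_k -> R) :
  span F -> (forall j, span (Z j)) -> (forall j, ip F (Z j) = 0) ->
  E (fun w => (F w < c0)%R%:R * \prod_j ((Z j w < c j)%R%:R : R)) =
  E (fun w => (F w < c0)%R%:R) * E (fun w => \prod_j ((Z j w < c j)%R%:R : R)).
Proof.
move=> sF sZ oFZ.
pose S1 X := exists a : R, X = fun w => a * F w.
(* The orthogonal complement of F contains every [Z j] and is a subspace, so the correlations among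
   the [Z j] do not enter. *)
pose S2 X := span X /\ ip F X = 0.
have s1 : subspace S1.
  split.
  - by exists 0; apply/funext => w; rewrite mul0r.
  - by move=> e X [a ->]; exists (e * a); apply/funext => w; rewrite mulrA.
  - by move=> X Y [a ->] [b ->]; exists (a + b); apply/funext => w; rewrite mulrDl.
have s2 : subspace S2.
  split.
  - split; first exact: field_span0.
    by rewrite /ip; under eq_Rintegral do rewrite mulr0; exact: Rintegral_probability_cst.
  - by move=> e X [sX oX]; split; [exact: field_spanZ|rewrite (field_ipZr f_gauss)// oX mulr0].
  - by move=> X Y [sX oX] [sY oY]; split; [exact: field_spanD|rewrite (field_ipDr f_gauss)// oX oY addr0].
have S1F : S1 F by exists 1; apply/funext => w; rewrite mul1r.
have S2Z j : S2 (Z j) by [].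
have mF := field_span_measurable sF; have mZ j := field_span_measurable (sZ j).
have S1s X : S1 X -> span X by move=> [a ->]; exact: field_spanZ.
have S2s X : S2 X -> span X by case.
have S12 X Y : S1 X -> S2 Y -> ip X Y = 0.
  by move=> [a ->] [sY oY]; rewrite (field_ipZl f_gauss)// oY mulr0.
pose g N n w := threshold_poly n (sin_level N c0 (F w)).
pose h N n w := \prod_j threshold_poly n (sin_level N (c j) (Z j w)).
pose g1 N w : R := (sin_level N c0 (F w) < 2^-1)%R%:R.
pose h1 N w : R := \prod_j ((sin_level N (c j) (Z j w) < 2^-1)%R%:R : R).
have b01 (b : bool) : `|b%:R : R| <= 1 by case: b; rewrite ?normr1 ?normr0.
have bprod (u : 'I_k -> R) : (forall j, 0 <= u j <= 1) -> `|\prod_j u j| <= 1.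
  move=> u01; rewrite ger0_norm; first exact: prodr_ile1.
  by apply: prodr_ge0 => j _; case/andP: (u01 j).
have m2 (b : Omega -> bool) : measurable [set w | b w] -> measurable_fun setT (fun w => (b w)%:R : R).
  move=> mb; have := measurable_indR mb; congr measurable_fun; apply/funext => w.
  by rewrite indicE mem_setE.
have msl (X : Omega -> R) N e : measurable_fun setT X -> measurable_fun setT (fun w => (sin_level N e (X w) < 2^-1)%R%:R : R).
  move=> mX; apply: m2; apply: measurable_ltR.
  apply: measurable_funM => //; apply: measurable_funD => //.
  apply: (@measurableT_comp _ _ _ _ _ _ sin).
    by apply: continuous_measurable_fun; exact: continuous_sin.
  by apply: measurable_funM => //; exact: measurable_funB.
have step1 N : E (fun w => g1 N w * h1 N w) = E (g1 N) * E (h1 N).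
  apply: (@factor_limit (g N) (h N)).
  - by move=> n; exact: measurable_threshold.
  - by move=> n; apply: measurable_prod => j _; exact: measurable_threshold.
  - exact: msl.
  - by apply: measurable_prod => j _; exact: msl.
  - move=> n w; rewrite ger0_norm ?threshold_poly_le1 ?threshold_poly_ge0 ?sin_level01//.
  - move=> n w; apply: bprod => j.
    by rewrite threshold_poly_le1 ?threshold_poly_ge0 ?sin_level01.
  - by move=> w; exact/cvg_threshold_poly/sin_level01.
  - by move=> w; apply: seq_cvg_prod => j; exact/cvg_threshold_poly/sin_level01.
  - move=> n; apply: (@trig_poly_factor S1 S2) => //; first exact: trig_poly_threshold.
    by apply: trig_poly_prod => // j; exact: trig_poly_threshold.
apply: (@factor_limit g1 h1).
- by move=> n; exact: msl.
- by move=> n; apply: measurable_prod => j _; exact: msl.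
- by apply: m2; exact: measurable_ltR.
- by apply: measurable_prod => j _; apply: m2; exact: measurable_ltR.
- by move=> n w; exact: b01.
- by move=> n w; apply: bprod => j; case: (_ < _)%R; rewrite ?lexx ?ler01.
- move=> w; apply: cvg_near_cst.
  by have := sin_level_lt c0 (F w); apply: filterS => N; rewrite /g1 => ->.
- move=> w; apply: seq_cvg_prod => j; apply: cvg_near_cst.
  by have := sin_level_lt (c j) (Z j w); apply: filterS => N ->.
- exact: step1.
Qed.

End Independence.

(** * From half-lines to product measures *)

Section HalfLines.
Context (R : realType).

Lemma halfline_measure_unique (m1 m2 : {measure set R -> \bar R}) :
  (forall x : R, m1 `]-oo, x[%classic = m2 `]-oo, x[%classic) ->
  (m1 setT < +oo)%E -> forall A, measurable A -> m1 A = m2 A.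
Proof.
move=> m12 m1f A mA.
pose G := [set A | exists x : R, A = `]-oo, x[%classic].
apply: (@measure_unique _ _ R G (fun n => `]-oo, n%:R[%classic)) => //.
- exact: RGenInftyO.measurableE.
- move=> _ _ [x ->] [y ->]; exists (Num.min x y).
  by apply/seteqP; split => z /=; rewrite !in_itv/= lt_min => /andP.
- by move=> n; exists n%:R.
- rewrite -subTset => x _; exists (Num.trunc `|x|).+1 => //=.
  rewrite in_itv/=; apply: le_lt_trans (ler_norm _) _.
  exact: truncnS_gt.
- by move=> _ [x ->].
- move=> k; apply: le_lt_trans m1f; apply: le_measure; rewrite ?inE//.
Qed.

Context (disp : measure_display) (Omega : measurableType disp).
Context (P : probability Omega R).

Lemma halfline_pushforward_unique (X : Omega -> R) (m1 m2 : {measure set Omega -> \bar R}) :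
  measurable_fun setT X ->
  (forall x : R, m1 [set w | X w < x] = m2 [set w | X w < x]) -> (m1 setT < +oo)%E ->
  forall A, measurable A -> m1 (X @^-1` A) = m2 (X @^-1` A).
Proof.
move=> mX m12 m1f A mA; rewrite -!/(pushforward _ X A).
unshelve apply: (@halfline_measure_unique (pushforward m1 X) (pushforward m2 X)) => //.
Qed.

Implicit Types F N : Omega -> R.

(** Uniqueness of finite measures, one variable at a time: with a half-line for N fixed, both sides
    are measures in A; with A fixed, both are measures in B. *)
Lemma independent_halflines F N : measurable_fun setT F -> measurable_fun setT N ->
  (forall s m : R, P ([set w | F w < s] `&` [set w | N w < m]) =
    (P [set w | (F w < s)%R] * P [set w | (N w < m)%R])%E) ->
  forall A B : set R, measurable A -> measurable B ->
  P (F @^-1` A `&` N @^-1` B) = (P (F @^-1` A) * P (N @^-1` B))%E.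
Proof.
move=> mF mN ind.
have pF A : measurable A -> measurable (F @^-1` A).
  by move=> mA; have := mF measurableT A mA; rewrite setTI.
have pN A : measurable A -> measurable (N @^-1` A).
  by move=> mA; have := mN measurableT A mA; rewrite setTI.
have fP (D : set Omega) : measurable D -> (P D < +oo)%E.
  by move=> mD; rewrite ltey_eq fin_num_measure.
have step1 (m : R) A : measurable A ->
    P (F @^-1` A `&` [set w | N w < m]) = (P (F @^-1` A) * P [set w | (N w < m)%R])%E.
  move=> mA; have mD : measurable [set w | N w < m] by exact: measurable_ltR.
  have r0 : 0 <= fine (P [set w | N w < m]) by exact: fine_ge0.
  have msE D : mscale (NngNum r0) P D = (P [set w | (N w < m)%R] * P D)%E.
    by rewrite /mscale /= fineK ?fin_num_measure.
  transitivity (mrestr P mD (F @^-1` A)) => //.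
  transitivity (mscale (NngNum r0) P (F @^-1` A)); last first.
    by rewrite msE muleC.
  apply: (@halfline_pushforward_unique F (mrestr P mD) (mscale (NngNum r0) P)) => //.
  - by move=> x; rewrite [RHS]msE muleC; exact: ind.
  - by apply: fP; exact: measurableI.
move=> A B mA mB.
have r0 : 0 <= fine (P (F @^-1` A)) by exact: fine_ge0.
have msE D : mscale (NngNum r0) P D = (P (F @^-1` A) * P D)%E.
  by rewrite /mscale /= fineK ?fin_num_measure//; exact: pF.
transitivity (mrestr P (pF A mA) (N @^-1` B)); first by rewrite /mrestr setIC.
transitivity (mscale (NngNum r0) P (N @^-1` B)); last first.
  by rewrite msE.
apply: (@halfline_pushforward_unique N (mrestr P (pF A mA)) (mscale (NngNum r0) P)) => //.
- by move=> x; rewrite [RHS]msE -step1// setIC.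
- by apply: fP; apply: measurableI => //; exact: pF.
Qed.

(** Integration over the value x of N: the strip for F then has probability psi(u) - psi(- x), or 0
    if - x <= u. *)
Lemma independent_strip F N (u : R) : measurable_fun setT F -> measurable_fun setT N ->
  (forall s m : R, P ([set w | F w < s] `&` [set w | N w < m]) =
    (P [set w | (F w < s)%R] * P [set w | (N w < m)%R])%E) ->
  (forall t, P [set w | t < F w] = (normal_tail t)%:E) ->
  P [set w | u < F w <= - N w] =
    (\int[P]_w (normal_tail u - normal_tail (Num.max u (- N w)))%R%:E)%E.
Proof.
move=> mF mN ind tF.
pose F' : {mfun Omega >-> R} := HB.pack F (@isMeasurableFun.Build _ _ _ _ F mF).
pose N' : {mfun Omega >-> R} := HB.pack N (@isMeasurableFun.Build _ _ _ _ N mN).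
pose NF (w : Omega) : R * R := (N w, F w).
have mNF : measurable_fun setT NF by exact: measurable_fun_pair.
pose NF' : {mfun Omega >-> (R * R)%type} :=
  HB.pack NF (@isMeasurableFun.Build _ _ _ _ NF mNF).
pose A := [set p : R * R | u < p.2 <= - p.1].
have mA : measurable A.
  have -> : A = (snd @^-1` `]u, +oo[) `&` ((fun p => p.1 + p.2) @^-1` `]-oo, 0]).
    apply/seteqP; split => -[x y] /=; rewrite /A /= !in_itv/= ?andbT.
      by move=> /andP[-> h]; split => //; lra.
    by move=> [-> h] /=; lra.
  apply: measurableI.
    have m2 : measurable_fun setT (@snd R R) by exact: measurable_snd.
    by rewrite -[X in measurable X]setTI; apply: m2.
  have m2 : measurable_fun setT (fun p : R * R => (p.1 + p.2 : R)).
    by apply: measurable_funD; [exact: measurable_fst|exact: measurable_snd].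
  by rewrite -[X in measurable X]setTI; apply: m2.
have E : (distribution P N' \x distribution P F')%E A = distribution P NF' A.
  apply: product_measure_unique => // B C mB mC; rewrite /distribution /pushforward muleC.
  have := independent_halflines mF mN ind mC mB => <-.
  by congr (P _); apply/seteqP; split => w /= [].
transitivity ((distribution P N' \x distribution P F')%E A); first by rewrite E.
rewrite /product_measure1 /=.
transitivity (\int[distribution P N']_x (normal_tail u - normal_tail (Num.max u (- x)))%R%:E)%E.
  apply: eq_integral => x _ /=; rewrite /distribution /pushforward.
  have [ux|xu] := leP u (- x); last first.
    rewrite subrr [X in P X](_ : _ = set0) ?measure0//.
    apply/seteqP; split => w //=; rewrite /xsection /= inE /A /=.
    by move=> /andP[h1 h2]; have := lt_le_trans h1 h2; rewrite ltNge (ltW xu).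
  have -> : F' @^-1` xsection A x = [set w | u < F w] `\` [set w | - x < F w].
    apply/seteqP; split => w /=; rewrite /xsection /= inE /A /=.
      by move=> /andP[-> h]; split => //; apply/negP; rewrite -leNgt.
    by move=> [-> /negP]; rewrite -leNgt.
  have mgt (t : R) : measurable [set w | t < F w] by exact: measurable_gtR.
  change (P ([set w | u < F w] `\` [set w | - x < F w]) = (normal_tail u - normal_tail (- x))%:E).
  rewrite measureD//; last by apply: (le_lt_trans (probability_le1 P _)) => //; exact: ltry.
  rewrite (_ : _ `&` _ = [set w | - x < F w]).
    by rewrite EFinB; congr (_ - _)%E; exact: tF.
  by apply/seteqP; split => w /=; [case|move=> h; split => //; exact: le_lt_trans h].
rewrite ge0_integral_distribution//.
- apply/measurable_EFinP; apply: measurable_funB => //.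
  apply: (@measurableT_comp _ _ _ _ _ _ (@normal_tail R)).
    by apply: continuous_measurable_fun; exact: continuous_normal_tail.
  by apply: measurable_maxr => //; exact: measurable_funN.
- by move=> y; rewrite lee_fin subr_ge0 normal_tail_nincr// le_max lexx.
Qed.

End HalfLines.

(** * Strips with a random upper end *)

Section Strip.
Context (disp : measure_display) (Omega : measurableType disp) (R : realType).
Context (P : probability Omega R) (d : nat) (f : 'rV[R]_d -> {RV P >-> R}).
Context (f_gauss : gaussian_field f) (f_mean : forall x, ('E_P[f x] = 0)%E).
Notation span := (field_span f).
Notation ip := (field_ip P).

Lemma minr_gtP k (g : 'I_k.+1 -> R) (m : R) :
  reflect (forall j, m < g j) (m < \big[Num.min/g ord0]_j g j).
Proof.
apply: (iffP idP) => [h j|h].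
  by apply: lt_le_trans h _; exact: bigmin_le.
by apply/lt_bigmin => //; split => //; exact: h.
Qed.

Lemma minr_geP k (g : 'I_k.+1 -> R) (m : R) :
  reflect (forall j, m <= g j) (m <= \big[Num.min/g ord0]_j g j).
Proof.
apply: (iffP idP) => [h j|h].
  by apply: le_trans h _; exact: bigmin_le.
by apply/le_bigmin => //; split => //; exact: h.
Qed.

(** The constraints amount to F <= M, where M depends on the Z only, and the events - M < m are
    orthants in the Z. Hence M is independent of F and serves as the random upper end of a strip. At
    least one Z is present, so that the minimum can start from one of its members. *)
Lemma gaussian_strip k (F : Omega -> R) (Z : 'I_k.+1 -> Omega -> R) (rho : 'I_k.+1 -> R) (u : R) :
  span F -> ip F F = 1 -> (forall j, span (Z j)) -> (forall j, ip F (Z j) = 0) ->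
  (forall j, 0 < rho j) ->
  let M w := \big[Num.min/(u - Z ord0 w) / rho ord0]_j ((u - Z j w) / rho j) in
  measurable_fun setT M /\
  P [set w | u < F w /\ forall j, rho j * F w + Z j w <= u] =
    (\int[P]_w (normal_tail u - normal_tail (Num.max u (M w)))%R%:E)%E.
Proof.
move=> sF F1 sZ oFZ rho0 M.
have mF := field_span_measurable sF; have mZ j := field_span_measurable (sZ j).
have mM : measurable_fun setT M.
  rewrite /M; elim: (index_enum _) => [|j s IH].
    under eq_fun do rewrite big_nil.
    by apply: measurable_funM => //; exact: measurable_funB.
  under eq_fun do rewrite big_cons.
  apply: measurable_minr => //.
  by apply: measurable_funM => //; exact: measurable_funB.
split => //.
have mN : measurable_fun setT (fun w => - M w) by exact: measurable_funN.
have tF (t : R) : P [set w | t < F w] = (normal_tail t)%:E.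
  by rewrite (field_span_tail f_gauss f_mean)// F1// sqrtr1 divr1.
have key (s m : R) : P ([set w | F w < s] `&` [set w | - M w < m]) =
    (P [set w | (F w < s)%R] * P [set w | (- M w < m)%R])%E.
  have E1 : [set w | - M w < m] = [set w | forall j, Z j w < u + m * rho j].
    apply/seteqP; split => w /=; rewrite ltrNl.
      move=> /(minr_gtP (fun j => (u - Z j w) / rho j)) h j.
      by have := h j; rewrite ltr_pdivlMr//; lra.
    move=> h; apply/(minr_gtP (fun j => (u - Z j w) / rho j)) => j.
    by have := h j; rewrite ltr_pdivlMr//; lra.
  rewrite E1.
  have := orthogonal_orthants f_gauss f_mean s (fun j => u + m * rho j) sF sZ oFZ.
  have m1 : measurable [set w | F w < s] by exact: measurable_ltR.
  have m2 : measurable [set w | forall j, Z j w < u + m * rho j].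
    by rewrite -E1; exact: measurable_ltR.
  have ind (A : set Omega) (b : Omega -> R) : measurable A -> (forall w, b w = (w \in A)%:R) ->
      \int[P]_w b w = fine (P A).
    move=> mA bA; rewrite -(expectation_indic P mA) unlock.
    by apply: eq_Rintegral => w _; rewrite bA indicE.
  have bprod w : \prod_j ((Z j w < u + m * rho j)%R%:R : R) =
      (w \in [set w | forall j, Z j w < u + m * rho j])%:R.
    have [h|h] := pselect (forall j, Z j w < u + m * rho j).
      by rewrite mem_set//; apply: big1 => j _; rewrite h.
    rewrite memNset//; move/existsNP: h => [j hj].
    by rewrite (bigD1 j)//= (negbTE (introN idP hj)) mul0r.
  rewrite (ind ([set w | F w < s] `&` [set w | forall j, Z j w < u + m * rho j])); last 2 first.
  - exact: measurableI.
  - move=> w; rewrite bprod in_setI; case: (w \in _); rewrite ?andbT ?mulr1 ?andbF ?mulr0//.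
    by rewrite mem_setE.
  rewrite (ind [set w | F w < s])//; last by move=> w; rewrite mem_setE.
  rewrite (ind [set w | forall j, Z j w < u + m * rho j])//.
  move=> h; apply/eqP; rewrite -[eqbLHS]fineK ?fin_num_measure//; last exact: measurableI.
  by rewrite h EFinM !fineK ?fin_num_measure.
have := @independent_strip _ _ _ P F (fun w => - M w) u mF mN key tF.
under eq_integral do rewrite opprK.
move=> <-; congr (P _); apply/seteqP; split => w /=.
  move=> [-> h] /=; rewrite opprK.
  apply/(minr_geP (fun j => (u - Z j w) / rho j)) => j.
  by rewrite ler_pdivlMr// mulrC; have := h j; lra.
move=> /andP[uF]; rewrite opprK => /(minr_geP (fun j => (u - Z j w) / rho j)) h.
split => // j; have := h j; rewrite ler_pdivlMr// mulrC; lra.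
Qed.

End Strip.

(** * Smooth paths and the covariance kernel *)

Lemma seq_cvg_comp (R : realType) (F : R -> R) (u : nat -> R) (a : R) :
  u @ \oo --> a -> {for a, continuous F} -> (fun n => F (u n)) @ \oo --> F a.
Proof. by move=> ua cF; exact: (cvg_comp _ _ ua cF). Qed.

Lemma seq_cvgX (R : realType) m (u : nat -> R) (a : R) :
  u @ \oo --> a -> (fun n => u n ^+ m) @ \oo --> a ^+ m.
Proof. by move=> ua; apply: (@seq_cvg_comp _ (fun x => x ^+ m)) => //; exact: exprn_continuous. Qed.

Lemma seq_cvg_sum (R : realType) (I : Type) (s : seq I) (Q : pred I)
    (u : nat -> I -> R) (l : I -> R) :
  (forall i, (fun n => u n i) @ \oo --> l i) ->
  (fun n => \sum_(i <- s | Q i) u n i) @ \oo --> \sum_(i <- s | Q i) l i.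
Proof.
move=> ul; elim: s => [|i s IH].
  rewrite big_nil; apply: (eq_near_cvg _ (cvg_cst (0 : R))).
  by near=> n; rewrite big_nil.
rewrite big_cons; case: ifP => Qi.
  apply: (eq_near_cvg _ (seq_cvgD (ul i) IH)).
  by near=> n; rewrite big_cons Qi.
by apply: (eq_near_cvg _ IH); near=> n; rewrite big_cons Qi.
Unshelve. all: by end_near. Qed.

Section SmoothPaths.
Context (R : realType) (d : nat).
Implicit Types (g : 'rV[R]_d -> R) (x v : 'rV[R]_d).

Lemma is_derive_line g x v (t : R) : derivable g (x + t *: v) v ->
  is_derive t (1 : R) (fun s : R => g (x + s *: v)) ('D_v g (x + t *: v)).
Proof.
move=> dg; have E : (fun h : R => h^-1 *: (g (x + (h *: (1 : R) + t) *: v) - g (x + t *: v)))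
    = (fun h : R => h^-1 *: (g (h *: v + (x + t *: v)) - g (x + t *: v))).
  apply/funext => h; congr (_ *: (g _ - _)).
  by rewrite [h *: 1]mulr1 scalerDl addrCA.
apply: DeriveDef.
  by rewrite /derivable [X in cvg (X @ _)]E.
by rewrite /derive [X in lim (X @ _)]E.
Qed.

Lemma MVT_line g x v (t : R) : (forall y, derivable g y v) ->
  exists2 s, `|s| <= `|t| & g (x + t *: v) - g x = t * 'D_v g (x + s *: v).
Proof.
move=> dg; have D s := @is_derive_line g x v s (dg _).
have c (a b : R) : {within `[a, b], continuous (fun s : R => g (x + s *: v))}.
  apply: continuous_subspaceT => s; apply: differentiable_continuous.
  by apply/derivable1_diffP; case: (D s).
have [t0|t0] := leP 0 t.
  have [s] := @MVT_segment _ _ _ 0 t t0 (fun s _ => D s) (c _ _).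
  rewrite in_itv/= => /andP[s0 st]; rewrite scale0r addr0 subr0 => ->.
  by exists s; [rewrite !ger0_norm|rewrite mulrC].
have [s] := @MVT_segment _ _ _ t 0 (ltW t0) (fun s _ => D s) (c _ _).
rewrite in_itv/= => /andP[ts s0] E.
exists s; first by rewrite !ler0_norm ?lerN2// ltW.
by move: E; rewrite scale0r addr0 => E; rewrite -opprB E; ring.
Qed.

(** Regularity is stated for partial derivatives, so the point delta k is reached along one
    coordinate at a time, with the mean value theorem on each edge. *)
Lemma is_C1_cvg_directional g (delta : nat -> R) (k : 'rV[R]_d) : is_C 1 g ->
  (forall n, delta n != 0) -> delta @ \oo --> (0 : R) ->
  (fun n => (g (delta n *: k) - g 0) / delta n) @ \oo -->
    \sum_i k 0 i * 'D_(basis_vec R i) g 0.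
Proof.
move=> [_ g1] dn0 d0.
pose p (j : nat) : 'rV[R]_d := \row_i (if (i < j)%N then k 0 i else 0).
have pS (i : 'I_d) : p i.+1 = p i + k 0 i *: basis_vec R i.
  apply/rowP => l; rewrite !mxE eqxx /= ltnS eq_sym.
  have [li|il|/val_inj ->] := ltngtP l i.
  - by rewrite -val_eqE /= (gtn_eqF li) mulr0 addr0.
  - by rewrite -val_eqE /= (ltn_eqF il) mulr0 addr0.
  - by rewrite eqxx mulr1 add0r.
have p0 : p 0%N = 0 by apply/rowP => l; rewrite !mxE.
have pd : p d = k by apply/rowP => l; rewrite !mxE ltn_ord.
have step (i : 'I_d) : (fun n => (g (delta n *: p i.+1) - g (delta n *: p i)) / delta n) @ \oo -->
    k 0 i * 'D_(basis_vec R i) g 0.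
  have [dg [cD _]] := g1 i.
  apply/cvgrPdist_le => e e0.
  have K0 : 0 < `|k 0 i| + 1 by rewrite ltr_wpDl.
  have e1 : 0 < e / (`|k 0 i| + 1) by rewrite divr_gt0.
  have := cD 0 => /cvgrPdist_le /(_ _ e1) /nbhs_ballP[rho /= rho0 hrho].
  pose B := `|p i| + `|k 0 i| * `|basis_vec R i| + 1.
  have B0 : 0 < B by rewrite ltr_wpDl// addr_ge0// mulr_ge0.
  near=> n.
  have dB : `|delta n| < rho / B.
    near: n; have := d0 => /cvgrPdist_lt /(_ _ (divr_gt0 rho0 B0)).
    by apply: filterS => n; rewrite sub0r normrN.
  rewrite pS scalerDr scalerA.
  have [s sle ->] := @MVT_line g (delta n *: p i) (basis_vec R i) (delta n * k 0 i) dg.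
  rewrite [X in _ - X](_ : _ = k 0 i * 'D_(basis_vec R i) g (delta n *: p i + s *: basis_vec R i)).
    2: by field; exact: dn0.
  rewrite -mulrBr normrM.
  have hb : `|'D_(basis_vec R i) g 0 - 'D_(basis_vec R i) g (delta n *: p i + s *: basis_vec R i)|
      <= e / (`|k 0 i| + 1).
    apply: hrho; rewrite -ball_normE /ball_ /= sub0r normrN.
    apply: (@le_lt_trans _ _ (`|delta n| * B)); last by rewrite -ltr_pdivlMr.
    apply: le_trans (ler_normD _ _) _; rewrite !normrZ /B 2!mulrDr mulr1 -addrA lerD//.
    apply: (@le_trans _ _ (`|delta n| * (`|k 0 i| * `|basis_vec R i|))); last by rewrite lerDl.
    by rewrite mulrA ler_wpM2r// -normrM.
  apply: le_trans (ler_wpM2l (normr_ge0 _) hb) _.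
  rewrite mulrCA ler_piMr ?(ltW e0)// ler_pdivrMr// mul1r lerDl//.
have E n : (g (delta n *: k) - g 0) / delta n =
    \sum_(i < d) (g (delta n *: p i.+1) - g (delta n *: p i)) / delta n.
  rewrite -mulr_suml; congr (_ / _).
  rewrite -(big_mkord xpredT (fun i => g (delta n *: p i.+1) - g (delta n *: p i))).
  by rewrite (telescope_sumr (fun i => g (delta n *: p i)))// pd p0 scaler0.
rewrite (_ : (fun n => _) = (fun n => \sum_(i < d) (g (delta n *: p i.+1) - g (delta n *: p i)) / delta n)).
  by apply: seq_cvg_sum => i; exact: step.
by apply/funext => n; exact: E.
Unshelve. all: by end_near. Qed.

(** The mean value theorem on either side of 0, then for the derivative between the two intermediate
    points. These are at most 2 |h| apart, so the final point is within 3 |h| of 0. *)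
Lemma second_difference_bound g v (h K : R) :
  (forall y, derivable g y v) -> (forall y, derivable ('D_v g) y v) ->
  (forall t, `|t| <= 3 * `|h| -> `|'D_v ('D_v g) (t *: v)| <= K) ->
  `|g (h *: v) + g (- h *: v) - 2 * g 0| <= 2 * K * h ^+ 2.
Proof.
move=> dg dg2 hK.
have [s sh E1] := @MVT_line g 0 v h dg.
have [s' sh' E2] := @MVT_line g 0 v (- h) dg.
have [y ys E3] := @MVT_line ('D_v g) (0 + s' *: v) v (s - s') dg2.
rewrite !add0r in E1 E2; rewrite !add0r -!scalerDl (addrCA s') subrr addr0 in E3.
rewrite normrN in sh'.
have ss : `|s - s'| <= 2 * `|h|.
  by rewrite (le_trans (ler_normB _ _))// mulr_natl mulr2n lerD.
have sy : `|s' + y| <= 3 * `|h|.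
  rewrite (le_trans (ler_normD _ _))// (_ : 3 * `|h| = `|h| + 2 * `|h|); last by ring.
  by rewrite lerD// (le_trans ys).
have {hK}hK := hK _ sy.
have -> : g (h *: v) + g (- h *: v) - 2 * g 0 = (h * (s - s')) * 'D_v ('D_v g) ((s' + y) *: v).
  transitivity ((g (h *: v) - g 0) + (g (- h *: v) - g 0)); first by ring.
  by rewrite E1 E2 -mulrA -E3; ring.
rewrite -(real_normK (num_real h)) !normrM.
apply: (@le_trans _ _ (`|h| * (2 * `|h|) * K)).
  by rewrite ler_pM ?mulr_ge0// ler_wpM2l.
by rewrite le_eqVlt; apply/orP; left; apply/eqP; ring.
Qed.

(** The bound [B] depends on the path; uniformity is recovered only at the level of variances. *)
Lemma is_C2_second_difference g (i : 'I_d) (h : nat -> R) : is_C 2 g ->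
  h @ \oo --> (0 : R) -> exists B, \forall n \near \oo,
  `|g (h n *: basis_vec R i) + g (- h n *: basis_vec R i) - 2 * g 0| <= B * h n ^+ 2.
Proof.
move=> [_ g1] h0; have [dg [cD /(_ i)[dg2 [c2 _]]]] := g1 i.
set e := basis_vec R i in dg dg2 cD c2 *.
set D2 := 'D_e ('D_e g) in c2.
exists (2 * (`|D2 0| + 1)).
have := c2 0 => /cvgrPdist_le /(_ 1 ltr01) /nbhs_ballP[rho /= rho0 hrho].
have e0 : 0 < 3 * (`|e| + 1) by rewrite mulr_gt0// ltr_wpDl.
near=> n.
have hn : `|h n| < rho / (3 * (`|e| + 1)).
  near: n; have := h0 => /cvgrPdist_lt /(_ _ (divr_gt0 rho0 e0)).
  by apply: filterS => n; rewrite sub0r normrN.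
apply: second_difference_bound => // t ht.
have : `|D2 0 - D2 (t *: e)| <= 1.
  apply: hrho; rewrite -ball_normE /ball_ /= sub0r normrN normrZ.
  move: hn; rewrite ltr_pdivlMr//; apply: le_lt_trans.
  rewrite mulrA (mulrC `|h n|); apply: ler_pM => //.
  by rewrite lerDl.
have := ler_normB (D2 0) (D2 0 - D2 (t *: e)); rewrite opprB addrC subrK => h1 h2.
by apply: le_trans h1 _; rewrite lerD2l.
Unshelve. all: by end_near. Qed.

End SmoothPaths.

(** * The covariance kernel and limits of variances *)

Section Covariance.
Context (disp : measure_display) (Omega : measurableType disp) (R : realType).
Context (P : probability Omega R) (d : nat) (f : 'rV[R]_d -> {RV P >-> R}).
Context (f_C2 : smooth_paths f 2) (f_gauss : gaussian_field f) (f_stat : stationary f).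
Context (f_mean : forall x, ('E_P[f x] = 0)%E) (f_var : forall x, ('V_P[f x] = 1)%E).
Notation span := (field_span f).
Notation ip := (field_ip P).
Notation r := (cov_kernel f).

Let ipE x y : ip (f x) (f y) = r (y - x).
Proof. exact: field_ip_stat. Qed.

Lemma field_ip_add X Y : span X -> span Y ->
  ip (fun w => X w + Y w) (fun w => X w + Y w) = ip X X + 2 * ip X Y + ip Y Y.
Proof.
move=> sX sY; have sXY := field_spanD sX sY.
by rewrite (field_ipDl f_gauss)// !(field_ipDr f_gauss)// (field_ipC P Y X); ring.
Qed.

Lemma cov_kernel0 : r 0 = 1.
Proof. by have := ipE 0 0; rewrite subrr => <-; rewrite field_ip_diag. Qed.

Lemma cov_kernelN h : r (- h) = r h.
Proof. by have := ipE 0 h; rewrite subr0 => <-; rewrite field_ipC ipE sub0r. Qed.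

Lemma increment_variance x y :
  ip (fun w => f y w - f x w) (fun w => f y w - f x w) = 2 * (1 - r (y - x)).
Proof.
have sx := field_span_pt f x; have sy := field_span_pt f y.
have sd := field_spanB sy sx.
rewrite (field_ipBl f_gauss)// !(field_ipBr f_gauss)// !ipE !subrr cov_kernel0.
by rewrite -(opprB x y) cov_kernelN -[x - y]opprB cov_kernelN; ring.
Qed.

Lemma cov_kernel_le1 h : r h <= 1.
Proof.
have := field_ip_ge0 P (fun w => f h w - f 0 w).
by rewrite increment_variance subr0; lra.
Qed.

(** The triangle inequality in L^2: 2 (1 - r(h)) is the squared norm of an increment along h, and m
    such increments add up to one along m h. *)
Lemma cov_deficit_mul (m : nat) h : 1 - r (m%:R *: h) <= m%:R ^+ 2 * (1 - r h).
Proof.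
elim: m => [|m IH]; first by rewrite scale0r cov_kernel0 subrr expr0n mul0r.
have s0 := field_span_pt f 0; have sm := field_span_pt f (m%:R *: h).
have sm1 := field_span_pt f (m.+1%:R *: h).
pose X w := f (m%:R *: h) w - f 0 w; pose Y w := f (m.+1%:R *: h) w - f (m%:R *: h) w.
have sX : span X by exact: field_spanB. have sY : span Y by exact: field_spanB.
have eX : ip X X = 2 * (1 - r (m%:R *: h)) by rewrite increment_variance subr0.
have eY : ip Y Y = 2 * (1 - r h).
  by rewrite increment_variance -scalerBl -natrB// subSnn scale1r.
have eXY : 2 * (1 - r (m.+1%:R *: h)) = ip X X + 2 * ip X Y + ip Y Y.
  transitivity (ip (fun w => X w + Y w) (fun w => X w + Y w)).
    have -> : (fun w => X w + Y w) = (fun w => f (m.+1%:R *: h) w - f 0 w).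
      by apply/funext => w; rewrite /X /Y addrC addrA subrK.
    by rewrite increment_variance subr0.
  exact: field_ip_add.
have D0 : 0 <= 1 - r h by rewrite subr_ge0 cov_kernel_le1.
have cs := cauchy_schwarz_field f_gauss sX sY.
have b : ip X Y <= m%:R * (2 * (1 - r h)).
  apply: le_trans (ler_norm _) _.
  rewrite -(@ler_pXn2r _ 2) ?nnegrE ?mulr_ge0 ?ler0n// real_normK ?num_real//.
  apply: (le_trans cs); rewrite eX eY.
  have -> : (m%:R * (2 * (1 - r h))) ^+ 2 = 2 * (m%:R ^+ 2 * (1 - r h)) * (2 * (1 - r h)) by ring.
  by rewrite ler_wpM2r ?mulr_ge0// ler_wpM2l.
rewrite (_ : m.+1%:R ^+ 2 * (1 - r h) = m%:R ^+ 2 * (1 - r h) + 2 * (m%:R * (1 - r h)) + (1 - r h)).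
  by move: eXY; rewrite eX eY; lra.
by rewrite -[m.+1%:R]natr1; ring.
Qed.

(** A small h is multiplied by an integer m <= 2 M / |h| for which |m h| > M, where r <= 1/2. The
    inequality for multiples then gives 1 - r(h) >= |h|^2 / (8 M^2). *)
Lemma cov_deficit_lower : r t @[t --> norm_infty R d] --> (0 : R) ->
  exists c : R, [/\ 0 < c, c <= 1 & forall h, c * Num.min (`|h| ^+ 2) 1 <= 1 - r h].
Proof.
move=> r0.
have [M0 _ hM0] : norm_infty R d [set t | r t <= 2^-1].
  apply: (r0 [set y | y <= 2^-1]).
  by apply: (@cvgr_le _ _ _ _ id (0 : R) cvg_id 2^-1).
pose M := Num.max M0 1.
have M1 : 1 <= M by rewrite le_max lexx orbT.
have hM t : M < `|t| -> r t <= 2^-1.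
  by move=> Mt; apply: hM0; apply: le_lt_trans Mt; rewrite le_max lexx.
exists (8 * M ^+ 2)^-1; split.
- by rewrite invr_gt0 mulr_gt0// exprn_gt0//; lra.
- by rewrite invf_le1; [nra|rewrite mulr_gt0// exprn_gt0//; lra].
move=> h.
have [->|hn0] := eqVneq h 0.
  by rewrite normr0 expr0n /= cov_kernel0 subrr minElt ltr01 mulr0.
have h0 : 0 < `|h| by rewrite normr_gt0.
have M8 : 0 < 8 * M ^+ 2 by rewrite mulr_gt0// exprn_gt0//; lra.
have [hM1|hM1] := ltP M `|h|.
  have := hM _ hM1; have : (8 * M ^+ 2)^-1 * Num.min (`|h| ^+ 2) 1 <= 2^-1.
    rewrite -[leRHS]mulr1 ler_pM ?invr_ge0 ?(ltW M8) ?le_min ?ler01 ?sqr_ge0 ?ge_min ?lexx ?orbT//.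
    by rewrite lef_pV2 ?posrE//; nra.
  lra.
pose m := (Num.trunc (M / `|h|)).+1.
have Mh0 : 0 <= M / `|h| by rewrite divr_ge0//; lra.
have m1 : M / `|h| < m%:R by exact: truncnS_gt.
have m2 : m%:R <= 2 * (M / `|h|).
  rewrite /m -natr1; have : (Num.trunc (M / `|h|))%:R <= M / `|h| by rewrite truncn_le.
  have : 1 <= M / `|h| by rewrite ler_pdivlMr// mul1r.
  lra.
have := cov_deficit_mul m h.
have /hM : M < `|m%:R *: h|.
  by rewrite normrZ normr_nat -ltr_pdivrMr.
move=> h1 h2.
have D0 : 0 <= 1 - r h by rewrite subr_ge0 cov_kernel_le1.
have : 2^-1 <= (2 * (M / `|h|)) ^+ 2 * (1 - r h).
  apply: le_trans (_ : m%:R ^+ 2 * (1 - r h) <= _); first lra.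
  by rewrite ler_wpM2r// ler_pXn2r ?nnegrE// mulr_ge0.
have -> : (2 * (M / `|h|)) ^+ 2 * (1 - r h) = 4 * M ^+ 2 * (1 - r h) / `|h| ^+ 2.
  by field; rewrite gt_eqF.
rewrite ler_pdivlMr ?exprn_gt0// => h3.
apply: (@le_trans _ _ ((8 * M ^+ 2)^-1 * `|h| ^+ 2)).
  by rewrite ler_wpM2l ?invr_ge0 ?(ltW M8)// ge_min lexx.
rewrite mulrC ler_pdivrMr//; lra.
Qed.

(** Cosines are bounded, so E cos(b X_n) = exp(- b^2 v_n / 2) converges for every b by dominated
    convergence. A small b makes the limit positive, its logarithm gives the limit of v_n, and b = 1
    then identifies that limit. *)
Lemma span_cvg_variance (X : nat -> Omega -> R) (Y : Omega -> R) :
  (forall n, span (X n)) -> (forall w, X ^~ w @ \oo --> Y w) ->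
  exists v, (fun n => ip (X n) (X n)) @ \oo --> v /\ v = - 2 * ln (\int[P]_w cos (Y w)).
Proof.
move=> sX XY.
have mX n := field_span_measurable (sX n).
have mY : measurable_fun setT Y.
  exact: (measurable_fun_cvg mX (fun w _ => XY w)).
have mc (Z : Omega -> R) : measurable_fun setT Z -> measurable_fun setT (fun w => cos (Z w)).
  move=> mZ; have := measurable_cosD 0 mZ.
  by congr measurable_fun; apply/funext => w; rewrite addr0.
have i1 : P.-integrable setT (EFin \o cst (1 : R)) by exact: finite_measure_integrable_cst.
have cb (b : R) : (fun n => expR (- (b ^+ 2 * ip (X n) (X n)) / 2)) @ \oo --> \int[P]_w cos (b * Y w).
  have E n : expR (- (b ^+ 2 * ip (X n) (X n)) / 2) = \int[P]_w cos (b * X n w).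
    rewrite (field_span_cos f_gauss f_mean (field_spanZ b (sX n))).
    rewrite (field_ipZl f_gauss)//; last exact: field_spanZ.
    by rewrite (field_ipZr f_gauss)// mulrA -expr2.
  under eq_fun do rewrite E.
  apply: (@dominated_cvg_Rintegral _ _ _ P (fun n w => cos (b * X n w)) (fun w => cos (b * Y w)) (cst 1)) => //.
  - by move=> n; apply: mc; exact: measurable_funM.
  - by apply: mc; exact: measurable_funM.
  - move=> w; apply: (@seq_cvg_comp _ cos (fun n => b * X n w)); last exact: continuous_cos.
    by apply: seq_cvgM; [exact: cvg_cst|exact: XY].
  - by move=> n w; exact: cos_max.
have [m m0] : exists m : nat, 0 < \int[P]_w cos (m.+1%:R^-1 * Y w).
  have c0 : (fun m : nat => \int[P]_w cos (m.+1%:R^-1 * Y w)) @ \oo --> \int[P]_w cst (1 : R) w.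
    apply: (@dominated_cvg_Rintegral _ _ _ P (fun m w => cos (m.+1%:R^-1 * Y w)) (cst 1) (cst 1)) => //.
    - by move=> n; apply: mc; exact: measurable_funM.
    - move=> w /=; have c : (fun n : nat => n.+1%:R^-1 * Y w) @ \oo --> (0 : R).
        rewrite -[X in _ --> X](mul0r (Y w)).
        by apply: seq_cvgM; [exact: cvg_harmonic|exact: cvg_cst].
      have := seq_cvg_comp c (@continuous_cos R 0); by rewrite cos0.
    - by move=> n w; exact: cos_max.
  rewrite Rintegral_probability_cst in c0.
  have := c0 => /(cvgr_gt _) /(_ 0 ltr01) [N _ /(_ N (leqnn N)) hN].
  by exists N.
pose b : R := m.+1%:R^-1; have b0 : 0 < b by rewrite invr_gt0 ltr0n.
have cv : (fun n => ip (X n) (X n)) @ \oo --> (- 2 / b ^+ 2) * ln (\int[P]_w cos (b * Y w)).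
  have := cb b => cbb.
  have cl : (fun n => ln (expR (- (b ^+ 2 * ip (X n) (X n)) / 2))) @ \oo --> ln (\int[P]_w cos (b * Y w)).
    by apply: (@seq_cvg_comp _ (@ln R)) => //; exact: continuous_ln.
  apply: (eq_near_cvg _ (seq_cvgM (cvg_cst (- 2 / b ^+ 2)) cl)).
  near=> n; rewrite expRK; field; lra.
exists ((- 2 / b ^+ 2) * ln (\int[P]_w cos (b * Y w))); split => //.
set v := (- 2 / b ^+ 2) * _ in cv *.
have c1 : (fun n => expR (- (1 ^+ 2 * ip (X n) (X n)) / 2)) @ \oo --> expR (- v / 2).
  apply: (@seq_cvg_comp _ expR (fun n => - (1 ^+ 2 * ip (X n) (X n)) / 2)); last exact: continuous_expR.
  apply: (@seq_cvgM _ (fun n => - (1 ^+ 2 * ip (X n) (X n))) (fun=> 2^-1)); last exact: cvg_cst.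
  rewrite -(sub0r v); apply: (eq_near_cvg _ (seq_cvgB (cvg_cst (0 : R)) cv)).
  by near=> n; rewrite sub0r expr1n mul1r.
have e1 : expR (- v / 2) = \int[P]_w cos (1 * Y w).
  by rewrite -(cvg_lim _ c1)// (cvg_lim _ (cb 1)).
under eq_Rintegral do rewrite -[Y _]mul1r.
by rewrite -e1 expRK; field.
Unshelve. all: by end_near. Qed.

End Covariance.

(** * Tails of pairs and of second differences *)

Lemma seq_cvgZ (R : realType) (u : nat -> R) (c a : R) :
  u @ \oo --> a -> (fun n => c * u n) @ \oo --> c * a.
Proof. by move=> ?; apply: seq_cvgM => //; exact: cvg_cst. Qed.

Section FieldTails.
Context (disp : measure_display) (Omega : measurableType disp) (R : realType).
Context (P : probability Omega R) (d : nat) (f : 'rV[R]_d -> {RV P >-> R}).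
Context (f_C2 : smooth_paths f 2) (f_gauss : gaussian_field f) (f_stat : stationary f).
Context (f_mean : forall x, ('E_P[f x] = 0)%E) (f_var : forall x, ('V_P[f x] = 1)%E).
Notation span := (field_span f).
Notation ip := (field_ip P).
Notation r := (cov_kernel f).
Notation psi := (@normal_tail R).

Definition Pr (A : set Omega) : R := fine (P A).

Lemma Pr_EFin A : measurable A -> P A = (Pr A)%:E.
Proof. by move=> mA; rewrite /Pr fineK// fin_num_measure. Qed.

Lemma Pr_ge0 A : 0 <= Pr A.
Proof. exact: fine_ge0. Qed.

Lemma le_Pr A B : measurable A -> measurable B -> A `<=` B -> Pr A <= Pr B.
Proof.
move=> mA mB AB; rewrite -lee_fin -!Pr_EFin//; apply: le_measure; rewrite ?inE//.
Qed.

Lemma Pr_tail X (t : R) : span X -> ip X X = 1 -> Pr [set w | t < X w] = psi t.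
Proof.
by move=> sX X1; rewrite /Pr (field_span_tail f_gauss f_mean)//= X1 // sqrtr1 divr1.
Qed.

Lemma Pr_tail_le X (t s : R) : span X -> 0 < ip X X -> ip X X <= s ^+ 2 -> 0 < s -> 0 <= t ->
  Pr [set w | t < X w] <= psi (t / s).
Proof.
move=> sX X0 Xs s0 t0; rewrite /Pr (field_span_tail f_gauss f_mean)//=.
have q0 : 0 < Num.sqrt (ip X X) by rewrite sqrtr_gt0.
apply: normal_tail_nincr; rewrite ler_wpM2l// lef_pV2 ?posrE//.
by rewrite -(ger0_norm (ltW s0)) -sqrtr_sqr ler_wsqrtr.
Qed.

Lemma measurable_exceed x (u : R) : measurable [set w | u < f x w].
Proof. exact: measurable_gtR. Qed.

Lemma Pr_exceed x (u : R) : Pr [set w | u < f x w] = psi u.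
Proof. by apply: Pr_tail; [exact: field_span_pt|exact: field_ip_diag]. Qed.

(** If both values exceed u, their sum exceeds 2 u while its variance is at most 2 + 2 e. Near r =
    -1 the sum may degenerate; there f x + f y / 2 > 3 u / 2 is used, whose variance lies between
    1/4 and 3/4. *)
Lemma pair_tail x y (u e : R) : 0 < u -> 0 <= e -> e <= 1 -> r (y - x) <= e ->
  Pr ([set w | u < f x w] `&` [set w | u < f y w]) <=
  psi u * expR (- (u ^+ 2 * ((1 - e) / (2 * (1 + e))))).
Proof.
move=> u0 e0 e1 re.
have sx := field_span_pt f x; have sy := field_span_pt f y.
have mA : measurable ([set w | u < f x w] `&` [set w | u < f y w]).
  by apply: measurableI; exact: measurable_exceed.
have e10 : 0 < 1 + e by lra.
have [rm1|rm1] := leP (r (y - x)) (- (1/2)).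
  pose X w := f x w + 2^-1 * f y w.
  have sX : span X by apply: field_spanD => //; exact: field_spanZ.
  have s2 := field_spanZ 2^-1 sy.
  have eX : ip X X = 1 + r (y - x) + 4^-1.
    rewrite (field_ip_add f_gauss)// (field_ipZr f_gauss)// (field_ipZl f_gauss)//.
    rewrite !(field_ipZr f_gauss)// !(field_ip_diag f_mean f_var).
    by rewrite (field_ip_stat f_gauss f_mean f_var f_stat); field.
  have r1 : -1 <= r (y - x).
    have := field_ip_ge0 P (fun w => f x w + f y w).
    rewrite (field_ip_add f_gauss)// !(field_ip_diag f_mean f_var).
    by rewrite (field_ip_stat f_gauss f_mean f_var f_stat); lra.
  apply: (@le_trans _ _ (Pr [set w | 3 / 2 * u < X w])).
    apply: le_Pr => //; first by apply: measurable_gtR; exact: field_span_measurable sX.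
    by move=> w [/= h1 h2]; rewrite /X; lra.
  apply: (@le_trans _ _ (psi (3 / 2 * u / 1))).
    by apply: Pr_tail_le => //; rewrite ?expr1n; lra.
  have h : u <= 3 / 2 * u / 1 by lra.
  apply: le_trans (normal_tail_ratio u0 h) _.
  rewrite ler_wpM2l ?normal_tail_ge0// ler_expR mulNr lerN2.
  have : (1 - e) / (2 * (1 + e)) <= 2^-1 by rewrite ler_pdivrMr; lra.
  have u2 := sqr_ge0 u; have := sqr_ge0 u.
  rewrite divr1 exprMn => _ /(ler_wpM2l u2); lra.
pose X w := f x w + f y w.
have sX : span X by exact: field_spanD.
have eX : ip X X = 2 + 2 * r (y - x).
  rewrite (field_ip_add f_gauss)// !(field_ip_diag f_mean f_var).
  by rewrite (field_ip_stat f_gauss f_mean f_var f_stat); ring.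
pose s := Num.sqrt (2 + 2 * e).
have s2 : s ^+ 2 = 2 + 2 * e by rewrite sqr_sqrtr//; lra.
have s0 : 0 < s by rewrite sqrtr_gt0; lra.
apply: (@le_trans _ _ (Pr [set w | 2 * u < X w])).
  apply: le_Pr => //; first by apply: measurable_gtR; exact: field_span_measurable sX.
  by move=> w [/= h1 h2]; rewrite /X; lra.
apply: (@le_trans _ _ (psi (2 * u / s))).
  by apply: Pr_tail_le => //; rewrite ?s2 ?eX; lra.
have h : u <= 2 * u / s.
  rewrite ler_pdivlMr// mulrC ler_pM2r//.
  by rewrite -(@ler_pXn2r _ 2) ?nnegrE ?(ltW s0)// s2; lra.
apply: le_trans (normal_tail_ratio u0 h) _.
rewrite ler_wpM2l ?normal_tail_ge0// ler_expR.
rewrite expr_div_n s2 le_eqVlt; apply/orP; left; apply/eqP.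
by field; lra.
Qed.

Definition second_diff (i : 'I_d) (h : R) (y : 'rV[R]_d) w :=
  f (y + h *: basis_vec R i) w + f (y - h *: basis_vec R i) w - 2 * f y w.

Lemma second_diff_span i h y : span (second_diff i h y).
Proof.
apply: field_spanB; last exact/field_spanZ/field_span_pt.
by apply: field_spanD; exact: field_span_pt.
Qed.

Lemma measurable_second_diff i (h t : R) y : measurable [set w | second_diff i h y w <= t].
Proof. by apply: measurable_leR; apply: field_span_measurable; exact: second_diff_span. Qed.

Lemma second_diff_ip_stat i h y :
  ip (second_diff i h y) (second_diff i h y) = ip (second_diff i h 0) (second_diff i h 0).
Proof.
have E z : ip (second_diff i h z) (second_diff i h z) =
    6 + 2 * r (2 *: (h *: basis_vec R i)) - 8 * r (h *: basis_vec R i).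
  set v := h *: basis_vec R i.
  have s1 := field_span_pt f (z + v); have s2 := field_span_pt f (z - v).
  have s3 := field_span_pt f z; have s4 := field_spanZ (-2) s3; have s5 := field_spanD s1 s2.
  have -> : second_diff i h z = fun w => (f (z + v) w + f (z - v) w) + -2 * f z w.
    by apply/funext => w; rewrite /second_diff -/v; ring.
  rewrite (field_ip_add f_gauss)// (field_ip_add f_gauss)// !(field_ipZr f_gauss)//.
  rewrite (field_ipDl f_gauss)// (field_ipZl f_gauss)//.
  rewrite !(field_ip_stat f_gauss f_mean f_var f_stat) !subrr.
  have -> : z - v - (z + v) = - (2 *: v).
    by rewrite opprD addrACA subrr add0r -opprD scaler_nat mulr2n.
  have -> : z - (z + v) = - v by rewrite opprD addrA subrr add0r.
  have -> : z - (z - v) = v by rewrite opprB addrC subrK.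
  rewrite !(cov_kernelN f_gauss f_stat f_mean f_var) (cov_kernel0 f_gauss f_stat f_mean f_var).
  by ring.
by rewrite !E.
Qed.

Lemma second_diff_ip_pt i h y : ip (f y) (second_diff i h y) = 2 * r (h *: basis_vec R i) - 2.
Proof.
set v := h *: basis_vec R i.
have s1 := field_span_pt f (y + v); have s2 := field_span_pt f (y - v).
have s3 := field_span_pt f y; have s4 := field_spanZ 2 s3; have s5 := field_spanD s1 s2.
rewrite /second_diff -/v (field_ipBr f_gauss)// (field_ipDr f_gauss)// (field_ipZr f_gauss)//.
rewrite !(field_ip_stat f_gauss f_mean f_var f_stat) subrr (cov_kernel0 f_gauss f_stat f_mean f_var).
rewrite (_ : y + v - y = v); last by rewrite addrC addKr.
rewrite (_ : y - v - y = - v); last by rewrite addrC addKr.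
rewrite (cov_kernelN f_gauss f_stat f_mean f_var); ring.
Qed.

(** By contradiction: along some h_m -> 0 the second differences divided by (m + 1) h_m^2 would have
    variance above 1, yet they tend to 0 on every path. The pathwise constants are never
    integrated. *)
Lemma second_diff_variance1 (i : 'I_d) : exists2 C : R, 0 < C & forall h : R, 0 < h -> h < C^-1 ->
  ip (second_diff i h 0) (second_diff i h 0) <= C * h ^+ 4.
Proof.
apply: contrapT => H.
have {H}H (m : nat) : exists h : R, [/\ 0 < h, h < m.+1%:R^-1 &
    m.+1%:R ^+ 2 * h ^+ 4 < ip (second_diff i h 0) (second_diff i h 0)].
  apply: contrapT => Hm; apply: H; exists (m.+1%:R ^+ 2).
    by rewrite exprn_gt0// ltr0n.
  move=> h h0 hm; rewrite leNgt; apply/negP => hlt; apply: Hm; exists h; split => //.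
  apply: (lt_le_trans hm); rewrite lef_pV2 ?posrE ?exprn_gt0 ?ltr0n//.
  by rewrite expr2 ler_peMr ?ler1n ?ler0n.
have [h hP] := choice H.
pose X m w := (m.+1%:R * h m ^+ 2)^-1 * second_diff i (h m) 0 w.
have sX m : span (X m) by apply: field_spanZ; exact: second_diff_span.
have h0 : h @ \oo --> (0 : R).
  apply: (@squeeze_cvgr _ _ _ _ (cst 0) (fun m : nat => m.+1%:R^-1)).
  - by near=> m; have [h1 h2 _] := hP m; rewrite /= !ltW.
  - exact: cvg_cst.
  - exact: cvg_harmonic.
have X0 w : X ^~ w @ \oo --> cst 0 w.
  have [B hB] := is_C2_second_difference i (f_C2 w) h0.
  have c : (fun m : nat => m.+1%:R^-1 * B) @ \oo --> (0 : R).
    rewrite -[X in _ --> X](mul0r B); apply: seq_cvgM; last exact: cvg_cst.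
    exact: cvg_harmonic.
  have cN : (fun m : nat => - (m.+1%:R^-1 * B)) @ \oo --> (0 : R).
    by rewrite -oppr0; exact: cvgN.
  apply: (squeeze_cvgr _ cN c); near=> m; rewrite -ler_norml /X normrM.
  have [hm _ _] := hP m.
  have p0 : 0 < m.+1%:R * h m ^+ 2 by rewrite mulr_gt0 ?ltr0n// exprn_gt0.
  rewrite ger0_norm ?invr_ge0 ?(ltW p0)//.
  rewrite mulrC ler_pdivrMr// mulrACA mulVf ?pnatr_eq0// mul1r.
  rewrite /second_diff !add0r -scaleNr.
  by near: m.
have [v [cv vE]] := span_cvg_variance f_gauss f_mean sX X0.
have v0 : v = 0.
  rewrite vE.
  under eq_Rintegral do rewrite cos0.
  by rewrite (Rintegral_probability_cst P 1) ln1 mulr0.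
rewrite v0 in cv.
have := cv => /(cvgr_lt _) /(_ 1 ltr01) [N _ /(_ N (leqnn N))] /=.
have [hN _ hlt] := hP N.
have p0 : 0 < N.+1%:R * h N ^+ 2 by rewrite mulr_gt0 ?ltr0n// exprn_gt0.
rewrite (field_ipZl f_gauss) ?(field_ipZr f_gauss)//; try exact: second_diff_span.
rewrite mulrA -expr2 exprVn mulrC ltr_pdivrMr ?exprn_gt0// mul1r exprMn -exprM.
by move=> /(lt_trans hlt); rewrite ltxx.
Unshelve. all: by end_near. Qed.

Lemma second_diff_variance : exists2 C : R, 0 < C & forall (i : 'I_d) (h : R), 0 < h -> h < C^-1 ->
  ip (second_diff i h 0) (second_diff i h 0) <= C * h ^+ 4.
Proof.
have H (i : 'I_d) : exists C : R, 0 < C /\ forall h : R, 0 < h -> h < C^-1 ->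
    ip (second_diff i h 0) (second_diff i h 0) <= C * h ^+ 4.
  by have [C C0 hC] := second_diff_variance1 i; exists C.
have [C hC] := choice H.
have S0 : 0 <= \sum_i C i by apply: sumr_ge0 => i _; rewrite ltW//; case: (hC i).
have Ci i : C i <= 1 + \sum_i C i.
  rewrite (bigD1 i)//= addrCA lerDl addr_ge0// sumr_ge0// => j _.
  by rewrite ltW//; case: (hC j).
exists (1 + \sum_i C i) => [|i h h0 hS]; first by rewrite ltr_pwDl.
have [Ci0 hi] := hC i.
apply: le_trans (hi h h0 _) _; last by rewrite ler_wpM2r// exprn_ge0// ltW.
by apply: (lt_le_trans hS); rewrite lef_pV2 ?posrE//; rewrite ltr_pwDl.
Qed.

(* Since [f y] and the second difference are negatively correlated, a second
   difference below [-2 t] on [{f y > v}] forces the Gaussian variable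
   [f y - second_diff / h^2], of bounded variance, above [v + 2 t / h^2]. *)
Lemma second_diff_tail : exists2 C : R, 1 <= C & forall (i : 'I_d) (h : R) y (v t : R),
  0 < h -> h < C^-1 -> 0 < v -> 0 <= t ->
  Pr ([set w | v < f y w] `&` [set w | second_diff i h y w <= - (2 * t)]) <=
  psi ((v + 2 * t / h ^+ 2) / C).
Proof.
have [K K0 hK] := second_diff_variance.
(* By the Cauchy-Schwarz inequality the variable [W] below has variance at most 1 + 2 sqrt K + K,
   which is at most C^2. *)
pose C := 1 + Num.sqrt K + K; exists C; first by rewrite /C; have := sqrtr_ge0 K; lra.
move=> i h y v t h0 hC v0 t0.
have sD := second_diff_span i h y; have sy := field_span_pt f y.
have C1 : 1 <= C by rewrite /C; have := sqrtr_ge0 K; lra.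
have hK1 : h < K^-1.
  apply: (lt_le_trans hC); rewrite lef_pV2 ?posrE//; last lra.
  by rewrite /C; have := sqrtr_ge0 K; lra.
have vD : ip (second_diff i h y) (second_diff i h y) <= K * h ^+ 4.
  by rewrite second_diff_ip_stat; exact: hK.
have h2 : 0 < h ^+ 2 by rewrite exprn_gt0.
pose W w := f y w + (- (h ^+ 2)^-1) * second_diff i h y w.
have sZ := field_spanZ (- (h ^+ 2)^-1) sD.
have sW : span W by exact: field_spanD.
have eW : ip W W = 1 + 2 * (- (h ^+ 2)^-1 * ip (f y) (second_diff i h y))
    + (h ^+ 2)^-1 ^+ 2 * ip (second_diff i h y) (second_diff i h y).
  rewrite (field_ip_add f_gauss)// (field_ip_diag f_mean f_var).
  rewrite !(field_ipZr f_gauss)// (field_ipZl f_gauss)//; ring.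
have c0 : ip (f y) (second_diff i h y) <= 0.
  by rewrite second_diff_ip_pt; have := cov_kernel_le1 f_gauss f_stat f_mean f_var (h *: basis_vec R i); lra.
have W1 : 1 <= ip W W.
  have n0 : 0 <= - (h ^+ 2)^-1 * ip (f y) (second_diff i h y).
    by rewrite mulNr -mulrN mulr_ge0 ?invr_ge0 ?(ltW h2)// oppr_ge0.
  have n1 : 0 <= (h ^+ 2)^-1 ^+ 2 * ip (second_diff i h y) (second_diff i h y).
    by apply: mulr_ge0; [exact: sqr_ge0|exact: field_ip_ge0].
  rewrite eW; lra.
have q0 := sqrtr_ge0 K.
have qK : Num.sqrt K ^+ 2 = K by rewrite sqr_sqrtr// ltW.
have cK : - ip (f y) (second_diff i h y) <= Num.sqrt K * h ^+ 2.
  apply: le_trans (ler_norm _) _; rewrite normrN.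
  have b0 : 0 <= Num.sqrt K * h ^+ 2 by rewrite mulr_ge0// ltW.
  rewrite -(@ler_pXn2r _ 2) ?nnegrE// real_normK ?num_real//.
  apply: le_trans (cauchy_schwarz_field f_gauss sy sD) _.
  by rewrite (field_ip_diag f_mean f_var) mul1r exprMn qK -exprM.
have WC : ip W W <= C ^+ 2.
  have a1 : - (h ^+ 2)^-1 * ip (f y) (second_diff i h y) <= Num.sqrt K.
    by rewrite mulNr -mulrN mulrC ler_pdivrMr.
  have a2 : (h ^+ 2)^-1 ^+ 2 * ip (second_diff i h y) (second_diff i h y) <= K.
    by rewrite exprVn mulrC ler_pdivrMr ?exprn_gt0// -exprM.
  rewrite eW /C; nra.
apply: (@le_trans _ _ (Pr [set w | v + 2 * t / h ^+ 2 < W w])).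
  apply: le_Pr.
  - apply: measurableI; first exact: measurable_exceed.
    exact: measurable_second_diff.
  - by apply: measurable_gtR; exact: field_span_measurable sW.
  - move=> w [/= vf dt]; rewrite /W ltr_leD// mulNr -mulrN mulrC.
    by rewrite ler_wpM2l ?invr_ge0 ?(ltW h2)// lerNr.
apply: Pr_tail_le => //; try lra.
by rewrite addr_ge0 ?(ltW v0)// divr_ge0 ?(ltW h2)// mulr_ge0.
Qed.

Definition dir_deriv (k : 'rV[R]_d) (w : Omega) : R :=
  \sum_i k 0 i * 'D_(basis_vec R i) (fun x => f x w) 0.

(** Half the limiting variance of the difference quotients of f along k, read off from the
    characteristic function of the derivative. It is the coefficient of delta^2 in 1 - r(delta
    k). *)
Definition dir_curv (k : 'rV[R]_d) : R := - ln (\int[P]_w cos (dir_deriv k w)).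

Lemma dir_deriv_cvg (delta : nat -> R) k w : (forall n, delta n != 0) ->
  delta @ \oo --> (0 : R) ->
  (fun n => (f (delta n *: k) w - f 0 w) / delta n) @ \oo --> dir_deriv k w.
Proof.
move=> dn0 d0; apply: (@is_C1_cvg_directional _ _ (fun x => f x w)) => //.
have [c g1] := f_C2 w; split => // i; have [dg [cD g2]] := g1 i; split => //.
Qed.

Lemma cov_kernel_expansion (delta : nat -> R) k : (forall n, delta n != 0) ->
  delta @ \oo --> (0 : R) ->
  (fun n => (1 - r (delta n *: k)) / delta n ^+ 2) @ \oo --> dir_curv k.
Proof.
move=> dn0 d0; pose X n w := (delta n)^-1 * (f (delta n *: k) w - f 0 w).
have sI n : span (fun w => f (delta n *: k) w - f 0 w).
  by apply: field_spanB; exact: field_span_pt.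
have sX n : span (X n) by exact: field_spanZ.
have XY w : X ^~ w @ \oo --> dir_deriv k w.
  have := @dir_deriv_cvg delta k w dn0 d0.
  by apply: eq_near_cvg; near=> n; rewrite /X mulrC.
have [v [cv vE]] := span_cvg_variance f_gauss f_mean sX XY.
have cv2 := seq_cvgZ (c := 2^-1) cv.
rewrite (_ : dir_curv k = 2^-1 * v); last by rewrite vE /dir_curv; field.
apply: (eq_near_cvg _ cv2); near=> n.
rewrite (field_ipZl f_gauss)// (field_ipZr f_gauss)//.
rewrite (increment_variance f_gauss f_stat f_mean f_var) subr0; field; exact: dn0.
Unshelve. all: by end_near. Qed.

End FieldTails.

(** * The local limit at a high level *)

Lemma seq_cvg_min (R : realType) (u v : nat -> R) (a b : R) : u @ \oo --> a ->
  v @ \oo --> b -> (fun n => Num.min (u n) (v n)) @ \oo --> Num.min a b.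
Proof.
move=> ua vb.
have h (x y : R) : Num.min x y = (x + y - `|x - y|) / 2.
  by rewrite minElt; case: ltP => xy; [rewrite ltr0_norm ?subr_lt0//|rewrite ger0_norm ?subr_ge0//]; field.
rewrite h; under eq_fun do rewrite h.
apply: (@seq_cvgM _ (fun n => u n + v n - `|u n - v n|) (fun=> 2^-1)); last exact: cvg_cst.
apply: (@seq_cvgB _ (fun n => u n + v n) (fun n => `|u n - v n|)); first exact: seq_cvgD.
by apply: cvg_norm; exact: seq_cvgB.
Qed.

Lemma seq_cvg_max (R : realType) (u v : nat -> R) (a b : R) : u @ \oo --> a ->
  v @ \oo --> b -> (fun n => Num.max (u n) (v n)) @ \oo --> Num.max a b.
Proof.
move=> ua vb.
have h (x y : R) : Num.max x y = x + y - Num.min x y by rewrite minElt maxElt; case: ltP => _; ring.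
rewrite h; under eq_fun do rewrite h.
by apply: (@seq_cvgB _ (fun n => u n + v n)); [exact: seq_cvgD|exact: seq_cvg_min].
Qed.

Lemma seq_cvg_bigmin (R : realType) (I : Type) (s : seq I) (u : nat -> I -> R) (l : I -> R)
    (u0 : nat -> R) (l0 : R) : u0 @ \oo --> l0 ->
  (forall i, (fun n => u n i) @ \oo --> l i) ->
  (fun n => \big[Num.min/u0 n]_(i <- s) u n i) @ \oo --> \big[Num.min/l0]_(i <- s) l i.
Proof.
move=> ul0 ul; elim: s => [|i s IH].
  by rewrite big_nil; apply: (eq_near_cvg _ ul0); near=> n; rewrite big_nil.
rewrite big_cons; apply: (eq_near_cvg _ (seq_cvg_min (ul i) IH)).
by near=> n; rewrite big_cons.
Unshelve. all: by end_near. Qed.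

Section LocalLimit.
Context (disp : measure_display) (Omega : measurableType disp) (R : realType).
Context (P : probability Omega R) (d : nat) (f : 'rV[R]_d -> {RV P >-> R}).
Context (f_C2 : smooth_paths f 2) (f_gauss : gaussian_field f) (f_stat : stationary f).
Context (f_mean : forall x, ('E_P[f x] = 0)%E) (f_var : forall x, ('V_P[f x] = 1)%E).
Notation span := (field_span f).
Notation ip := (field_ip P).
Notation r := (cov_kernel f).
Notation psi := (@normal_tail R).

Definition local_last (u delta : R) (s : seq 'rV[R]_d) (h : 'rV[R]_d) : set Omega :=
  [set w | u < f h w /\ forall v, v \in s -> f (h + delta *: v) w <= u].

Lemma measurable_local_last u delta s h : measurable (local_last u delta s h).
Proof.
have -> : local_last u delta s h =
    [set w | u < f h w] `\` \big[setU/set0]_(v <- s) [set w | u < f (h + delta *: v) w].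
  apply/seteqP; split => w /=.
    move=> [h1 h2]; split => //; rewrite -bigcup_seq => -[v /= vs].
    by rewrite /= ltNge h2.
  move=> [h1 h2]; split => // v vs; rewrite leNgt; apply/negP => h3.
  by apply: h2; rewrite -bigcup_seq; exists v.
by apply: measurableD; [|apply: bigsetU_measurable => v _]; exact: measurable_exceed.
Qed.

Lemma local_last_stat u delta s h :
  Pr P (local_last u delta s h) = Pr P (local_last u delta s 0).
Proof.
pose x (i : 'I_(size s).+1) : 'rV[R]_d := nth 0 (0 :: [seq delta *: v | v <- s]) i.
pose A : set ((size s).+1.-tuple R) :=
  [set t | u < tnth t ord0] `&` \bigcap_(i in [set i : 'I_(size s).+1 | i != ord0]) [set t | tnth t i <= u].
have mA : measurable A.
  have mt (i : 'I_(size s).+1) : measurable_fun setT (fun t : (size s).+1.-tuple R => tnth t i) by exact: measurable_tnth.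
  apply: measurableI; first exact: measurable_gtR.
  apply: fin_bigcap_measurable => // i _.
  exact: measurable_leR.
have E z : local_last u delta s z = marginal f (fun i => x i + z) @^-1` A.
  apply/seteqP; split => w.
    move=> [h1 h2]; split.
      by rewrite /= tnth_mktuple /x /= add0r.
    move=> i /= i0; rewrite tnth_mktuple.
    have [j ji] : exists j, i = j.+1 :> nat by case: i i0 => -[|j]//= *; exists j.
    have js : (j < size s)%N by have := ltn_ord i; rewrite ji ltnS.
    rewrite /x ji /= (nth_map 0)// addrC; apply: h2; exact: mem_nth.
  move=> [/= h1 h2]; split; first by move: h1; rewrite tnth_mktuple /x /= add0r.
  move=> v vs.
  have js : ((index v s).+1 < (size s).+1)%N by rewrite ltnS index_mem.
  have := h2 (Ordinal js) isT; rewrite /= tnth_mktuple /x /= (nth_map 0) ?index_mem//.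
  by rewrite nth_index// addrC.
have := f_stat h x mA; rewrite /pushforward -E => PE.
have := f_stat 0 x mA; rewrite /pushforward -E => P0.
by rewrite /Pr PE P0.
Qed.

(* [c v] is the limit of [u_n] times the excess of [f 0] over [u_n] that is
   needed for [f (delta_n v)] to exceed [u_n] as well. *)
Definition local_const (a : R) (v0 : 'rV[R]_d) (s : seq 'rV[R]_d) : R :=
  let c v w := a ^+ 2 * dir_curv f v - a * dir_deriv f v w in
  \int[P]_w (1 - expR (- Num.max 0
    (\big[Num.min/c v0 w]_(j < (size s).+1) c (nth v0 (v0 :: s) j) w))).

(** With f(delta v) = rho f(0) + Z and Z orthogonal to f(0), the event is a strip u < f(0) <= u + W
    / u with W independent of f(0). On each path W converges, so the tail quotient converges to
    exp(- lim W), and everything is bounded by 1. *)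
Lemma local_last_cvg_aux (u delta : nat -> R) (a : R) v0 s :
  (forall n, 0 < u n) -> (forall n, 0 < delta n) ->
  (forall n (j : 'I_(size s).+1), 0 < r (delta n *: nth v0 (v0 :: s) j)) ->
  u @ \oo --> +oo -> delta @ \oo --> (0 : R) -> (fun n => u n * delta n) @ \oo --> a ->
  (fun n => Pr P (local_last (u n) (delta n) (v0 :: s) 0) / psi (u n)) @ \oo --> local_const a v0 s.
Proof.
move=> u0 dl0 rho0 uoo dlc ua.
pose v (j : 'I_(size s).+1) := nth v0 (v0 :: s) j.
pose rho n j := r (delta n *: v j).
pose Z n j w := f (delta n *: v j) w - rho n j * f 0 w.
pose c n j w := (u n ^+ 2 * (1 - rho n j) - u n * Z n j w) / rho n j.
pose c0 j w := a ^+ 2 * dir_curv f (v j) - a * dir_deriv f (v j) w.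
pose W n w := Num.max 0 (\big[Num.min/c n ord0 w]_(j < (size s).+1) c n j w).
have dn0 n : delta n != 0 by rewrite gt_eqF.
have cdef j : (fun n => (1 - rho n j) / delta n ^+ 2) @ \oo --> dir_curv f (v j).
  exact: (cov_kernel_expansion f_C2 f_gauss f_stat f_mean f_var).
have cu2 j : (fun n => u n ^+ 2 * (1 - rho n j)) @ \oo --> a ^+ 2 * dir_curv f (v j).
  have h := seq_cvgM (seq_cvgM ua ua) (cdef j).
  rewrite -expr2 in h; apply: (eq_near_cvg _ h); near=> n.
  by field; exact: dn0.
have ui := cvg_inv_pinfty uoo.
have crho j : (fun n => rho n j) @ \oo --> (1 : R).
  have h := seq_cvgM (cu2 j) (seq_cvgM ui ui).
  have h2 := seq_cvgB (cvg_cst (1 : R)) h; rewrite mul0r mulr0 subr0 in h2.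
  apply: (eq_near_cvg _ (h2 _)); near=> n.
  by field; rewrite gt_eqF.
have cZ j w : (fun n => u n * Z n j w) @ \oo --> a * dir_deriv f (v j) w.
  have h1 := @dir_deriv_cvg _ _ _ P d f f_C2 delta (v j) w dn0 dlc.
  have h2 := seq_cvgM ua h1.
  have h3 := seq_cvgM (seq_cvgM (cu2 j) ui) (cvg_cst (f 0 w)).
  have h4 := seq_cvgD h2 (h3 _); rewrite mulr0 mul0r addr0 in h4.
  apply: (eq_near_cvg _ (h4 _)); near=> n; rewrite /Z.
  by field; rewrite gt_eqF//=.
have cc j w : (fun n => c n j w) @ \oo --> c0 j w.
  have h1 := seq_cvgB (cu2 j) (cZ j w).
  have h2 : (fun n => (rho n j)^-1) @ \oo --> (1 : R).
    rewrite -[X in _ --> X]invr1; apply: cvgV => //; exact: oner_neq0.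
  by have := seq_cvgM h1 h2; rewrite mulr1.
have cW w : (fun n => W n w) @ \oo --> Num.max 0 (\big[Num.min/c0 ord0 w]_(j < (size s).+1) c0 j w).
  apply: seq_cvg_max; first exact: cvg_cst.
  by apply: seq_cvg_bigmin => [|j]; exact: cc.
have sF := field_span_pt f 0; have F1 := field_ip_diag f_mean f_var 0.
have sZ n j : span (Z n j) by apply: field_spanB; [|apply: field_spanZ]; exact: field_span_pt.
have oFZ n j : ip (f 0) (Z n j) = 0.
  have s1 := field_span_pt f (delta n *: v j); have s2 := field_spanZ (rho n j) sF.
  rewrite (field_ipBr f_gauss)// (field_ipZr f_gauss)// F1.
  by rewrite (field_ip_stat f_gauss f_mean f_var f_stat) subr0 mulr1 subrr.
have mW n : measurable_fun setT (W n).
  have mZ j : measurable_fun setT (Z n j) by exact: field_span_measurable (sZ n j).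
  have mc j : measurable_fun setT (c n j).
    by apply: measurable_funM => //; apply: measurable_funB => //; exact: measurable_funM.
  apply: measurable_maxr => //; elim: (index_enum _) => [|j l IH].
    by rewrite (_ : (fun _ => _) = c n ord0)//; apply/funext => w; rewrite big_nil.
  rewrite (_ : (fun _ => _) = fun w => Num.min (c n j w) (\big[Num.min/c n ord0 w]_(i <- l) c n i w)).
    exact: measurable_minr.
  by apply/funext => w; rewrite big_cons.
have mg n : measurable_fun setT (fun w => 1 - psi (u n + W n w / u n) / psi (u n)).
  apply: measurable_funB => //; apply: measurable_funM => //.
  apply: (@measurableT_comp _ _ _ _ _ _ psi).
    by apply: continuous_measurable_fun; exact: continuous_normal_tail.
  by apply: measurable_funD => //; exact: measurable_funM.
have W0 n w : 0 <= W n w by rewrite le_max lexx.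
(* Rewrites the constraint (u - Z) / rho as u plus the scaled excess [c] divided by u. *)
have alg (x z q : R) : 0 < x -> 0 < q -> (x - z) / q = x + (x ^+ 2 * (1 - q) - x * z) / q / x.
  by move=> x0 q0; field; rewrite !gt_eqF.
have E n : Pr P (local_last (u n) (delta n) (v0 :: s) 0) / psi (u n) =
    \int[P]_w (1 - psi (u n + W n w / u n) / psi (u n)).
  have [mM PM] := gaussian_strip f_gauss f_mean (u n) sF F1 (sZ n) (oFZ n) (rho0 n).
  have pu := normal_tail_gt0 (u n).
  have -> : Pr P (local_last (u n) (delta n) (v0 :: s) 0) =
      Pr P [set w | u n < f 0 w /\ forall j, rho n j * f 0 w + Z n j w <= u n].
    congr (Pr P _); apply/seteqP; split => w [h1 h2]; split => //.
      move=> j; rewrite /Z addrC subrK -[delta n *: _]add0r; apply: h2.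
      by rewrite /v; apply: mem_nth.
    move=> y ys; have js : (index y (v0 :: s) < (size s).+1)%N by rewrite index_mem.
    by have := h2 (Ordinal js); rewrite /Z /v addrC subrK /= add0r nth_index.
  rewrite /Pr PM -/(Rintegral _ _ _) mulrC -RintegralZl//; last first.
    apply: (@integrable_bounded _ _ _ P _ (psi (u n))).
      apply: measurable_funB => //; apply: (@measurableT_comp _ _ _ _ _ _ psi).
        by apply: continuous_measurable_fun; exact: continuous_normal_tail.
      exact: measurable_maxr.
    move=> w; rewrite ger0_norm; last by rewrite subr_ge0 normal_tail_nincr// le_max lexx.
    by rewrite lerBlDr lerDl normal_tail_ge0.
  apply: eq_Rintegral => w _; rewrite mulrBr mulVf ?gt_eqF// mulrC; congr (_ - psi _ / _).
  rewrite /W; set m1 := \big[_/_]_j _; set m2 := \big[_/_]_j _.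
  have -> : m1 = u n + m2 / u n.
    rewrite /m1 /m2; apply: (big_ind2 (fun x y => x = u n + y / u n)).
    - exact: alg (u0 n) (rho0 n ord0).
    - move=> x1 x2 y1 y2 -> ->; rewrite -addr_minr -minr_pMl//.
      by rewrite invr_ge0 ltW.
    - by move=> j _; exact: alg (u0 n) (rho0 n j).
  rewrite -{1}[u n]addr0 -addr_maxr; congr (_ + _).
  by rewrite maxr_pMl ?invr_ge0 ?ltW// mul0r.
have i1 : P.-integrable setT (EFin \o cst (1 : R)) by exact: finite_measure_integrable_cst.
have h : (fun n => \int[P]_w (1 - psi (u n + W n w / u n) / psi (u n))) @ \oo --> local_const a v0 s.
  apply: (@dominated_cvg_Rintegral _ _ _ P _ _ (cst 1)) => //.
  - have mc0 (j : 'I_(size s).+1) : measurable_fun setT (c0 j).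
      have mc n : measurable_fun setT (c n j).
        apply: measurable_funM => //; apply: measurable_funB => //; apply: measurable_funM => //.
        exact: field_span_measurable (sZ n j).
      exact: (measurable_fun_cvg mc (fun w _ => cc j w)).
    apply: measurable_funB => //; apply: (@measurableT_comp _ _ _ _ _ _ expR) => //.
    apply: measurable_funN; apply: measurable_maxr => //; elim: (index_enum _) => [|j l IH].
      rewrite (_ : (fun _ => _) = c0 ord0); first exact: mc0.
      by apply/funext => w; rewrite big_nil.
    rewrite (_ : (fun _ => _) = fun w => Num.min (c0 j w) (\big[Num.min/c0 ord0 w]_(i <- l) c0 i w)).
      by apply: measurable_minr => //; exact: mc0.
    by apply/funext => w; rewrite big_cons.
  - move=> w; apply: seq_cvgB; first exact: cvg_cst.
    by apply: normal_tail_shift => //; exact: cW.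
  - move=> n w; have pu := normal_tail_gt0 (u n).
    have h1 : psi (u n + W n w / u n) <= psi (u n).
      by apply: normal_tail_nincr; rewrite lerDl divr_ge0// ltW.
    rewrite /= ger0_norm ?subr_ge0 ?ler_pdivrMr ?mul1r// lerBlDr lerDl.
    by rewrite divr_ge0 ?normal_tail_ge0.
by apply: (eq_near_cvg _ h); near=> n; rewrite E.
Unshelve. all: by end_near. Qed.

Lemma local_last_cvg (u delta : nat -> R) (a : R) v0 s :
  (forall n, 0 < delta n) ->
  u @ \oo --> +oo -> delta @ \oo --> (0 : R) -> (fun n => u n * delta n) @ \oo --> a ->
  (fun n => Pr P (local_last (u n) (delta n) (v0 :: s) 0) / psi (u n)) @ \oo --> local_const a v0 s.
Proof.
move=> dl0 uoo dlc ua.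
have dn0 n : delta n != 0 by rewrite gt_eqF.
have crho (k : 'rV[R]_d) : (fun n => r (delta n *: k)) @ \oo --> (1 : R).
  have cd := @cov_kernel_expansion _ _ _ P d f f_C2 f_gauss f_stat f_mean f_var delta k dn0 dlc.
  have h := seq_cvgB (cvg_cst (1 : R)) (seq_cvgM (seq_cvgM dlc dlc) cd).
  rewrite !mul0r subr0 in h; apply: (eq_near_cvg _ (h _)); near=> n.
  by field; exact: dn0.
have [N hN] : exists N, forall n, (N <= n)%N -> 0 < u n /\
    forall j : 'I_(size s).+1, 0 < r (delta n *: nth v0 (v0 :: s) j).
  have h1 : \forall n \near \oo, 0 < u n by near=> n; near: n; apply: (cvgryPgt _).1.
  have h2 : \forall n \near \oo, forall j : 'I_(size s).+1, 0 < r (delta n *: nth v0 (v0 :: s) j).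
    apply: filter_forall => j.
    by have := crho (nth v0 (v0 :: s) j) => /(cvgr_gt _) /(_ 0 ltr01).
  have [N _ hN] : \forall n \near \oo, 0 < u n /\ forall j : 'I_(size s).+1, 0 < r (delta n *: nth v0 (v0 :: s) j).
    by near=> n; split; [near: n|near: n].
  by exists N => n /hN.
(* The level and the correlations are positive from N on; dropping the first terms makes this hold
   at every index. *)
rewrite -(cvg_shiftn N).
apply: (@local_last_cvg_aux (fun n => u (n + N)%N) (fun n => delta (n + N)%N)) => //.
- by move=> n; have [] := hN (n + N)%N (leq_addl _ _).
- by move=> n j; have [_ h] := hN (n + N)%N (leq_addl _ _).
- by rewrite (cvg_shiftn N).
- by rewrite (cvg_shiftn N).
- by rewrite (cvg_shiftn N (fun n => u n * delta n)).
Unshelve. all: by end_near. Qed.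

End LocalLimit.

(** * Exceedances on a lattice *)

Section Lexicographic.
Context (R : realType) (d : nat).
Implicit Types v w : 'rV[R]_d.

Definition lexpos v := [exists i : 'I_d,
  (0 < v 0 i) && [forall j : 'I_d, (j < i)%N ==> (v 0 j == 0)]].

Lemma lexposP v : reflect (exists2 i : 'I_d, 0 < v 0 i &
  forall j : 'I_d, (j < i)%N -> v 0 j = 0) (lexpos v).
Proof.
apply: (iffP existsP) => [[i /andP[vi /forallP h]]|[i vi h]]; exists i => //.
  by move=> j ji; apply/eqP; have := h j; rewrite ji.
by rewrite vi; apply/forallP => j; apply/implyP => /h ->.
Qed.

Lemma lexpos0 : lexpos 0 = false.
Proof. by apply/lexposP; case=> i; rewrite mxE ltxx. Qed.

Lemma lexposD v w : lexpos v -> lexpos w -> lexpos (v + w).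
Proof.
move=> /lexposP[i vi hi] /lexposP[j wj hj]; apply/lexposP.
have [ij|ji|/val_inj ij] := ltngtP i j.
- exists i => [|k ki]; rewrite mxE; first by rewrite hj// addr0.
  by rewrite hi// hj ?addr0// (ltn_trans ki).
- exists j => [|k kj]; rewrite mxE; first by rewrite hi// add0r.
  by rewrite hj// hi ?addr0// (ltn_trans kj).
- rewrite -ij in wj hj; exists i => [|k ki]; rewrite mxE; first exact: addr_gt0.
  by rewrite hi// hj// addr0.
Qed.

Lemma lexpos_total v : v != 0 -> lexpos v || lexpos (- v).
Proof.
move=> v0.
have [i0 vi0] : exists i, v 0 i != 0.
  apply: contrapT => h; move/eqP: v0; apply; apply/rowP => i; rewrite mxE.
  by apply: contrapT => /eqP vi; apply: h; exists i.
case: (@arg_minnP _ i0 (fun i => v 0 i != 0) (fun i => i : nat) vi0) => i vi hi.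
have h (j : 'I_d) : (j < i)%N -> v 0 j = 0.
  by move=> ji; apply/eqP; apply: contraTT ji => /hi; rewrite -leqNgt.
have [p|p|/eqP p] := ltgtP 0 (v 0 i).
- by apply/orP; left; apply/lexposP; exists i.
- apply/orP; right; apply/lexposP; exists i => [|j /h hj]; first by rewrite mxE oppr_gt0.
  by rewrite mxE hj oppr0.
- by rewrite eq_sym p in vi.
Qed.

Lemma grid_pt_inj N : injective (@grid_pt R d N).
Proof.
move=> x y /rowP xy; apply/ffunP => i; apply/val_inj/eqP.
by have := xy i; rewrite !mxE => /eqP; rewrite eqr_nat.
Qed.

Definition lex_offsets N (j : grid d N) : seq 'rV[R]_d :=
  [seq v <- [seq grid_pt R k - grid_pt R j | k <- index_enum (grid d N)] | lexpos v].

(** The lexicographically positive vectors of {-K, ..., K}^d, obtained by centring a grid of side 2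
    K. *)
Definition box_offsets K : seq 'rV[R]_d :=
  [seq v <- [seq grid_pt R o - const_mx K%:R | o <- index_enum (grid d (2 * K))] | lexpos v].

(** The lexicographic maximum is found as the point of A with the most grid points below it. *)
Lemma lex_last N (A : pred (grid d N)) j0 : A j0 ->
  exists2 j, A j & forall k, A k -> ~~ lexpos (grid_pt R k - grid_pt R j).
Proof.
move=> A0; pose below (j : grid d N) := #|[pred k : grid d N | lexpos (grid_pt R j - grid_pt R k)]|.
case: (@arg_maxnP _ j0 A below A0) => j Aj hj; exists j => // k /hj kj.
apply/negP => jk; move: kj; rewrite /= leqNgt => /negP; apply.
apply/proper_card/properP; split.
  by apply/fintype.subsetP => i; rewrite !inE => /(lexposD jk); rewrite addrA subrK.
by exists j; rewrite !inE// subrr lexpos0.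
Qed.

Definition box_interior K N (j : grid d N) :=
  [forall i, (K <= j i)%N && (j i + K <= N)%N].

Lemma box_interior_offsets K N (j : grid d N) : box_interior K j ->
  {subset box_offsets K <= lex_offsets j}.
Proof.
move=> /forallP hj v; rewrite !mem_filter => /andP[-> /=] /mapP[t _ ->].
have h i : (j i + t i - K < N.+1)%N.
  have /andP[h1 h2] := hj i; have := ltn_ord (t i); rewrite ltnS => h3.
  by move: h1 h2 h3; move: (nat_of_ord (j i)) (nat_of_ord (t i)) => x y; lia.
apply/mapP; exists ([ffun i => Ordinal (h i)] : grid d N); first exact: mem_index_enum.
apply/rowP => i; rewrite !mxE ffunE /= natrB; last first.
  by have /andP[h1 _] := hj i; exact: leq_trans h1 (leq_addr _ _).
by rewrite natrD; ring.
Qed.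

Lemma lex_offsets_far K N (j : grid d N) v : v \in lex_offsets j -> v \notin box_offsets K ->
  exists2 k : grid d N, v = grid_pt R k - grid_pt R j & exists i, K.+1%:R <= `|v 0 i|.
Proof.
rewrite !mem_filter => /andP[lv /mapP[k _ vE]]; rewrite lv /= => vK; exists k => //.
apply: contrapT => hv; move/negP: vK; apply.
have hi i : (k i + K - j i < (2 * K).+1)%N /\ (j i <= k i + K)%N.
  have : `|v 0 i| < K.+1%:R by rewrite ltNge; apply/negP => h; apply: hv; exists i.
  rewrite vE !mxE ltr_norml => /andP[h1 h2].
  have h3 : (k i < j i + K.+1)%N by rewrite -(@ltr_nat R) natrD; lra.
  have h4 : (j i < k i + K.+1)%N by rewrite -(@ltr_nat R) natrD; lra.
  by split; [rewrite ltnS leq_subLR|]; lia.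
apply/mapP; exists ([ffun i => Ordinal (hi i).1] : grid d (2 * K)); first exact: mem_index_enum.
apply/rowP => i; rewrite vE !mxE ffunE /= natrB; last exact: (hi i).2.
by rewrite natrD; ring.
Qed.

Lemma card_box_interior K N : ((N.+1 - 2 * K) ^ d <= #|@box_interior K N|)%N.
Proof.
have hK (i : 'I_(N.+1 - 2 * K)) : (i + K < N.+1)%N by have := ltn_ord i; lia.
pose g (t : {ffun 'I_d -> 'I_(N.+1 - 2 * K)}) : grid d N := [ffun i => Ordinal (hK (t i))].
have gi : injective g.
  move=> x y /ffunP xy; apply/ffunP => i; have := xy i; rewrite !ffunE => -[].
  by move=> /eqP; rewrite eqn_add2r => /eqP; exact: val_inj.
rewrite -{1}(card_ord d) -{1}(card_ord (N.+1 - 2 * K)) -card_ffun -(card_codom gi).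
apply/subset_leq_card/fintype.subsetP => t /codomP[x ->].
rewrite unfold_in; apply/forallP => i; rewrite ffunE /=.
by rewrite leq_addl /=; case: (x i) => y /= hy; lia.
Qed.

Lemma card_grid N : #|{: grid d N}| = (N.+1 ^ d)%N.
Proof. by rewrite card_ffun !card_ord. Qed.

End Lexicographic.

(** * Probabilities of finite unions *)

Section FiniteUnions.
Context (disp : measure_display) (Omega : measurableType disp) (R : realType).
Context (P : probability Omega R) (I : eqType) (F : I -> set Omega).
Hypothesis mF : forall i, measurable (F i).

Lemma seq_union_cons i s : [set w | exists2 j, j \in i :: s & F j w] =
  F i `|` [set w | exists2 j, j \in s & F j w].
Proof.
apply/seteqP; split => [w [j]|w [Fw|[j js Fw]]].
- by rewrite inE => /orP[/eqP -> ?|js ?]; [left|right; exists j].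
- by exists i; rewrite ?inE ?eqxx.
- by exists j; rewrite // inE js orbT.
Qed.

Lemma seq_union_nil : [set w | exists2 j, j \in [::] & F j w] = set0.
Proof. by apply/seteqP; split => // w []. Qed.

Lemma measurable_seq_union (s : seq I) : measurable [set w | exists2 j, j \in s & F j w].
Proof.
elim: s => [|i s IH]; first by rewrite seq_union_nil; exact: measurable0.
by rewrite seq_union_cons; exact: measurableU.
Qed.

Lemma Pr_setU_le A B : measurable A -> measurable B -> Pr P (A `|` B) <= Pr P A + Pr P B.
Proof.
move=> mA mB; rewrite -lee_fin EFinD -!Pr_EFin//; last exact: measurableU.
exact: measureU2.
Qed.

Lemma Pr_seq_union_le s :
  Pr P [set w | exists2 j, j \in s & F j w] <= \sum_(j <- s) Pr P (F j).
Proof.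
elim: s => [|i s IH]; first by rewrite seq_union_nil big_nil /Pr measure0.
rewrite seq_union_cons big_cons.
by apply: le_trans (Pr_setU_le _ _) _ => //; [exact: measurable_seq_union|rewrite lerD2l].
Qed.

Lemma Pr_seq_union_disjoint s : uniq s -> (forall i j w, F i w -> F j w -> i = j) ->
  Pr P [set w | exists2 j, j \in s & F j w] = \sum_(j <- s) Pr P (F j).
Proof.
move=> us dF; elim: s us => [_|i s IH /= /andP[iNs us]].
  by rewrite seq_union_nil big_nil /Pr measure0.
rewrite seq_union_cons big_cons -IH//; apply: EFin_inj.
have ms := measurable_seq_union s.
rewrite EFinD -!Pr_EFin//; last exact: measurableU.
apply: measureU => //; apply/seteqP; split => // w [/= Fi [j js Fj]].
by move: iNs; rewrite (dF _ _ _ Fi Fj) js.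
Qed.

End FiniteUnions.

(** * Gaussian sums over the grid *)

Section GeometricSums.
Context (R : realType).

(** The exponent is |k - j|, written with truncated subtraction. The bound carried through the
    induction is the exact value of (1 - x) times the sum, apart from a dropped term - x^(j + 1). *)
Lemma two_sided_geometric_sum (x : R) n j : 0 <= x < 1 ->
  \sum_(k < n) x ^+ (k - j + (j - k)) <= 2 / (1 - x).
Proof.
move=> /andP[x0 x1]; have x1' : 0 < 1 - x by lra.
suff : (1 - x) * \sum_(k < n) x ^+ (k - j + (j - k)) <=
    if (n <= j)%N then x ^+ (j - n).+1 else 1 + x - x ^+ (n - j).
  rewrite ler_pdivlMr// mulrC => /le_trans; apply.
  have h (m : nat) : 0 <= x ^+ m <= 1 by rewrite exprn_ge0// exprn_ile1// ltW.
  by case: ifP => _; [have := h (j - n).+1|have := h (n - j)%N]; lra.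
elim: n => [|n IH]; first by rewrite big_ord0 mulr0 leq0n exprn_ge0.
rewrite big_ord_recr mulrDr /=; have [nj|jn] := ltnP n j.
  rewrite (ltnW nj) in IH; apply: le_trans (lerD IH (lexx _)) _.
  have -> : (n - j + (j - n) = (j - n.+1).+1)%N by lia.
  have -> : (j - n = (j - n.+1).+1)%N by lia.
  by rewrite [x ^+ _.+2]exprS; lra.
have -> : (n - j + (j - n) = n - j)%N by lia.
rewrite subSn// exprS.
case: (leqP n j) IH => nj IH.
  have e : (n - j = 0)%N by lia.
  have e' : (j - n = 0)%N by lia.
  by move: IH; rewrite e e' expr1 expr0; lra.
by move: IH; lra.
Qed.

Lemma discrete_gaussian_sum (b : R) n (j : nat) : 0 < b ->
  \sum_(k < n) expR (- (b * (k%:R - j%:R) ^+ 2)) <= 2 / (1 - expR (- b)).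
Proof.
move=> b0; have x1 : 0 <= expR (- b) < 1 by rewrite expR_ge0 -expR0 ltr_expR oppr_lt0.
apply: le_trans _ (two_sided_geometric_sum n j x1); apply: ler_sum => k _.
rewrite -expRM_natl ler_expR mulrN lerN2 mulrC ler_pM2l// expr2.
have [kj|jk] := leqP k j.
  have -> : (k - j + (j - k) = j - k)%N by lia.
  rewrite -opprB mulrNN -natrB// -natrM ler_nat; nia.
have -> : (k - j + (j - k) = k - j)%N by lia.
by rewrite -natrB 1?ltnW// -natrM ler_nat; nia.
Qed.

Definition gauss_tail (d : nat) (b : R) (K : nat) : R :=
  expR (- (b * K.+1%:R)) * (2 / (1 - expR (- b))) ^+ d.

(** Half of the exponent pays for the distance: a coordinate differing by at least K + 1 makes the
    sum of squares at least K + 1. The other half is summed over all points, where the sum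
    factorises over coordinates. *)
Lemma grid_gaussian_sum d N K (b : R) (j : grid d N) : 0 < b ->
  \sum_(k : grid d N | [exists i, K.+1%:R <= `|(k i)%:R - (j i)%:R : R|])
    expR (- (2 * b * \sum_i ((k i)%:R - (j i)%:R) ^+ 2)) <= gauss_tail d b K.
Proof.
move=> b0.
have h (k : grid d N) : [exists i, K.+1%:R <= `|(k i)%:R - (j i)%:R : R|] ->
    expR (- (2 * b * \sum_i ((k i)%:R - (j i)%:R) ^+ 2)) <=
    expR (- (b * K.+1%:R)) * \prod_i expR (- (b * ((k i)%:R - (j i)%:R) ^+ 2)).
  move=> /existsP[i0 hi0]; rewrite -expR_sum -expRD ler_expR sumrN -mulr_sumr.
  set S := \sum_i _.
  have : K.+1%:R <= S.
    rewrite /S (bigD1 i0)//=; apply: (@le_trans _ _ (((k i0)%:R - (j i0)%:R) ^+ 2)); last first.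
      by rewrite lerDl sumr_ge0// => i _; rewrite sqr_ge0.
    rewrite -real_normK ?num_real// (le_trans hi0)// expr2 ler_peMr//.
    by rewrite (le_trans _ hi0)// ler1n.
  by move=> /(ler_wpM2l (ltW b0)); lra.
apply: le_trans (ler_sum _ h) _; rewrite -mulr_sumr ler_wpM2l ?expR_ge0//.
apply: (@le_trans _ _ (\sum_(k : {ffun 'I_d -> 'I_N.+1}) \prod_i expR (- (b * ((k i)%:R - (j i)%:R) ^+ 2)))).
  rewrite [leRHS](bigID (fun k : grid d N => [exists i, K.+1%:R <= `|(k i)%:R - (j i)%:R : R|]))/=.
  by rewrite lerDl sumr_ge0// => k _; rewrite prodr_ge0// => i _; exact: expR_ge0.
rewrite -(bigA_distr_bigA (fun i (x : 'I_N.+1) => expR (- (b * (x%:R - (j i)%:R) ^+ 2)))).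
rewrite -[X in _ <= _ ^+ X](card_ord d) -prodr_const; apply: ler_prod => i _.
by rewrite discrete_gaussian_sum// sumr_ge0// => x _; exact: expR_ge0.
Qed.

Lemma gauss_tail_cvg0 d (b : R) : 0 < b -> gauss_tail d b K @[K --> \oo] --> (0 : R).
Proof.
move=> b0; rewrite -[X in _ --> X](mul0r ((2 / (1 - expR (- b))) ^+ d)).
apply: seq_cvgM; last exact: cvg_cst.
have x1 : `|expR (- b)| < 1 by rewrite ger0_norm ?expR_ge0// -expR0 ltr_expR oppr_lt0.
have := cvg_geometric (expR (- b)) x1; apply: eq_near_cvg; near=> K.
by rewrite /geometric /= -exprS -expRM_natl mulrN mulrC.
Unshelve. all: by end_near. Qed.

End GeometricSums.

(** * Bounds for the exceedance probability on a lattice *)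

Section LatticeMaximum.
Context (disp : measure_display) (Omega : measurableType disp) (R : realType).
Context (P : probability Omega R) (d : nat) (f : 'rV[R]_d -> {RV P >-> R}).
Context (f_C2 : smooth_paths f 2) (f_gauss : gaussian_field f) (f_stat : stationary f).
Context (f_mean : forall x, ('E_P[f x] = 0)%E) (f_var : forall x, ('V_P[f x] = 1)%E).
Context (r_lim : cov_kernel f t @[t --> norm_infty R d] --> (0 : R)).
Notation r := (cov_kernel f).
Notation psi := (@normal_tail R).

(** On bounded sets the deficit is quadratic; elsewhere the correlation is below the prescribed e.
    The condition c |h|^2 <= 1 keeps the bound 1 - c |h|^2 nonnegative, as the pair estimate
    requires. *)
Lemma cov_kernel_regions (e : R) : 0 < e -> exists c : R, [/\ 0 < c &
  forall h, (r h <= 1 - c * `|h| ^+ 2 /\ c * `|h| ^+ 2 <= 1) \/ r h <= e].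
Proof.
move=> e0; have [c [c0 c1 hc]] := cov_deficit_lower f_gauss f_stat f_mean f_var r_lim.
have [M0 _ hM0] : norm_infty R d [set t | r t <= e].
  have ne : nbhs (0 : R) [set y | y <= e] by apply: (@cvgr_le _ _ _ _ id (0 : R) cvg_id e).
  exact: (r_lim ne).
pose M := Num.max M0 1.
have M1 : 1 <= M by rewrite le_max lexx orbT.
have M2 : 0 < M ^+ 2 by rewrite exprn_gt0//; lra.
exists (c / M ^+ 2); split; first by rewrite divr_gt0.
move=> h; have [Mh|hM] := ltP M `|h|.
  by right; apply: hM0; apply: le_lt_trans Mh; rewrite le_max lexx.
have h2 : `|h| ^+ 2 <= M ^+ 2 by rewrite ler_pXn2r ?nnegrE//; lra.
have q0 := sqr_ge0 `|h|.
have q : `|h| ^+ 2 / M ^+ 2 <= Num.min (`|h| ^+ 2) 1.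
  rewrite le_min !ler_pdivrMr// mul1r h2 andbT ler_peMr//.
  by rewrite -[1](expr1n _ 2) ler_pXn2r ?nnegrE//; lra.
left; rewrite mulrAC -mulrA; split; last first.
  apply: le_trans (_ : c * 1 <= 1); last by rewrite mulr1.
  by rewrite ler_wpM2l ?(ltW c0)// ler_pdivrMr// mul1r.
have := hc h; have := ler_wpM2l (ltW c0) q; lra.
Qed.

Definition lattice_pt (b : 'rV[R]_d) (delta : R) N (j : grid d N) : 'rV[R]_d :=
  b + delta *: grid_pt R j.

Definition lattice_exceed (u : R) b delta N : set Omega :=
  [set w | exists j : grid d N, u < f (lattice_pt b delta j) w].

Lemma lattice_pt_lex b delta N (j k : grid d N) :
  lattice_pt b delta j + delta *: (grid_pt R k - grid_pt R j) = lattice_pt b delta k.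
Proof. by rewrite /lattice_pt -addrA -scalerDr (addrC (grid_pt R k)) addrA subrr add0r. Qed.

Lemma lattice_exceed_union u b delta N : lattice_exceed u b delta N =
  [set w | exists2 j : grid d N, j \in index_enum (grid d N) & u < f (lattice_pt b delta j) w].
Proof.
by apply/seteqP; split => w [j h]; exists j => //; exact: mem_index_enum.
Qed.

Lemma measurable_lattice_exceed u b delta N : measurable (lattice_exceed u b delta N).
Proof.
by rewrite lattice_exceed_union; apply: measurable_seq_union => j; exact: measurable_exceed.
Qed.

Notation last_at u b delta j := (local_last f u delta (lex_offsets R j) (lattice_pt b delta j)).

Lemma last_at_le u b delta N (j k : grid d N) w : last_at u b delta j w ->
  lexpos (grid_pt R k - grid_pt R j) -> f (lattice_pt b delta k) w <= u.
Proof.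
move=> [_ h] kj; rewrite -(lattice_pt_lex b delta j); apply: h.
rewrite mem_filter kj; apply/mapP; exists k => //; exact: mem_index_enum.
Qed.

(* Split according to the lexicographically last exceedance; this order is
   invariant under translations, so all interior terms are equal. *)
Lemma lattice_exceed_sum u b delta N :
  Pr P (lattice_exceed u b delta N) = \sum_(j : grid d N) Pr P (last_at u b delta j).
Proof.
rewrite -(Pr_seq_union_disjoint P (F := fun j => last_at u b delta j)).
- congr (Pr P _); apply/seteqP; split => w; last by move=> [j _ [h _]]; exists j.
  move=> [j0 hj0]; have [j hj jmax] := @lex_last R d N (fun j => u < f (lattice_pt b delta j) w) j0 hj0.
  exists j; first exact: mem_index_enum.
  split => // v; rewrite mem_filter => /andP[lv /mapP[k _ vE]].
  rewrite vE lattice_pt_lex leNgt; apply: contraTN lv => /jmax; by rewrite vE.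
- by move=> j; exact: measurable_local_last.
- exact: index_enum_uniq.
- move=> j k w hj hk; apply: contrapT => jk.
  have ne : grid_pt R k - grid_pt R j != 0.
    by apply/eqP => /subr0_eq /grid_pt_inj E; apply: jk.
  have [h|h] := orP (lexpos_total ne).
    by have := last_at_le hj h; rewrite leNgt hk.1.
  rewrite opprB in h; by have := last_at_le hk h; rewrite leNgt hj.1.
Qed.

(** The Gaussian term serves pairs at bounded distance and is summable over k; [E] serves distant
    pairs and must be small against the number of points. *)
Definition pair_decay (u : R) b delta N (c E : R) := forall j k : grid d N,
  Pr P ([set w | u < f (lattice_pt b delta j) w] `&` [set w | u < f (lattice_pt b delta k) w]) <=
  psi u * (expR (- (2 * c * \sum_i ((k i)%:R - (j i)%:R) ^+ 2)) + E).

Lemma sum_sqr_le_norm (v : 'rV[R]_d) : \sum_i v 0 i ^+ 2 <= d%:R * `|v| ^+ 2.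
Proof.
have -> : d%:R * `|v| ^+ 2 = \sum_(i < d) `|v| ^+ 2 by rewrite sumr_const card_ord mulr_natl.
apply: ler_sum => i _; rewrite -real_normK ?num_real// ler_pXn2r ?nnegrE//.
by rewrite [leRHS]/Num.norm /= mx_normrE; apply/bigmax_geP; right => /=; exists (0, i).
Qed.

Lemma pair_decay_regime (kappa : R) : 0 < kappa -> kappa < 2^-1 -> exists2 c : R, 0 < c &
  forall (a u : R) b delta N, 0 < a -> 0 < u -> a ^+ 2 / 2 <= (u * delta) ^+ 2 ->
  pair_decay u b delta N (c * a ^+ 2) (expR (- (kappa * u ^+ 2))).
Proof.
(* Solves (1 - e) / (2 (1 + e)) = kappa, the exponent for pairs of correlation at most e. *)
move=> k0 k1; pose e := (1 - 2 * kappa) / (1 + 2 * kappa).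
have e0 : 0 < e by rewrite divr_gt0; lra.
have [c [c0 hc]] := cov_kernel_regions e0.
(* The losses are 4 from the exponent u^2 c |h|^2 / (2 (2 - c |h|^2)), 2 from a^2 / 2, 2 from the
   factor 2 in [pair_decay], and d + 1 from comparing the Euclidean with the maximum norm. *)
exists (c / 16 / (d%:R + 1)); first by rewrite !divr_gt0// ltr_wpDl.
move=> a u b delta N a0 u0 au j k.
pose h := lattice_pt b delta k - lattice_pt b delta j.
have D0 : 0 < d%:R + 1 :> R by rewrite ltr_wpDl.
have hE : h = delta *: (grid_pt R k - grid_pt R j).
  by rewrite /h -(lattice_pt_lex b delta j k) addrC addKr.
have p0 := normal_tail_ge0 u.
case: (hc h) => [[h1 h2]|h1].
  have q0 : 0 <= c * `|h| ^+ 2 by rewrite mulr_ge0 ?(ltW c0).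
  apply: le_trans (pair_tail f_gauss f_stat f_mean f_var u0 _ _ h1) _; try lra.
  rewrite ler_wpM2l// -[leLHS]addr0 lerD ?expR_ge0// ler_expR lerN2.
  set S := \sum_i _.
  have S1 : delta ^+ 2 * S <= (d%:R + 1) * `|h| ^+ 2.
    have := sum_sqr_le_norm h.
    have -> : \sum_i h 0 i ^+ 2 = delta ^+ 2 * S.
      by rewrite hE /S mulr_sumr; apply: eq_bigr => i _; rewrite !mxE exprMn.
    by move=> /le_trans; apply; rewrite ler_wpM2r ?sqr_ge0//; lra.
  have S0 : 0 <= S by rewrite sumr_ge0// => i _; rewrite sqr_ge0.
  apply: (@le_trans _ _ (u ^+ 2 * (c * `|h| ^+ 2 / 4))); last first.
    rewrite ler_wpM2l ?sqr_ge0// opprB addrCA subrr addr0.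
    by rewrite ler_pdivlMr; nra.
  have S2 : a ^+ 2 / 2 * S <= u ^+ 2 * ((d%:R + 1) * `|h| ^+ 2).
    apply: le_trans (ler_wpM2r S0 au) _.
    by rewrite exprMn -mulrA ler_wpM2l ?sqr_ge0.
  have -> : 2 * (c / 16 / (d%:R + 1) * a ^+ 2) * S = c / (4 * (d%:R + 1)) * (a ^+ 2 / 2 * S).
    by field; lra.
  apply: le_trans (ler_wpM2l _ S2) _; first by rewrite divr_ge0//; lra.
  by rewrite le_eqVlt; apply/orP; left; apply/eqP; field; lra.
have e1 : e <= 1 by rewrite ler_pdivrMr; lra.
apply: le_trans (pair_tail f_gauss f_stat f_mean f_var u0 (ltW e0) e1 h1) _.
rewrite ler_wpM2l// -[leLHS]add0r lerD ?expR_ge0// ler_expR lerN2.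
have -> : (1 - e) / (2 * (1 + e)) = kappa by rewrite /e; field; lra.
by rewrite mulrC.
Qed.

(** For a point whose box lies in the grid, being last on the grid implies being last in the box.
    The other points are few, and each is charged psi(u). *)
Lemma lattice_exceed_upper u b delta N K :
  Pr P (lattice_exceed u b delta N) <=
  N.+1%:R ^+ d * Pr P (local_last f u delta (box_offsets R d K) 0) +
  (N.+1%:R ^+ d - (N.+1 - 2 * K)%:R ^+ d) * psi u.
Proof.
set p := Pr P (local_last _ _ _ _ _).
have h (j : grid d N) : Pr P (last_at u b delta j) <= p + (~~ box_interior K j)%:R * psi u.
  case: (boolP (box_interior K j)) => jK /=.
    rewrite mul0r addr0 /p -(local_last_stat f_stat u delta _ (lattice_pt b delta j)).
    apply: le_Pr; try exact: measurable_local_last.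
    move=> w [h1 h2]; split => // v /(box_interior_offsets jK); exact: h2.
  rewrite mul1r; apply: (@le_trans _ _ (psi u)); last by rewrite lerDr; exact: Pr_ge0.
  rewrite -(Pr_exceed f_gauss f_mean f_var (lattice_pt b delta j)); apply: le_Pr.
  - exact: measurable_local_last.
  - exact: measurable_exceed.
  - by move=> w [].
rewrite lattice_exceed_sum; apply: le_trans (ler_sum _ (fun j _ => h j)) _.
rewrite big_split /= sumr_const cardT -cardE card_grid -mulr_suml -[p *+ _]mulr_natl natrX lerD2l.
rewrite ler_wpM2r ?normal_tail_ge0//.
rewrite -natr_sum -big_mkcond /= sum1_card -!natrX lerBrDr -natrD ler_nat.
rewrite -card_grid -(cardC (@box_interior d K N)) addnC leq_add2r.
exact: card_box_interior.
Qed.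

(** A last exceedance in the box that is not last on the grid is accompanied by an exceedance more
    than K away in some coordinate. This holds at boundary points too, whose box leaves the grid. *)
Lemma lattice_exceed_lower u b delta N K (c E : R) : 0 < c -> 0 <= E ->
  pair_decay u b delta N c E ->
  N.+1%:R ^+ d * (Pr P (local_last f u delta (box_offsets R d K) 0)
    - psi u * (gauss_tail d c K + N.+1%:R ^+ d * E)) <= Pr P (lattice_exceed u b delta N).
Proof.
move=> c0 E0 dec; set p := Pr P (local_last _ _ _ _ _).
have p0 := normal_tail_ge0 u.
have h (j : grid d N) : p - psi u * (gauss_tail d c K + N.+1%:R ^+ d * E) <= Pr P (last_at u b delta j).
  pose far (k : grid d N) := [exists i, K.+1%:R <= `|(k i)%:R - (j i)%:R : R|].
  pose A (k : grid d N) := [set w | u < f (lattice_pt b delta j) w] `&`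
    [set w | u < f (lattice_pt b delta k) w].
  have mA k : measurable (A k) by apply: measurableI; exact: measurable_exceed.
  have mU := measurable_seq_union mA [seq k <- index_enum (grid d N) | far k].
  rewrite lerBlDr /p -(local_last_stat f_stat u delta _ (lattice_pt b delta j)).
  apply: (@le_trans _ _ (Pr P (last_at u b delta j `|`
      [set w | exists2 k, k \in [seq k <- index_enum (grid d N) | far k] & A k w]))).
    apply: le_Pr; first exact: measurable_local_last.
      by apply: measurableU => //; exact: measurable_local_last.
    move=> w [h1 h2]; case: (pselect (last_at u b delta j w)) => hl; first by left.
    right; apply: contrapT => hk; apply: hl; split => // v vj.
    have [vK|vK] := boolP (v \in box_offsets R d K); first exact: h2.
    have [k vE [i hi]] := lex_offsets_far vj vK.
    rewrite leNgt; apply/negP => hv; apply: hk; exists k.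
      rewrite mem_filter mem_index_enum andbT; apply/existsP; exists i.
      by move: hi; rewrite vE !mxE.
    by split => //=; rewrite -(lattice_pt_lex b delta j) -vE.
  apply: le_trans (Pr_setU_le _ _ _) _ => //; first exact: measurable_local_last.
  rewrite lerD2l; apply: le_trans (Pr_seq_union_le P mA _) _.
  rewrite big_filter; apply: le_trans (ler_sum _ (fun k _ => dec j k)) _.
  rewrite -mulr_sumr ler_wpM2l// big_split /= lerD ?grid_gaussian_sum//.
  apply: (@le_trans _ _ (\sum_(k : grid d N) E)).
    by rewrite [leRHS](bigID far)/= lerDl sumr_ge0.
  by rewrite sumr_const cardT -cardE card_grid -natrX mulr_natl.
rewrite lattice_exceed_sum; apply: le_trans (ler_sum _ (fun j _ => h j)).
by rewrite sumr_const cardT -cardE card_grid -natrX mulr_natl.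
Qed.

End LatticeMaximum.

(** * The limiting density of exceedances for a given mesh parameter *)

Section LatticeLimit.
Context (disp : measure_display) (Omega : measurableType disp) (R : realType).
Context (P : probability Omega R) (d : nat) (f : 'rV[R]_d -> {RV P >-> R}).
Context (f_C2 : smooth_paths f 2) (f_gauss : gaussian_field f) (f_stat : stationary f).
Context (f_mean : forall x, ('E_P[f x] = 0)%E) (f_var : forall x, ('V_P[f x] = 1)%E).
Context (r_lim : cov_kernel f t @[t --> norm_infty R d] --> (0 : R)).
Context (kappa : R) (kappa_gt0 : 0 < kappa) (kappa_lt : kappa < 2^-1).
Notation psi := (@normal_tail R).

(** The condition u delta -> a fixes the mesh at the natural scale 1 / u; the last condition makes
    the distant pairs negligible in the union bound. *)
Definition mesh_regime (a : R) (u delta : nat -> R) (N : nat -> nat) : Prop :=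
  [/\ u @ \oo --> +oo, forall n, 0 < delta n, delta @ \oo --> (0 : R) &
   [/\ (fun n => u n * delta n) @ \oo --> a, (fun n => (N n).+1%:R : R) @ \oo --> +oo &
      (fun n => (N n).+1%:R ^+ d * expR (- (kappa * u n ^+ 2))) @ \oo --> (0 : R)]].

Definition exceed_density (u : R) b (delta : R) N : R :=
  Pr P (lattice_exceed f u b delta N) / (N.+1%:R ^+ d * psi u).

(** For an empty list of offsets the event is u < f(0) itself, whose normalised probability is 1. *)
Definition box_const (a : R) K : R :=
  if box_offsets R d K is v0 :: s then local_const f a v0 s else 1.

Lemma box_const_cvg (a : R) (u delta : nat -> R) K :
  (forall n, 0 < delta n) ->
  u @ \oo --> +oo -> delta @ \oo --> (0 : R) -> (fun n => u n * delta n) @ \oo --> a ->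
  (fun n => Pr P (local_last f (u n) (delta n) (box_offsets R d K) 0) / psi (u n)) @ \oo -->
    box_const a K.
Proof.
move=> dl0 uoo dlc ua; rewrite /box_const.
case: (box_offsets R d K) => [|v0 s]; last exact: local_last_cvg.
apply: (eq_near_cvg _ (cvg_cst (1 : R))); near=> n.
rewrite (_ : local_last _ _ _ _ _ = [set w | u n < f 0 w]); last first.
  by apply/seteqP; split => w //= [].
by rewrite (Pr_exceed f_gauss f_mean f_var) divff// gt_eqF// normal_tail_gt0.
Unshelve. all: by end_near. Qed.

Lemma box_const0 (a : R) : box_const a 0 = 1.
Proof.
rewrite /box_const; case E : (box_offsets R d 0) => [//|v s].
have : v \in box_offsets R d 0 by rewrite E mem_head.
rewrite mem_filter => /andP[lv /mapP[t _ vE]].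
have v0 : v = 0 by apply/rowP => i; rewrite vE !mxE; case: (t i) => -[|m] //= _; rewrite subrr.
by rewrite v0 lexpos0 in lv.
Qed.

Lemma interior_ratio_cvg K (N : nat -> nat) : (fun n => (N n).+1%:R : R) @ \oo --> +oo ->
  (fun n => 1 - ((N n).+1 - 2 * K)%:R ^+ d / (N n).+1%:R ^+ d) @ \oo --> (0 : R).
Proof.
move=> Noo; have Ni := cvg_inv_pinfty Noo.
have h1 : (fun n => 1 - (2 * K)%:R * (N n).+1%:R^-1) @ \oo --> (1 : R).
  rewrite -[X in _ --> X]subr0 -[X in _ - X](mulr0 (2 * K)%:R).
  by apply: seq_cvgB; [exact: cvg_cst|exact: seq_cvgZ].
have h2 : (fun n => (1 - (2 * K)%:R * (N n).+1%:R^-1) ^+ d) @ \oo --> (1 ^+ d : R).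
  exact: seq_cvgX.
have -> : (0 : R) = 1 - 1 ^+ d by rewrite expr1n subrr.
apply: (eq_near_cvg _ (seq_cvgB (cvg_cst (1 : R)) h2)).
near=> n; rewrite -expr_div_n; congr (1 - _ ^+ _).
have h : (2 * K <= (N n).+1)%N.
  by rewrite -(ler_nat R); near: n; exact: (cvgryPge _).1.
by rewrite natrB// mulrBl divff ?pnatr_eq0.
Unshelve. all: by end_near. Qed.

(** The boundary points and the distant pairs vanish with n and go into e; the tail over moderately
    distant pairs remains. Since c depends neither on a nor on the sequences, this tail is small for
    large K and also, with K = 0, for large a. *)
Lemma exceed_density_approx : exists2 c : R, 0 < c & forall (a : R) u delta N b, 0 < a ->
  mesh_regime a u delta N -> forall K (e : R), 0 < e -> \forall n \near \oo,
  `|exceed_density (u n) b (delta n) (N n) - box_const a K| <= gauss_tail d (c * a ^+ 2) K + e.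
Proof.
have [c c0 hc] := pair_decay_regime f_gauss f_stat f_mean f_var r_lim kappa_gt0 kappa_lt.
exists c => // a u delta N b a0 [uoo dl0 dlc [ua Noo gr]] K e e0.
have e3 : 0 < e / 3 by rewrite divr_gt0.
have tc := @box_const_cvg a u delta K dl0 uoo dlc ua.
have ic := interior_ratio_cvg K Noo.
have ua2 := seq_cvgM ua ua.
near=> n.
have u0 : 0 < u n by near: n; exact: (cvgryPgt _).1.
have a2 : a ^+ 2 / 2 <= (u n * delta n) ^+ 2.
  rewrite [leRHS]expr2; near: n; apply: cvgr_ge ua2 _ _.
  by rewrite -expr2 ltr_pdivrMr//; have := exprn_gt0 2 a0; lra.
have tn : `|box_const a K - Pr P (local_last f (u n) (delta n) (box_offsets R d K) 0) / psi (u n)| <= e / 3.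
  by near: n; move: (tc) => /cvgrPdist_le; exact.
have im : `|0 - (1 - ((N n).+1 - 2 * K)%:R ^+ d / (N n).+1%:R ^+ d)| <= e / 3.
  by near: n; move: (ic) => /cvgrPdist_le; exact.
have gn : `|0 - (N n).+1%:R ^+ d * expR (- (kappa * u n ^+ 2))| <= e / 3.
  by near: n; move: (gr) => /cvgrPdist_le; exact.
have D0 : 0 < (N n).+1%:R ^+ d :> R by rewrite exprn_gt0// ltr0n.
have p0 := normal_tail_gt0 (u n).
have up := lattice_exceed_upper f_gauss f_stat f_mean f_var (u n) b (delta n) (N n) K.
have ca : 0 < c * a ^+ 2 by rewrite mulr_gt0// exprn_gt0.
have lo := lattice_exceed_lower f_stat K ca (expR_ge0 _)
  (hc a (u n) b (delta n) (N n) a0 u0 a2).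
set p := Pr P (local_last _ _ _ _ _) in tn up lo.
have up' : exceed_density (u n) b (delta n) (N n) <=
    p / psi (u n) + (1 - ((N n).+1 - 2 * K)%:R ^+ d / (N n).+1%:R ^+ d).
  rewrite /exceed_density ler_pdivrMr ?mulr_gt0//; apply: le_trans up _.
  by rewrite le_eqVlt; apply/orP; left; apply/eqP; field; rewrite !gt_eqF.
have lo' : p / psi (u n) - (gauss_tail d (c * a ^+ 2) K +
    (N n).+1%:R ^+ d * expR (- (kappa * u n ^+ 2))) <= exceed_density (u n) b (delta n) (N n).
  rewrite /exceed_density ler_pdivlMr ?mulr_gt0//; apply: le_trans lo.
  by rewrite le_eqVlt; apply/orP; left; apply/eqP; field; rewrite !gt_eqF.
have g0 : 0 <= gauss_tail d (c * a ^+ 2) K.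
  rewrite mulr_ge0 ?expR_ge0// exprn_ge0// divr_ge0// subr_ge0 -expR0 ler_expR oppr_le0.
  exact: ltW.
move: tn im gn; rewrite !ler_norml => /andP[t1 t2] /andP[i1 i2] /andP[g1 g2].
by apply/andP; split; lra.
Unshelve. all: by end_near. Qed.

(** The approximating constants involve only a and K, so the limit depends on a alone. This allows
    the same value to be used at the level u and at a slightly lower one. *)
Lemma exceed_density_limit : exists L : R -> R, forall (a : R) u delta N b, 0 < a ->
  mesh_regime a u delta N ->
  (fun n => exceed_density (u n) b (delta n) (N n)) @ \oo --> L a.
Proof.
have [c c0 hc] := exceed_density_approx.
exists (fun a => lim (box_const a @ \oo)) => a u delta N b a0 reg.
have gt := gauss_tail_cvg0 d (mulr_gt0 c0 (exprn_gt0 2 a0)).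
pose x n := exceed_density (u n) b (delta n) (N n).
have cx : cvg (x @ \oo).
  apply/cauchy_cvgP/(@cauchy_exP _ _ (x @ \oo)) => e e0.
  have e4 : 0 < e / 4 by rewrite divr_gt0.
  have [K _ hK] : \forall K \near \oo, gauss_tail d (c * a ^+ 2) K <= e / 4 by apply: cvgr_le gt _ _.
  exists (box_const a K); rewrite /nbhs /=.
  have := hc a u delta N b a0 reg K _ e4; apply: filterS => n hn.
  rewrite -ball_normE /ball_ /= distrC (le_lt_trans hn)//.
  by have := hK K (leqnn K); rewrite /=; lra.
suff bl : box_const a @ \oo --> lim (x @ \oo) by rewrite (cvg_lim _ bl).
apply/cvgrPdist_le => e e0; near=> K.
have hK : gauss_tail d (c * a ^+ 2) K <= e / 2.
  by near: K; apply: cvgr_le gt _ _; rewrite divr_gt0.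
have e2 : 0 < e / 2 by rewrite divr_gt0.
have cn : (fun n => `|x n - box_const a K|) @ \oo --> `|lim (x @ \oo) - box_const a K|.
  by apply: cvg_norm; apply: seq_cvgB => //; exact: cvg_cst.
rewrite -(cvg_lim _ cn)//; apply: limr_le; first by apply/cvg_ex; eexists; exact: cn.
have := hc a u delta N b a0 reg K _ e2; apply: filterS => n hn.
by rewrite (le_trans hn)//; lra.
Unshelve. all: by end_near. Qed.

(** With K = 0 the box constant is 1, and a large a makes the pair tail at most 1/2; the remaining
    error is 1/4. *)
Lemma exceed_density_positive : exists2 a : R, 0 < a & forall u delta N b,
  mesh_regime a u delta N ->
  \forall n \near \oo, 1 / 4 <= exceed_density (u n) b (delta n) (N n).
Proof.
have [c c0 hc] := exceed_density_approx.
have [a a0 ha] : exists2 a : R, 0 < a & gauss_tail d (c * a ^+ 2) 0 <= 1 / 2.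
  have h1 : (fun m : nat => expR (- (c * m%:R))) @ \oo --> (0 : R).
    have x1 : `|expR (- c)| < 1 by rewrite ger0_norm ?expR_ge0// -expR0 ltr_expR oppr_lt0.
    apply: (eq_near_cvg _ (cvg_expr x1)); near=> m.
    by rewrite -expRM_natl mulrN mulrC.
  have h2 : (fun m : nat => expR (- (c * m%:R)) * (2 / (1 - expR (- (c * m%:R)))) ^+ d) @ \oo --> (0 : R).
    rewrite -[X in _ --> X](mul0r ((2 / (1 - 0)) ^+ d)); apply: seq_cvgM => //.
    apply: seq_cvgX.
    apply: seq_cvgZ; apply: cvgV; first by rewrite subr0 oner_neq0.
    by apply: seq_cvgB => //; exact: cvg_cst.
  have [M _ hM] : \forall m \near \oo, expR (- (c * m%:R)) * (2 / (1 - expR (- (c * m%:R)))) ^+ d <= 1 / 2.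
    by apply: cvgr_le h2 _ _; lra.
  exists (Num.sqrt M.+1%:R); first by rewrite sqrtr_gt0 ltr0n.
  by rewrite sqr_sqrtr ?ler0n// /gauss_tail mulr1; apply: hM => /=.
exists a => // u delta N b reg.
have e0 : (0 : R) < 1 / 4 by lra.
have := hc a u delta N b a0 reg 0%N (1 / 4) e0; apply: filterS => n.
by rewrite box_const0 ler_norml => /andP[h _]; lra.
Unshelve. all: by end_near. Qed.

End LatticeLimit.

(** * Dyadic chaining *)

Section DyadicRefinement.
Context (R : realType) (d : nat).
Implicit Types (g : 'rV[R]_d -> R) (b : 'rV[R]_d) (j : 'I_d -> nat).

Definition node b (h : R) j : 'rV[R]_d := b + h *: \row_i (j i)%:R.

Definition odd_coords j := #|[pred i | odd (j i)]|.

Lemma node_shift b h j (i : 'I_d) c : node b h (fun l => if l == i then c else j l) =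
  node b h j + (h * (c%:R - (j i)%:R)) *: basis_vec R i.
Proof.
apply/rowP => l; rewrite !mxE eqxx /=; case: eqP => [->|_]; last by rewrite mulr0 addr0.
by rewrite mulr1; ring.
Qed.

Lemma odd_coords_shift j (i : 'I_d) c : odd (j i) -> ~~ odd c ->
  odd_coords j = (odd_coords (fun l => if l == i then c else j l)).+1.
Proof.
move=> ji oc; rewrite /odd_coords (cardD1 i) inE ji add1n; congr _.+1.
by apply: eq_card => l; rewrite !inE; case: eqP => [->|_] //=; rewrite (negbTE oc).
Qed.

(* Induction on the number of odd coordinates: a node with an odd coordinate is
   the midpoint of two nodes with one odd coordinate less. *)
Lemma dyadic_refinement g b (h v V t : R) N : v <= V -> 0 <= t ->
  (forall j, (forall i, j i <= N)%N -> g (node b (2 * h) j) <= V) ->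
  (forall j i, (forall i, j i <= 2 * N)%N -> v < g (node b h j) ->
    - (2 * t) < g (node b h j + h *: basis_vec R i) + g (node b h j - h *: basis_vec R i)
      - 2 * g (node b h j)) ->
  forall j, (forall i, j i <= 2 * N)%N -> g (node b h j) <= V + d%:R * t.
Proof.
move=> vV t0 h1 h2.
have H m : forall j, odd_coords j = m -> (forall i, j i <= 2 * N)%N -> g (node b h j) <= V + m%:R * t.
  elim: m => [|m IH] j jm jN.
    have E : node b h j = node b (2 * h) (fun i => (j i)./2).
      congr (_ + _); apply/rowP => i; rewrite !mxE.
      have : ~~ odd (j i).
        by apply/negP => oi; have := card0_eq jm i; rewrite !inE oi.
      move=> ei; rewrite -{1}(even_halfK ei) -muln2 natrM; ring.
    rewrite mul0r addr0 E; apply: h1 => i; have := jN i; lia.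
  have [i oi] : exists i, odd (j i).
    have : (0 < odd_coords j)%N by rewrite jm.
    by move=> /card_gt0P[i]; rewrite inE; exists i.
  have [ji0 ji1] : (0 < j i)%N /\ (j i < 2 * N)%N.
    split; first by case: (j i) oi.
    by rewrite ltn_neqAle jN andbT; apply/eqP => e; move: oi; rewrite e mul2n odd_double.
  have side c : ~~ odd c -> (c <= 2 * N)%N ->
      g (node b h j + (h * (c%:R - (j i)%:R)) *: basis_vec R i) <= V + m%:R * t.
    move=> oc cN; rewrite -node_shift; apply: IH.
      by apply: succn_inj; rewrite -jm; exact/esym/odd_coords_shift.
    by move=> l; case: ifP.
  have sp : g (node b h j + h *: basis_vec R i) <= V + m%:R * t.
    have e : (j i).+1%:R - (j i)%:R = 1 :> R by rewrite -natr1 addrC addKr.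
    by have := side (j i).+1; rewrite e mulr1 /= oi; exact.
  have sm : g (node b h j - h *: basis_vec R i) <= V + m%:R * t.
    have e : (j i).-1%:R - (j i)%:R = -1 :> R.
      by rewrite -{2}(prednK ji0) -natr1 opprD addrA subrr sub0r.
    have := side (j i).-1; rewrite e mulrN1 scaleNr -subn1 oddB// oi; apply => //.
    by lia.
  (* Above v, the second difference bounds the midpoint by the mean of its neighbours plus t; below
     v, the bound is immediate from v <= V. *)
  have [gv|gv] := ltP v (g (node b h j)).
    by have := h2 j i jN gv; rewrite -natr1; lra.
  apply: le_trans gv _; rewrite (le_trans vV)// lerDl mulr_ge0//.
move=> j jN; apply: le_trans (H _ j erefl jN) _; rewrite lerD2l ler_wpM2r// ler_nat.
by rewrite -[leqRHS](card_ord d) max_card.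
Qed.

End DyadicRefinement.

(** * From the lattice to the continuum *)

Section Chaining.
Context (disp : measure_display) (Omega : measurableType disp) (R : realType).
Context (P : probability Omega R) (d : nat) (f : 'rV[R]_d -> {RV P >-> R}).
Context (f_C2 : smooth_paths f 2) (f_gauss : gaussian_field f) (f_stat : stationary f).
Context (f_mean : forall x, ('E_P[f x] = 0)%E) (f_var : forall x, ('V_P[f x] = 1)%E).
Notation psi := (@normal_tail R).

Lemma lattice_node (u : R) b h N w :
  lattice_exceed f u b h N w <-> exists2 j : 'I_d -> nat, (forall i, j i <= N)%N & u < f (node b h j) w.
Proof.
split=> [[j hj]|[j jN hj]].
  by exists (fun i => j i : nat) => // i; rewrite -ltnS.
have jN' i : (j i < N.+1)%N by rewrite ltnS.
exists [ffun i => Ordinal (jN' i)]; rewrite /lattice_pt.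
rewrite (_ : grid_pt R _ = \row_i (j i)%:R)//.
by apply/rowP => i; rewrite !mxE ffunE.
Qed.

(** The exceptional event is that some fine node is above v with a second difference at most - 2 t
    in some direction; the union bound runs over nodes and directions. *)
Lemma lattice_exceed_refine : exists2 C : R, 1 <= C & forall b (h v V t : R) N,
  0 < h -> h < C^-1 -> 0 < v -> v <= V -> 0 <= t ->
  Pr P (lattice_exceed f (V + d%:R * t) b h (2 * N)) <=
  Pr P (lattice_exceed f V b (2 * h) N) +
    d%:R * (2 * N).+1%:R ^+ d * psi ((v + 2 * t / h ^+ 2) / C).
Proof.
have [C C1 hC] := second_diff_tail f_C2 f_gauss f_stat f_mean f_var.
exists C => // b h v V t N h0 hC1 v0 vV t0.
pose A (ji : grid d (2 * N) * 'I_d) := [set w | v < f (lattice_pt b h ji.1) w] `&`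
  [set w | second_diff f ji.2 h (lattice_pt b h ji.1) w <= - (2 * t)].
have mA ji : measurable (A ji).
  by apply: measurableI; [exact: measurable_exceed|exact: measurable_second_diff].
pose s := index_enum ((grid d (2 * N) * 'I_d)%type : finType).
have mU := measurable_seq_union mA s.
apply: (@le_trans _ _ (Pr P (lattice_exceed f V b (2 * h) N `|`
    [set w | exists2 ji, ji \in s & A ji w]))).
  apply: le_Pr; first exact: measurable_lattice_exceed.
    by apply: measurableU => //; exact: measurable_lattice_exceed.
  move=> w hw; apply: contrapT => /not_orP[n1 n2].
  have [j jN] := (lattice_node _ _ _ _ _).1 hw; rewrite ltNge => /negP; apply.
  apply: (@dyadic_refinement _ _ (fun x => f x w) b h v V t N) => //.
    move=> l lN; rewrite leNgt; apply/negP => hl; apply: n1; apply/lattice_node.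
    by exists l.
  move=> l i lN hl; rewrite ltNge; apply/negP => hs; apply: n2.
  have lN' k : (l k < (2 * N).+1)%N by rewrite ltnS.
  have E : lattice_pt b h ([ffun k => Ordinal (lN' k)] : grid d (2 * N)) = node b h l.
    rewrite /lattice_pt /node; congr (_ + _ *: _).
    by apply/rowP => k; rewrite !mxE ffunE.
  exists ([ffun k => Ordinal (lN' k)], i); first exact: mem_index_enum.
  by rewrite /A /= E; split.
apply: le_trans (Pr_setU_le _ _ _) _ => //; first exact: measurable_lattice_exceed.
rewrite lerD2l; apply: le_trans (Pr_seq_union_le P mA _) _.
apply: le_trans (ler_sum _ (fun ji _ => hC ji.2 h (lattice_pt b h ji.1) v t h0 hC1 v0 t0)) _.
rewrite sumr_const cardT -cardE card_prod card_ord card_grid -[leLHS]mulr_natl natrM natrX.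
by rewrite [d%:R * _]mulrC.
Qed.

Lemma triple_lt_exp4 m : (3 * m < 4 ^ m)%N.
Proof.
elim: m => [|m IH]; first by [].
by rewrite expnS; move: (4 ^ m)%N IH => x; lia.
Qed.

Lemma sum_geometric_le (q : R) K : 0 <= q -> q <= 2^-1 -> \sum_(k < K) q ^+ k.+1 <= 2 * q.
Proof.
move=> q0 q1; suff : \sum_(k < K) q ^+ k.+1 <= 2 * q - 2 * q ^+ K.+1.
  by move=> /le_trans; apply; have := exprn_ge0 K.+1 q0; lra.
elim: K => [|K IH]; first by rewrite big_ord0 expr1 subrr.
rewrite big_ord_recr /=; apply: le_trans (lerD IH (lexx _)) _.
by have := exprn_ge0 K.+1 q0; rewrite (exprS q K.+1); nra.
Qed.

(** The level rises from v towards v + eta / v, each step using half of what is left, while h^2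
    shrinks by a factor 4. Thus 2 t / h^2 doubles at each step, and the smallness of (v delta)^2
    against eta makes it at least C 2^(k+1) v. The exceptional probability per node is then at most
    psi(2^(k+1) v), which beats the growth of the number of nodes: the errors form a geometric
    series of ratio at most 1/2. *)
Lemma dyadic_chaining : (0 < d)%N -> exists2 C : R, 1 <= C & forall b (delta v eta : R) N K,
  0 < delta -> delta < C^-1 -> 0 < v -> 0 <= eta -> C * d%:R * (v * delta) ^+ 2 <= 2 * eta ->
  2 ^+ d * expR (- (3 / 2 * v ^+ 2)) <= 2^-1 ->
  Pr P (lattice_exceed f (v + eta / v) b (delta / 2 ^+ K) (2 ^ K * N)) <=
  Pr P (lattice_exceed f v b delta N) +
    N.+1%:R ^+ d * psi v * (2 * d%:R * (2 ^+ d * expR (- (3 / 2 * v ^+ 2)))).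
Proof.
move=> d0; have [C C1 hC] := lattice_exceed_refine; exists C => // b delta v eta N K dl0 dlC v0 eta0 small q1.
set q := 2 ^+ d * _ in q1 *.
have q0 : 0 <= q by rewrite mulr_ge0 ?exprn_ge0// expR_ge0.
have p0 := normal_tail_gt0 v.
(* The increment from k to k + 1 is eta / v / 2^(k+1); it is split below into d equal parts [t], one
   for each possible odd coordinate. *)
pose V k := v + eta / v * (1 - (2 ^+ k)^-1).
have ev0 : 0 <= eta / v by rewrite divr_ge0// ltW.
have two0 k : 0 < 2 ^+ k :> R by rewrite exprn_gt0.
have two1 k : 1 <= 2 ^+ k :> R by rewrite exprn_ege1// ler1n.
have VK k : v <= V k <= v + eta / v.
  have h1 : (2 ^+ k)^-1 <= 1 :> R by rewrite invf_le1.
  have h2 : 0 <= (2 ^+ k)^-1 :> R by rewrite invr_ge0 ltW.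
  by rewrite /V; apply/andP; split; nra.
have main k : Pr P (lattice_exceed f (V k) b (delta / 2 ^+ k) (2 ^ k * N)) <=
    Pr P (lattice_exceed f v b delta N) + N.+1%:R ^+ d * psi v * (d%:R * \sum_(l < k) q ^+ l.+1).
  elim: k => [|k IH].
    by rewrite big_ord0 !mulr0 addr0 /V expr0 invr1 subrr mulr0 addr0 mulr1 expn0 mul1n.
  have dR : 0 < d%:R :> R by rewrite ltr0n.
  pose t := eta / v / (d%:R * 2 ^+ k.+1); pose h := delta / 2 ^+ k.+1.
  have h0 : 0 < h by rewrite divr_gt0.
  have hC1 : h < C^-1 by apply: le_lt_trans dlC; rewrite ler_pdivrMr// ler_peMr// ltW.
  have t0 : 0 <= t by rewrite divr_ge0// mulr_ge0 ?ler0n// ltW.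
  have /andP[vV _] := VK k.
  have := hC b h v (V k) t (2 ^ k * N)%N h0 hC1 v0 vV t0.
  have -> : V k + d%:R * t = V k.+1.
    by rewrite /V /t exprS; field; rewrite !gt_eqF.
  have -> : 2 * h = delta / 2 ^+ k by rewrite /h exprS; field; rewrite gt_eqF.
  rewrite mulnA -expnS => /le_trans; apply.
  rewrite big_ord_recr /= !mulrDr [leRHS]addrA lerD//.
  rewrite -[leLHS]mulrA [leRHS]mulrCA ler_wpM2l ?ler0n//.
  have g1 : 2 ^+ k.+1 * v <= (v + 2 * t / h ^+ 2) / C.
    rewrite ler_pdivlMr; last lra.
    apply: (@le_trans _ _ (2 * t / h ^+ 2)); last by rewrite lerDr ltW.
    have -> : 2 * t / h ^+ 2 = 2 ^+ k.+1 * (2 * eta) / (v * d%:R * delta ^+ 2).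
      by rewrite /t /h; field; rewrite !gt_eqF.
    rewrite ler_pdivlMr; last by rewrite !mulr_gt0// exprn_gt0.
    rewrite -!mulrA ler_wpM2l ?(ltW (two0 _))//; apply: le_trans small.
    by rewrite le_eqVlt; apply/orP; left; apply/eqP; ring.
  have g2 : psi ((v + 2 * t / h ^+ 2) / C) <= psi v * expR (- (3 / 2 * v ^+ 2)) ^+ k.+1.
    apply: le_trans (normal_tail_nincr g1) _.
    have g3 : v <= 2 ^+ k.+1 * v by rewrite ler_peMl// ltW.
    apply: le_trans (normal_tail_ratio v0 g3) _.
    rewrite ler_wpM2l ?(ltW p0)// -expRM_natl ler_expR.
    have g4 : 1 + 3 * k.+1%:R <= (2 ^+ k.+1) ^+ 2 :> R.
      have -> : (2 ^+ k.+1) ^+ 2 = (4 ^ k.+1)%:R :> R.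
        by rewrite natrX -exprM mulnC exprM; congr (_ ^+ _); ring.
      by rewrite -natrM addrC natr1 ler_nat; exact: triple_lt_exp4.
    have := sqr_ge0 v; rewrite exprMn; nra.
  have g5 : (2 ^ k.+1 * N).+1%:R ^+ d <= N.+1%:R ^+ d * (2 ^+ d) ^+ k.+1 :> R.
    rewrite [(2 ^+ d) ^+ _]exprAC -exprMn ler_pXn2r ?nnegrE ?mulr_ge0 ?(ltW (two0 _))//.
    by rewrite -natrX -natrM ler_nat mulSn mulnC -add1n leq_add2r expn_gt0.
  apply: (@le_trans _ _ ((N.+1%:R ^+ d * (2 ^+ d) ^+ k.+1) * (psi v * expR (- (3 / 2 * v ^+ 2)) ^+ k.+1))).
    by rewrite ler_pM// ?exprn_ge0// normal_tail_ge0.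
  by rewrite le_eqVlt; apply/orP; left; apply/eqP; rewrite /q exprMn; ring.
have /andP[_ VKu] := VK K.
apply: (@le_trans _ _ (Pr P (lattice_exceed f (V K) b (delta / 2 ^+ K) (2 ^ K * N)))).
  apply: le_Pr; try exact: measurable_lattice_exceed.
  by move=> w [j hj]; exists j; exact: le_lt_trans hj.
apply: le_trans (main K) _; rewrite lerD2l ler_wpM2l ?mulr_ge0 ?exprn_ge0 ?(ltW p0)//.
rewrite -mulrA mulrCA ler_wpM2l ?ler0n//; exact: sum_geometric_le.
Qed.

Definition cube_exceed (u : R) (b : 'rV[R]_d) (l : R) : set Omega :=
  [set w | exists2 x : 'rV[R]_d, forall i, b 0 i <= x 0 i <= b 0 i + l & u < f x w].

Lemma lattice_exceed_nested u b (delta : R) N :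
  lattice_exceed f u b delta N `<=` lattice_exceed f u b (delta / 2) (2 * N).
Proof.
move=> w /lattice_node[j jN hj]; apply/lattice_node; exists (fun i => 2 * j i)%N.
  by move=> i; rewrite leq_mul2l /= jN.
rewrite (_ : node _ _ _ = node b delta j)//; congr (_ + _); apply/rowP => i.
by rewrite !mxE natrM; field.
Qed.

(** An exceedance is an open condition along a continuous path, and the dyadic nodes are dense in
    the cube. *)
Lemma cube_exceedE (u : R) b (delta : R) N : 0 < delta ->
  cube_exceed u b (N%:R * delta) =
  \bigcup_k lattice_exceed f u b (delta / 2 ^+ k) (2 ^ k * N).
Proof.
move=> dl0; have two0 k : 0 < 2 ^+ k :> R by rewrite exprn_gt0.
apply/seteqP; split => [w [x xB hx]|w [k _ /lattice_node[j jN hj]]]; last first.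
  exists (node b (delta / 2 ^+ k) j) => // i; rewrite !mxE lerDl lerD2l.
  rewrite mulr_ge0 ?divr_ge0 ?(ltW dl0) ?(ltW (two0 k))//=.
  rewrite mulrAC ler_pdivrMr// mulrC mulrAC ler_wpM2r ?(ltW dl0)//.
  by rewrite -natrX -natrM ler_nat mulnC.
pose y k := node b (delta / 2 ^+ k) (fun i => Num.trunc ((x 0 i - b 0 i) * 2 ^+ k / delta)).
have yx k : `|x - y k| <= delta / 2 ^+ k.
  have h0 : 0 <= delta / 2 ^+ k by rewrite divr_ge0// ltW.
  rewrite [leLHS]/Num.norm /= mx_normrE; apply/bigmax_leP; split => // -[i0 i] _ /=.
  rewrite !mxE ord1; set s := x 0 i - b 0 i.
  have s0 : 0 <= s by rewrite subr_ge0; have /andP[] := xB i.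
  have z0 : 0 <= s * 2 ^+ k / delta by rewrite divr_ge0 ?mulr_ge0 ?(ltW dl0)// ltW.
  have /andP[t1 t2] := truncn_itv z0.
  have e : s = delta / 2 ^+ k * (s * 2 ^+ k / delta) by field; rewrite !gt_eqF.
  rewrite opprD addrA -/s {1}e -mulrBr normrM ger0_norm// ler_piMr//.
  by rewrite ger0_norm ?subr_ge0// lerBlDr addrC natr1 ltW.
have cx : (fun k : nat => f (y k) w) @ \oo --> f x w.
  have yc : y @ \oo --> x.
    have x1 : `|2^-1 : R| < 1 by rewrite ger0_norm ?invf_lt1 ?ltr1n// invr_ge0.
    have c0 := seq_cvgZ (c := delta) (cvg_expr x1); rewrite mulr0 in c0.
    apply/cvgrPdist_le => e e0; near=> k; apply: le_trans (yx k) _.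
    by rewrite -exprVn; near: k; exact: cvgr_le c0 _ _.
  have [cf _] := f_C2 w; exact: (cvg_comp _ _ yc (cf x)).
have [K _ hK] : \forall k \near \oo, u < f (y k) w by apply: cvgr_gt cx _ hx.
exists K => //; apply/lattice_node; exists (fun i => Num.trunc ((x 0 i - b 0 i) * 2 ^+ K / delta)).
  move=> i; have /andP[x1 x2] := xB i.
  have z0 : 0 <= (x 0 i - b 0 i) * 2 ^+ K / delta.
    by rewrite divr_ge0 ?mulr_ge0 ?(ltW dl0) ?subr_ge0// ltW.
  rewrite -(@ler_nat R); have /andP[zt _] := truncn_itv z0; apply: (le_trans zt).
  rewrite ler_pdivrMr// natrM natrX -mulrA mulrC ler_wpM2l ?(ltW (two0 K))//.
  by rewrite lerBlDl.
exact: hK K (leqnn K).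
Unshelve. all: by end_near. Qed.

Lemma measurable_cube_exceed u b l : 0 < l -> measurable (cube_exceed u b l).
Proof.
move=> l0; rewrite -[l]mul1r (@cube_exceedE u b l 1%N l0).
by apply: bigcupT_measurable => k; exact: measurable_lattice_exceed.
Qed.

End Chaining.

(** * Exceedances on a cube *)

Lemma cvg_mul_expR_sqr (R : realType) (c : R) (u : nat -> R) : 0 < c -> u @ \oo --> +oo ->
  (fun n => u n * expR (- (c * u n ^+ 2))) @ \oo --> (0 : R).
Proof.
move=> c0 uoo.
have ui := cvg_inv_pinfty uoo.
have ci := seq_cvgZ (c := c^-1) ui; rewrite mulr0 in ci.
apply: (squeeze_cvgr _ (cvg_cst 0) ci); near=> n.
have u0 : 0 < u n by near: n; exact: (cvgryPgt _).1.
rewrite mulr_ge0 ?expR_ge0 ?(ltW u0)//= expRN -invfM ler_pdivrMr ?expR_gt0//.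
rewrite mulrC ler_pdivlMr ?mulr_gt0//.
have -> : u n * (c * u n) = c * u n ^+ 2 by ring.
by apply: le_trans (expR_ge1Dx _); rewrite lerDr.
Unshelve. all: by end_near. Qed.

Lemma cvg_expR_sqr (R : realType) (c : R) (u : nat -> R) : 0 < c -> u @ \oo --> +oo ->
  (fun n => expR (- (c * u n ^+ 2))) @ \oo --> (0 : R).
Proof.
move=> c0 uoo.
have ui := cvg_inv_pinfty uoo.
have h := seq_cvgM ui (cvg_mul_expR_sqr c0 uoo); rewrite mulr0 in h.
apply: (eq_near_cvg _ h); near=> n.
have u0 : 0 < u n by near: n; exact: (cvgryPgt _).1.
by rewrite mulKf// gt_eqF.
Unshelve. all: by end_near. Qed.

Section CubeMaximum.
Context (disp : measure_display) (Omega : measurableType disp) (R : realType).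
Context (P : probability Omega R) (d : nat) (d_gt0 : (0 < d)%N) (f : 'rV[R]_d -> {RV P >-> R}).
Context (f_C2 : smooth_paths f 2) (f_gauss : gaussian_field f) (f_stat : stationary f).
Context (f_mean : forall x, ('E_P[f x] = 0)%E) (f_var : forall x, ('V_P[f x] = 1)%E).
Context (r_lim : cov_kernel f t @[t --> norm_infty R d] --> (0 : R)).
Context (kappa : R) (kappa_gt0 : 0 < kappa) (kappa_lt : kappa < 2^-1).
Notation psi := (@normal_tail R).

Lemma le_cube_exceed (u v : R) b l : u <= v -> cube_exceed f v b l `<=` cube_exceed f u b l.
Proof. by move=> uv w [x xB hx]; exists x => //; exact: le_lt_trans hx. Qed.

Lemma lattice_cube_exceed u b (delta : R) N : 0 < delta ->
  lattice_exceed f u b delta N `<=` cube_exceed f u b (N%:R * delta).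
Proof.
move=> dl0 w hw; rewrite (cube_exceedE f_C2)//; exists 0%N => //.
by rewrite expr0 divr1 expn0 mul1n.
Qed.

(** The dyadic lattices are nested, so the probability for the cube is the limit of those for the
    lattices. *)
Lemma Pr_cube_exceed_le (u : R) b (delta : R) N (x : R) : 0 < delta ->
  (forall k, Pr P (lattice_exceed f u b (delta / 2 ^+ k) (2 ^ k * N)) <= x) ->
  Pr P (cube_exceed f u b (N%:R * delta)) <= x.
Proof.
move=> dl0 hx; rewrite (cube_exceedE f_C2)//.
pose A k := lattice_exceed f u b (delta / 2 ^+ k) (2 ^ k * N).
have mA k : measurable (A k) by exact: measurable_lattice_exceed.
have nA : nondecreasing_seq A.
  apply/nondecreasing_seqP => k; apply/subsetPset; rewrite /A exprS expnS -mulnA.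
  rewrite (_ : delta / (2 * 2 ^+ k) = delta / 2 ^+ k / 2); last by rewrite invfM mulrA mulrAC.
  exact: lattice_exceed_nested.
have mU : measurable (\bigcup_k A k) by exact: bigcupT_measurable.
have := nondecreasing_cvg_mu (mu := P) mA mU nA.
rewrite -lee_fin -Pr_EFin// => c.
rewrite -(cvg_lim _ c)//; apply: lime_le; first by apply/cvg_ex; eexists; exact: c.
by apply: nearW => k; rewrite /= Pr_EFin// lee_fin; exact: hx.
Qed.

(** The number of mesh steps per side. The mesh a / u is adjusted so as to divide the side n + 1 of
    the cube exactly, and the successor keeps the count positive. *)
Definition mesh_count (a : R) (u : nat -> R) n : nat := (Num.trunc (n.+1%:R * u n / a)).+1.

Definition mesh_size (a : R) (u : nat -> R) n : R := n.+1%:R / (mesh_count a u n)%:R.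

Lemma mesh_sizeM a u n : (mesh_count a u n)%:R * mesh_size a u n = n.+1%:R.
Proof. by rewrite /mesh_size mulrC divfK// pnatr_eq0. Qed.

Lemma mesh_size_gt0 a u n : 0 < mesh_size a u n.
Proof. by rewrite divr_gt0. Qed.

Lemma mesh_count_ratio (a : R) u : 0 < a -> u @ \oo --> +oo ->
  (fun n => (mesh_count a u n)%:R / (n.+1%:R * u n)) @ \oo --> a^-1 /\
  (fun n => (mesh_count a u n).+1%:R / (n.+1%:R * u n)) @ \oo --> a^-1.
Proof.
move=> a0 uoo.
have ui := cvg_inv_pinfty uoo.
have sq (c : R) (z : nat -> R) : (\forall n \near \oo, a^-1 <= z n <= a^-1 + c * (u n)^-1) ->
    z @ \oo --> a^-1.
  move=> hz; apply: (squeeze_cvgr hz); first exact: cvg_cst.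
  rewrite -[X in _ --> X]addr0 -[X in _ + X](mulr0 c).
  by apply: seq_cvgD; [exact: cvg_cst|exact: seq_cvgZ].
have b : \forall n \near \oo, 0 < u n /\
    n.+1%:R * u n / a <= (mesh_count a u n)%:R <= n.+1%:R * u n / a + 1.
  near=> n; have u0 : 0 < u n by near: n; exact: (cvgryPgt _).1.
  split => //; have z0 : 0 <= n.+1%:R * u n / a by rewrite divr_ge0 ?mulr_ge0 ?ltW.
  have /andP[t1 t2] := truncn_itv z0.
  by rewrite (ltW t2) /= /mesh_count -[(Num.trunc _).+1%:R]natr1 lerD2r.
split; [apply: (sq 1)|apply: (sq 2)]; near=> n.
  have [u0 /andP[b1 b2]] : 0 < u n /\ n.+1%:R * u n / a <= (mesh_count a u n)%:R <= n.+1%:R * u n / a + 1.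
    by near: n.
  have D0 : 0 < n.+1%:R * u n by rewrite mulr_gt0.
  rewrite ler_pdivlMr// ler_pdivrMr// mulrC b1 /= (le_trans b2)//.
  rewrite mulrDl mulrC lerD2l mul1r mulrCA mulVf ?gt_eqF// mulr1 ler1n//.
have [u0 /andP[b1 b2]] : 0 < u n /\ n.+1%:R * u n / a <= (mesh_count a u n)%:R <= n.+1%:R * u n / a + 1.
  by near: n.
have D0 : 0 < n.+1%:R * u n by rewrite mulr_gt0.
rewrite ler_pdivlMr// ler_pdivrMr// mulrC -[(mesh_count a u n).+1%:R]natr1.
have -> : (a^-1 + 2 * (u n)^-1) * (n.+1%:R * u n) = n.+1%:R * u n / a + 2 * n.+1%:R.
  by field; rewrite !gt_eqF.
apply/andP; split; first lra.
have n1 : 1 <= n.+1%:R :> R by rewrite ler1n.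
lra.
Unshelve. all: by end_near. Qed.

Lemma mesh_regime_exists (a : R) (u : nat -> R) : 0 < a -> u @ \oo --> +oo ->
  (fun n => (n.+1%:R * u n) ^+ d * expR (- (kappa * u n ^+ 2))) @ \oo --> (0 : R) ->
  mesh_regime d kappa a u (mesh_size a u) (mesh_count a u).
Proof.
move=> a0 uoo gr; have [c1 c2] := mesh_count_ratio a0 uoo.
have ui := cvg_inv_pinfty uoo.
have ua : (fun n => u n * mesh_size a u n) @ \oo --> a.
  have h : (fun n => ((mesh_count a u n)%:R / (n.+1%:R * u n))^-1) @ \oo --> a^-1^-1.
    by apply: cvgV => //; rewrite invr_neq0// gt_eqF.
  rewrite invrK in h; apply: (eq_near_cvg _ h); near=> n.
  by rewrite invf_div /mesh_size mulrA [u n * _]mulrC.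
split => //; first by move=> n; exact: mesh_size_gt0.
  have h := seq_cvgM ua ui; rewrite mulr0 in h; apply: (eq_near_cvg _ h).
  near=> n; have u0 : 0 < u n by near: n; exact: (cvgryPgt _).1.
  by rewrite mulrAC divff ?mul1r// gt_eqF.
split => //.
  apply/cvgryPge => A; near=> n.
  have u0 : 0 < u n by near: n; exact: (cvgryPgt _).1.
  have uA : A * a <= u n by near: n; exact: (cvgryPge _).1.
  have z0 : 0 <= n.+1%:R * u n / a by rewrite divr_ge0 ?mulr_ge0 ?ltW.
  have /andP[_ t2] := truncn_itv z0.
  apply: (@le_trans _ _ (n.+1%:R * u n / a)).
    rewrite ler_pdivlMr// (le_trans uA)// ler_peMl ?(ltW u0)// ler1n//.
  by apply: (le_trans (ltW t2)); rewrite ler_nat.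
have h : (fun n => ((mesh_count a u n).+1%:R / (n.+1%:R * u n)) ^+ d) @ \oo --> a^-1 ^+ d.
  exact: seq_cvgX.
have h2 := seq_cvgM h gr; rewrite mulr0 in h2; apply: (eq_near_cvg _ h2).
near=> n; have u0 : 0 < u n by near: n; exact: (cvgryPgt _).1.
by rewrite mulrA -exprMn divfK// gt_eqF// mulr_gt0.
Unshelve. all: by end_near. Qed.

Definition cube_density (u : nat -> R) b n : R :=
  Pr P (cube_exceed f (u n) b n.+1%:R) / ((n.+1%:R * u n) ^+ d * psi (u n)).

Lemma cube_density_lower (a : R) (u : nat -> R) b : 0 < a -> u @ \oo --> +oo ->
  \forall n \near \oo,
  exceed_density f (u n) b (mesh_size a u n) (mesh_count a u n) *
    ((mesh_count a u n).+1%:R / (n.+1%:R * u n)) ^+ d <= cube_density u b n.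
Proof.
move=> a0 uoo; near=> n.
have u0 : 0 < u n by near: n; exact: (cvgryPgt _).1.
have D0 : 0 < n.+1%:R * u n by rewrite mulr_gt0.
have p0 := normal_tail_gt0 (u n).
have -> : exceed_density f (u n) b (mesh_size a u n) (mesh_count a u n) *
    ((mesh_count a u n).+1%:R / (n.+1%:R * u n)) ^+ d =
    Pr P (lattice_exceed f (u n) b (mesh_size a u n) (mesh_count a u n)) /
      ((n.+1%:R * u n) ^+ d * psi (u n)).
  rewrite /exceed_density expr_div_n; set x := _.+1%:R; set D := n.+1%:R * u n.
  have x0 : x != 0 by rewrite /x pnatr_eq0.
  have X0 : x ^+ d != 0 by rewrite expf_neq0.
  have Y0 : D ^+ d != 0 by rewrite expf_neq0// gt_eqF.
  by move: X0 Y0; move: (x ^+ d) (D ^+ d) => X Y X0 Y0; field; rewrite X0 Y0 gt_eqF.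
rewrite /cube_density ler_pM2r ?invr_gt0 ?mulr_gt0 ?exprn_gt0// -(mesh_sizeM a u n).
apply: le_Pr.
- exact: measurable_lattice_exceed.
- by apply: (measurable_cube_exceed f_C2); rewrite mesh_sizeM.
- by apply: lattice_cube_exceed; exact: mesh_size_gt0.
Unshelve. all: by end_near. Qed.

(** The chaining starts at the lower level v = u - 2 eta / u, which satisfies v + eta / v <= u once
    u is large. The price is the factor psi(v) / psi(u), which tends to exp(2 eta). *)
Lemma cube_density_upper : exists2 C : R, 0 < C & forall (a eta : R) (u : nat -> R) b,
  0 < a -> C * a ^+ 2 < eta -> u @ \oo --> +oo ->
  let v n := u n - 2 * eta / u n in
  (fun n => (n.+1%:R * v n) ^+ d * expR (- (kappa * v n ^+ 2))) @ \oo --> (0 : R) ->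
  \forall n \near \oo, cube_density u b n <=
  (exceed_density f (v n) b (mesh_size a v n) (mesh_count a v n) +
     2 * d%:R * (2 ^+ d * expR (- (3 / 2 * v n ^+ 2)))) *
    (((mesh_count a v n).+1%:R / (n.+1%:R * v n)) ^+ d * (v n / u n) ^+ d * (psi (v n) / psi (u n))).
Proof.
have [C C1 hC] := dyadic_chaining f_C2 f_gauss f_stat f_mean f_var d_gt0.
have dR : 1 <= d%:R :> R by rewrite ler1n.
exists (C * d%:R); first by rewrite mulr_gt0//; lra.
move=> a eta u b a0 ca uoo v gr.
have eta0 : 0 < eta by apply: le_lt_trans ca; rewrite !mulr_ge0 ?sqr_ge0//; lra.
have voo : v @ \oo --> +oo.
  apply/cvgryPge => A; near=> n.
  have u1 : 1 <= u n by near: n; exact: (cvgryPge _).1.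
  have u2 : A + 2 * eta <= u n by near: n; exact: (cvgryPge _).1.
  have : 2 * eta / u n <= 2 * eta by rewrite ler_pdivrMr ?ler_peMr//; lra.
  by rewrite /v; lra.
have [_ _ dl0 [va _ _]] := mesh_regime_exists a0 voo gr.
have va2 := seq_cvgM va va; rewrite -expr2 in va2.
have tail0 : (fun n => 2 ^+ d * expR (- (3 / 2 * v n ^+ 2))) @ \oo --> (0 : R).
  rewrite -[X in _ --> X](mulr0 (2 ^+ d)); apply: seq_cvgZ; apply: cvg_expR_sqr => //.
near=> n.
have u0 : 0 < u n by near: n; exact: (cvgryPgt _).1.
have v0 : 0 < v n by near: n; exact: (cvgryPgt _).1.
have vu : v n + eta / v n <= u n.
  have : u n <= 2 * v n.
    have u1 : 4 * eta <= u n by near: n; exact: (cvgryPge _).1.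
    have u2 : 1 <= u n by near: n; exact: (cvgryPge _).1.
    rewrite /v mulrBr; have : 2 * (2 * eta / u n) <= u n; last by lra.
    by rewrite mulrA ler_pdivrMr//; nra.
  move=> h; have : eta / v n <= 2 * eta / u n; last by rewrite /v; lra.
  by rewrite ler_pdivrMr// mulrAC ler_pdivlMr//; nra.
have dn0 := mesh_size_gt0 a v n.
have dC : mesh_size a v n < C^-1.
  by near: n; apply: cvgr_lt dl0 _ _; rewrite invr_gt0; lra.
have sm : C * d%:R * (v n * mesh_size a v n) ^+ 2 <= 2 * eta.
  have : (v n * mesh_size a v n) ^+ 2 <= 2 * eta / (C * d%:R).
    rewrite expr2; near: n; apply: cvgr_le va2 _ _.
    by rewrite ltr_pdivlMr ?mulr_gt0//; [move: ca; rewrite mulrC; lra|lra|lra].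
  by rewrite ler_pdivlMr ?mulr_gt0//; [rewrite mulrC|lra|lra].
have q1 : 2 ^+ d * expR (- (3 / 2 * v n ^+ 2)) <= 2^-1.
  by near: n; apply: cvgr_le tail0 _ _; rewrite invr_gt0.
have up : Pr P (cube_exceed f (u n) b n.+1%:R) <=
    Pr P (lattice_exceed f (v n) b (mesh_size a v n) (mesh_count a v n)) +
    (mesh_count a v n).+1%:R ^+ d * psi (v n) * (2 * d%:R * (2 ^+ d * expR (- (3 / 2 * v n ^+ 2)))).
  apply: (@le_trans _ _ (Pr P (cube_exceed f (v n + eta / v n) b n.+1%:R))).
    by apply: le_Pr; [exact: measurable_cube_exceed|exact: measurable_cube_exceed|exact: le_cube_exceed].
  rewrite -(mesh_sizeM a v n); apply: Pr_cube_exceed_le => // k.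
  by apply: hC => //; exact: ltW.
have D0 : 0 < n.+1%:R * u n by rewrite mulr_gt0.
have pu := normal_tail_gt0 (u n); have pv := normal_tail_gt0 (v n).
rewrite /cube_density ler_pdivrMr ?mulr_gt0 ?exprn_gt0//; apply: le_trans up _.
rewrite le_eqVlt; apply/orP; left; apply/eqP.
rewrite /exceed_density !expr_div_n !exprMn; set x := _.+1%:R ^+ d; set y := n.+1%:R ^+ d.
have x0 : x != 0 by rewrite expf_neq0// pnatr_eq0.
have y0 : y != 0 by rewrite expf_neq0// pnatr_eq0.
have v1 : v n ^+ d != 0 by rewrite expf_neq0// gt_eqF.
have u1 : u n ^+ d != 0 by rewrite expf_neq0// gt_eqF.
move: (2 * d%:R * _) (v n ^+ d) (u n ^+ d) v1 u1 => T V U V0 U0; clearbody x y.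
move: (psi (v n)) (psi (u n)) pv pu => Q W /lt0r_neq0 Q0 /lt0r_neq0 W0.
by field; rewrite Q0 W0 x0 y0 V0 U0.
Unshelve. all: by end_near. Qed.

End CubeMaximum.

(** * Convergence of the normalised probability for the cube *)

Section CubeLimit.
Context (disp : measure_display) (Omega : measurableType disp) (R : realType).
Context (P : probability Omega R) (d : nat) (d_gt0 : (0 < d)%N) (f : 'rV[R]_d -> {RV P >-> R}).
Context (f_C2 : smooth_paths f 2) (f_gauss : gaussian_field f) (f_stat : stationary f).
Context (f_mean : forall x, ('E_P[f x] = 0)%E) (f_var : forall x, ('V_P[f x] = 1)%E).
Context (r_lim : cov_kernel f t @[t --> norm_infty R d] --> (0 : R)).
Context (kappa : R) (kappa_gt0 : 0 < kappa) (kappa_lt : kappa < 2^-1).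
Context (u : nat -> R) (uoo : u @ \oo --> +oo) (b : 'rV[R]_d).
Context (gr : (fun n => (n.+1%:R * u n) ^+ d * expR (- (kappa * u n ^+ 2))) @ \oo --> (0 : R)).
Notation psi := (@normal_tail R).

Let ui := cvg_inv_pinfty uoo.

Lemma shifted_level_cvg (c : R) : 0 <= c -> (fun n => u n - c / u n) @ \oo --> +oo.
Proof.
move=> c0; apply/cvgryPge => A; near=> n.
have u1 : 1 <= u n by near: n; exact: (cvgryPge _).1.
have u2 : A + c <= u n by near: n; exact: (cvgryPge _).1.
have : c / u n <= c by rewrite ler_pdivrMr ?ler_peMr//; lra.
lra.
Unshelve. all: by end_near. Qed.

(** Lowering the level by c / u enlarges the exponential by a factor of at most exp(2 kappa c). *)
Lemma shifted_level_growth (c : R) : 0 <= c ->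
  (fun n => (n.+1%:R * (u n - c / u n)) ^+ d * expR (- (kappa * (u n - c / u n) ^+ 2))) @ \oo --> (0 : R).
Proof.
move=> c0; have h := seq_cvgZ (c := expR (2 * kappa * c)) gr; rewrite mulr0 in h.
apply: (squeeze_cvgr _ (cvg_cst 0) h); near=> n.
have u0 : 0 < u n by near: n; exact: (cvgryPgt _).1.
have v0 : 0 < u n - c / u n by near: n; exact: (cvgryPgt _).1 (shifted_level_cvg c0) _.
have cu : 0 <= c / u n by rewrite divr_ge0// ltW.
apply/andP; split; first by rewrite mulr_ge0 ?expR_ge0// exprn_ge0// mulr_ge0// ltW.
rewrite [leRHS]mulrCA ler_pM ?expR_ge0 ?exprn_ge0 ?mulr_ge0 ?(ltW v0)//.
  by rewrite ler_pXn2r ?nnegrE ?mulr_ge0 ?(ltW v0) ?(ltW u0)// ler_wpM2l//; lra.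
rewrite -expRD ler_expR.
have -> : (u n - c / u n) ^+ 2 = u n ^+ 2 - 2 * c + (c / u n) ^+ 2 by field; rewrite gt_eqF.
have := mulr_ge0 (ltW kappa_gt0) (sqr_ge0 (c / u n)); lra.
Unshelve. all: by end_near. Qed.

(* For [eta > C a^2] the density lies asymptotically between [B a] and
   [expR (2 eta) * B a], and [a], hence [eta], can be taken arbitrarily small. *)
Lemma cube_density_limit : exists2 c : R, 0 < c &
  cube_density f u b @ \oo --> c.
Proof.
have [C C0 hC] := cube_density_upper d_gt0 f_C2 f_gauss f_stat f_mean f_var kappa.
have [L hL] := exceed_density_limit f_C2 f_gauss f_stat f_mean f_var r_lim kappa_gt0 kappa_lt.
have [a1 a10 hpos] := exceed_density_positive f_C2 f_gauss f_stat f_mean f_var r_lim kappa_gt0 kappa_lt.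
pose rho := cube_density f u b.
pose B a := L a * a^-1 ^+ d.
have low a (e : R) : 0 < a -> 0 < e -> \forall n \near \oo, B a - e <= rho n.
  move=> a0 e0.
  have reg := mesh_regime_exists a0 uoo gr.
  have cl := seq_cvgM (hL a u _ _ b a0 reg) (@seq_cvgX _ d _ _ (mesh_count_ratio a0 uoo).2).
  near=> n; apply: (@le_trans _ _ (exceed_density f (u n) b (mesh_size a u n) (mesh_count a u n) *
    ((mesh_count a u n).+1%:R / (n.+1%:R * u n)) ^+ d)).
    by near: n; apply: cvgr_ge cl _ _; rewrite /B ltrBlDr ltrDl.
  by near: n; exact: (cube_density_lower f_C2 b a0 uoo).
have up a (eta e : R) : 0 < a -> C * a ^+ 2 < eta -> 0 < e ->
    \forall n \near \oo, rho n <= expR (2 * eta) * B a + e.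
  move=> a0 ca e0.
  have eta0 : 0 <= 2 * eta.
    by rewrite mulr_ge0// (le_trans _ (ltW ca))// mulr_ge0 ?sqr_ge0// ltW.
  have voo := shifted_level_cvg eta0; have gv := shifted_level_growth eta0.
  pose v n := u n - 2 * eta / u n.
  have reg := mesh_regime_exists a0 voo gv.
  have tail0 := seq_cvgZ (c := 2 * d%:R) (seq_cvgZ (c := 2 ^+ d)
    (cvg_expR_sqr (_ : 0 < 3 / 2) voo)); rewrite !mulr0 in tail0.
  have c1 := seq_cvgD (hL a v _ _ b a0 reg) (tail0 _).
  have c2 := @seq_cvgX _ d _ _ (mesh_count_ratio a0 voo).2.
  have c3 : (fun n => v n / u n) @ \oo --> (1 : R).
    have h := seq_cvgB (cvg_cst (1 : R)) (seq_cvgZ (c := 2 * eta) (seq_cvgM ui ui)).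
    rewrite !mulr0 subr0 in h; apply: (eq_near_cvg _ (h _)); near=> n.
    have u0 : 0 < u n by near: n; exact: (cvgryPgt _).1.
    by rewrite /v; field; rewrite gt_eqF.
  have c4 : (fun n => psi (v n) / psi (u n)) @ \oo --> expR (2 * eta).
    have h := normal_tail_shift uoo (cvg_cst (- (2 * eta))).
    rewrite opprK in h; apply: (eq_near_cvg _ (h _)); near=> n.
    by rewrite mulNr.
  have cl := seq_cvgM (c1 _) (seq_cvgM (seq_cvgM c2 (@seq_cvgX _ d _ _ c3)) c4).
  rewrite addr0 expr1n mulr1 in cl.
  have h32 : (0 : R) < 3 / 2 by lra.
  have lt : L a * (a^-1 ^+ d * expR (2 * eta)) < expR (2 * eta) * B a + e.
    by rewrite mulrA -/(B a) [B a * _]mulrC ltrDl.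
  have h2 := cvgr_le _ (cl h32) _ lt; move: (hC a eta u b a0 ca uoo gv) (h2 eventually_filter).
  by apply: filterS2 => n /le_trans; apply.
have mesh (eta : R) : 0 < eta -> exists2 a : R, 0 < a & C * a ^+ 2 < eta.
  move=> eta0; have h : 0 < eta / (2 * C) by rewrite divr_gt0// mulr_gt0.
  exists (Num.sqrt (eta / (2 * C))); first by rewrite sqrtr_gt0.
  rewrite sqr_sqrtr ?(ltW h)//.
  have -> : C * (eta / (2 * C)) = eta / 2 by field; rewrite gt_eqF.
  lra.
(* Every asymptotic lower bound lies below every asymptotic upper bound, so the upper bound for one
   fixed a2 controls all the [B a]. *)
have [M M0 hM] : exists2 M : R, 0 < M & forall a, 0 < a -> B a <= M.
  have [a2 a20 ca2] := mesh 1 ltr01.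
  have u2 := up a2 1 1 a20 ca2 ltr01.
  exists (`|expR (2 * 1) * B a2 + 1| + 1); first by rewrite ltr_wpDl.
  move=> a a0; have l2 := low a 1 a0 ltr01.
  have [n [h1 h2]] : exists n, B a - 1 <= rho n /\ rho n <= expR (2 * 1) * B a2 + 1.
    have [N _ hN] : \forall n \near \oo, B a - 1 <= rho n /\ rho n <= expR (2 * 1) * B a2 + 1.
      by near=> n; split; near: n.
    by exists N; exact: hN (leqnn N).
  rewrite -lerBlDr; apply: le_trans h1 _; apply: le_trans h2 _; exact: ler_norm.
have cr : cvg (rho @ \oo).
  apply/cauchy_cvgP/(@cauchy_exP _ _ (rho @ \oo)) => e e0.
  have e4 : 0 < e / 4 by rewrite divr_gt0.
  have q0 : 0 < e / 4 / M by rewrite divr_gt0.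
  (* Makes exp(2 eta) B(a) - B(a) at most e / 4, uniformly in a. *)
  pose eta := ln (1 + e / 4 / M) / 2.
  have eta0 : 0 < eta by rewrite divr_gt0// ln_gt0// ltrDl.
  have etaE : expR (2 * eta) = 1 + e / 4 / M.
    by rewrite /eta mulrC divfK// lnK// posrE addr_gt0.
  have [a a0 ca] := mesh eta eta0.
  exists (B a); rewrite /nbhs /=; near=> n.
  have l1 : B a - e / 4 <= rho n by near: n; exact: low.
  have u1 : rho n <= expR (2 * eta) * B a + e / 4 by near: n; exact: up.
  rewrite -ball_normE /ball_ /= ltr_norml etaE in u1 *.
  have : e / 4 / M * B a <= e / 4.
    by rewrite -[leRHS](@divfK _ M) ?gt_eqF// ler_wpM2l ?(ltW q0)// hM.
  by move=> h; apply/andP; split; lra.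
exists (lim (rho @ \oo)) => //.
have h1 := @seq_cvgX _ d _ _ (mesh_count_ratio a10 uoo).2.
have i0 : 0 < a1^-1 ^+ d by rewrite exprn_gt0// invr_gt0.
(* Eventually the lattice density for a1 is at least 1/4 and the power of the count ratio at least
   half its limit. *)
apply: (@lt_le_trans _ _ (1 / 4 * (a1^-1 ^+ d / 2))); first by rewrite mulr_gt0// divr_gt0.
apply: limr_ge => //; near=> n.
apply: (@le_trans _ _ (exceed_density f (u n) b (mesh_size a1 u n) (mesh_count a1 u n) *
    ((mesh_count a1 u n).+1%:R / (n.+1%:R * u n)) ^+ d)); last first.
  by near: n; exact: (cube_density_lower f_C2 b a10 uoo).
apply: ler_pM; rewrite ?divr_ge0//; first exact: ltW.
  by near: n; apply: hpos; exact: mesh_regime_exists.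
by near: n; apply: cvgr_ge h1 _ _; rewrite ltr_pdivrMr//; lra.
Unshelve. all: by end_near. Qed.

End CubeLimit.

(** * Total variation and normalisation *)

Section TotalVariation.
Context (disp : measure_display) (Omega : measurableType disp) (R : realType).
Context (P : probability Omega R) (d : nat) (f : 'rV[R]_d -> {RV P >-> R}).
Context (f_C2 : smooth_paths f 2) (alpha : R) (n : nat).
Notation u := (level alpha d n).
Notation X := (exceedance f alpha n).

Lemma cube_atP (t : grid d n) (x : 'rV[R]_d) :
  cube_at R t x <-> forall i, (t i)%:R - 2^-1 <= x 0 i <= (t i)%:R - 2^-1 + 1.
Proof.
split=> [[y yD <-] i|h].
  by rewrite !mxE; have /andP[y1 y2] := yD i; apply/andP; split; lra.
exists (x - grid_pt R t); last by rewrite addrC subrK.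
by move=> i; rewrite !mxE; have /andP[h1 h2] := h i; apply/andP; split; lra.
Qed.

Lemma compact_cube_at (t : grid d n) : compact (cube_at R t).
Proof.
pose A (i : 'I_d) : set R := `[(t i)%:R - 2^-1, (t i)%:R - 2^-1 + 1]%classic.
rewrite (_ : cube_at R t = [set v | forall i, A i (v ord0 i)]).
  by apply: rV_compact => i; exact: segment_compact.
apply/seteqP; split => x.
  by move=> /cube_atP h i; rewrite /A /= in_itv /=; exact: h.
by move=> h; apply/cube_atP => i; have := h i; rewrite /A /= in_itv.
Qed.

Lemma exceedanceP (t : grid d n) w :
  X w t <-> cube_exceed f u (const_mx (- 2^-1) + grid_pt R t) 1 w.
Proof.
have E x : cube_at R t x <-> forall i : 'I_d,
    (const_mx (- 2^-1) + grid_pt R t) 0 i <= x 0 i <= (const_mx (- 2^-1) + grid_pt R t) 0 i + 1.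
  apply: (iff_trans (cube_atP t x)); split=> h i; have := h i; rewrite !mxE.
    by rewrite [- 2^-1 + _]addrC.
  by rewrite [- 2^-1 + _]addrC.
have [cf _] := f_C2 w.
have ub : has_ubound [set f x w | x in cube_at R t].
  have : compact [set f x w | x in cube_at R t].
    apply: continuous_compact; last exact: compact_cube_at.
    exact: continuous_subspaceT.
  move=> /compact_bounded[M [_ hM]]; exists (M + 1) => y hy.
  have := hM (M + 1); rewrite ltrDl ltr01 => /(_ isT y hy) h.
  exact: le_trans (ler_norm y) h.
have ne : [set f x w | x in cube_at R t] !=set0.
  exists (f (grid_pt R t) w), (grid_pt R t) => //; apply/cube_atP => i.
  by rewrite mxE; apply/andP; split; lra.
rewrite ffunE; split => [/(sup_gt ne)[_ [x xt <-] hx]|[x xt hx]].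
  by exists x => //; exact/E.
by apply: (lt_le_trans hx); apply: ub_le_sup => //; exists x => //; exact/E.
Qed.

Lemma exceedance_neq0 w : X w != [ffun=> false] <->
  cube_exceed f u (const_mx (- 2^-1)) n.+1%:R w.
Proof.
split=> [h|[x xB hx]].
  have [t ht] : exists t, X w t.
    apply: contrapT => H; move/negP: h; apply; apply/eqP/ffunP => t; rewrite [RHS]ffunE.
    by apply/negbTE/negP => ht; apply: H; exists t.
  have /exceedanceP[x xt hx] := ht; exists x => // i.
  have := xt i; rewrite !mxE => /andP[h1 h2].
  have : (t i)%:R <= n%:R :> R by rewrite ler_nat -ltnS.
  have : 0 <= (t i)%:R :> R by [].
  rewrite -[n.+1%:R]natr1; move=> h3 h4; apply/andP; split; lra.
(* The nearest integer to each coordinate, capped at n for points on the face where the coordinate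
   is n + 1/2. *)
have lt i : (minn (Num.trunc (x 0%R i + 2^-1)%R) n < n.+1)%N by rewrite ltnS geq_minr.
pose t : grid d n := [ffun i => Ordinal (lt i)].
suff Xt : X w t by apply/eqP => X0; move: Xt; rewrite X0 ffunE.
apply/exceedanceP; exists x => // i; rewrite !mxE ffunE /=.
have := xB i; rewrite !mxE -[n.+1%:R]natr1 => /andP[h1 h2].
have z0 : 0 <= x 0 i + 2^-1 by lra.
have /andP[t1 t2] := truncn_itv z0; rewrite -[(Num.trunc _).+1%:R]natr1 in t2.
case: (leqP (Num.trunc (x 0 i + 2^-1)) n) => [tn|nt].
  by apply/andP; split; lra.
have : n%:R <= (Num.trunc (x 0 i + 2^-1))%:R :> R by rewrite ler_nat ltnW.
by move=> h; apply/andP; split; lra.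
Qed.

Lemma measurable_exceedance_pt (t : grid d n) : measurable [set w | X w t].
Proof.
rewrite (_ : [set w | _] = cube_exceed f u (const_mx (- 2^-1) + grid_pt R t) 1).
  exact: (measurable_cube_exceed f_C2).
by apply/seteqP; split => w /exceedanceP.
Qed.

Lemma measurable_exceedance (A : set (config d n)) : measurable (X @^-1` A).
Proof.
have mc (c : config d n) : measurable [set w | X w = c].
  rewrite (_ : [set w | _] = \bigcap_(t in [set: grid d n])
      (if c t then [set w | X w t] else ~` [set w | X w t])).
    apply: fin_bigcap_measurable; first exact: finite_finset.
    move=> t _; case: (c t); first exact: measurable_exceedance_pt.
    by apply: measurableC; exact: measurable_exceedance_pt.
  apply/seteqP; split => w /=.
    by move=> <- t _; case E : (X w t) => //=; rewrite E.
  move=> h; apply/ffunP => t; have := h t I; case: (c t) => //= /negP.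
  by move=> /negbTE.
rewrite (_ : X @^-1` A = \bigcup_(c in A) [set w | X w = c]).
  by apply: fin_bigcup_measurable => //; exact: finite_finset.
apply/seteqP; split => [w Aw|w [c Ac /= Xc]]; first by exists (X w).
by rewrite /= Xc.
Qed.

(** On a set containing the zero configuration the difference is the probability that X avoids the
    set, on any other set the probability that X hits it. Both are at most P(X <> 0), and the set of
    nonzero configurations attains this value. *)
Lemma tv_dist_exceedance :
  tv_dist (pushforward P X) (pushforward P (zero_process Omega d n)) =
  Pr P (cube_exceed f u (const_mx (- 2^-1)) n.+1%:R).
Proof.
set p := Pr P _; pose z : config d n := [ffun=> false].
have pE : p = Pr P (X @^-1` [set c | c != z]).
  by congr (Pr P _); apply/seteqP; split => w /exceedance_neq0.
have zA (A : set (config d n)) : A z -> pushforward P (zero_process Omega d n) A = 1%E.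
  move=> Az; rewrite /pushforward (_ : _ @^-1` A = setT) ?probability_setT//.
  by apply/seteqP; split.
have zN (A : set (config d n)) : ~ A z -> pushforward P (zero_process Omega d n) A = 0%E.
  move=> Az; rewrite /pushforward (_ : _ @^-1` A = set0) ?measure0//.
  by apply/seteqP; split.
have ub (A : set (config d n)) :
    `|fine (pushforward P X A) - fine (pushforward P (zero_process Omega d n) A)| <= p.
  have mA := measurable_exceedance A.
  case: (pselect (A z)) => Az.
    rewrite zA// distrC.
    have -> : fine (1%E : \bar R) - fine (pushforward P X A) = Pr P (X @^-1` (~` A)).
      apply: EFin_inj; rewrite -Pr_EFin; last exact: measurable_exceedance.
      rewrite preimage_setC probability_setC// /pushforward (Pr_EFin P mA).
      by rewrite /Pr.
    rewrite ger0_norm ?Pr_ge0// pE; apply: le_Pr; try exact: measurable_exceedance.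
    by move=> w Xw; apply/eqP => E; apply: Xw; rewrite E.
  rewrite zN// subr0 ger0_norm; last exact: Pr_ge0.
  rewrite pE -/(Pr P _).
  apply: le_Pr; try exact: measurable_exceedance.
  by move=> w Xw; apply/eqP => E; apply: Az; rewrite -E.
have pin : [set `|fine (pushforward P X A) - fine (pushforward P (zero_process Omega d n) A)|
    | A in @measurable _ (config d n)] p.
  exists [set c | c != z] => //; rewrite zN /= ?eqxx// subr0 ger0_norm; last exact: Pr_ge0.
  by rewrite pE.
apply/eqP; rewrite eq_le; apply/andP; split.
  by apply: ge_sup; [exists p|move=> _ [A _ <-]].
by apply: ub_le_sup => //; exists p => _ [A _ <-].
Qed.

End TotalVariation.

(** * Asymptotics of the level and the normalising sequence *)

Section Level.
Context (R : realType) (d : nat) (d_gt0 : (0 < d)%N) (alpha : R) (alpha_gt1 : 1 < alpha).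
Notation u := (level alpha d).
Notation psi := (@normal_tail R).

Let c0 : 0 < 2 * alpha * d%:R.
Proof. by have a1 := alpha_gt1; rewrite !mulr_gt0 ?ltr0n//; lra. Qed.

Lemma level_sqr n : (0 < n)%N -> u n ^+ 2 = 2 * alpha * d%:R * ln n%:R.
Proof. by move=> n0; rewrite sqr_sqrtr// mulr_ge0 ?(ltW c0)// ln_ge0// ler1n. Qed.

Lemma level_cvg : u @ \oo --> +oo.
Proof.
apply/cvgryPge => A; near=> n.
have n1 : expR (A ^+ 2 / (2 * alpha * d%:R)) <= n%:R by near: n; exact: nbhs_infty_ger.
apply: le_trans (ler_norm A) _; rewrite -sqrtr_sqr ler_wsqrtr//.
have nR : 0 < n%:R :> R by exact: lt_le_trans (expR_gt0 _) n1.
rewrite mulrC -ler_pdivrMr// -[leLHS]expRK ler_ln ?posrE ?expR_gt0//.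
Unshelve. all: by end_near. Qed.

Lemma expR_level (k : R) n : (0 < n)%N ->
  expR (- (k * u n ^+ 2)) = n%:R `^ (- (k * (2 * alpha * d%:R))).
Proof.
move=> n0; rewrite level_sqr// /powR pnatr_eq0 gtn_eqF//; congr expR; ring.
Qed.

Lemma cvg_count_ratio : (fun n : nat => n.+1%:R / n%:R) @ \oo --> (1 : R).
Proof.
have h := seq_cvgD (cvg_cst (1 : R)) (@cvg_invn0 R); rewrite addr0 in h.
apply: (eq_near_cvg _ (h _)); near=> n.
have n0 : n%:R != 0 :> R by rewrite pnatr_eq0 -lt0n; near: n; exact: nbhs_infty_gt.
by rewrite -natr1 mulrDl divff// mul1r.
Unshelve. all: by end_near. Qed.

(** Since u^2 = 2 alpha d log n, the exponential is n^(- (alpha + 1) d / 2). The part n^(- d)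
    cancels the volume of the cube, and the surplus n^(- (alpha - 1) d / 2) beats u^d. *)
Lemma level_growth : let kappa := (1 + alpha^-1) / 4 in
  (fun n => (n.+1%:R * u n) ^+ d * expR (- (kappa * u n ^+ 2))) @ \oo --> (0 : R).
Proof.
have a1 := alpha_gt1; move=> kappa; pose s := (alpha - 1) / 2; have s0 : 0 < s by rewrite /s; lra.
have q0 : 0 < s / (2 * alpha) / d%:R by rewrite !divr_gt0 ?ltr0n//; lra.
have h1 := seq_cvgM cvg_count_ratio (cvg_mul_expR_sqr q0 level_cvg); rewrite mulr0 in h1.
have h2 : (fun n => (n.+1%:R / n%:R * (u n * expR (- (s / (2 * alpha) / d%:R * u n ^+ 2)))) ^+ d)
    @ \oo --> (0 ^+ d : R).
  exact: seq_cvgX.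
rewrite expr0n gtn_eqF//= in h2; apply: (eq_near_cvg _ h2); near=> n.
have n0 : (0 < n)%N by near: n; exact: nbhs_infty_gt.
have nR : 0 < n%:R :> R by rewrite ltr0n.
have -> : n.+1%:R / n%:R * (u n * expR (- (s / (2 * alpha) / d%:R * u n ^+ 2))) =
    n.+1%:R * u n * (n%:R^-1 * expR (- (s / (2 * alpha) / d%:R * u n ^+ 2))) by ring.
rewrite exprMn; congr (_ * _).
rewrite -{1}(lnK nR) -expRN -expRD -expRM_natl level_sqr//; congr expR.
by rewrite /kappa /s; field; rewrite pnatr_eq0 -lt0n d_gt0; lra.
Unshelve. all: by end_near. Qed.

(** Here psi(u) ~ phi(u) / u, and phi(u) is n^(- alpha d) up to a constant. One of the d factors u
    cancels, and the remaining u^(d-1) is the power (d - 1) / 2 of 2 alpha d log n. *)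
Lemma level_normalisation : (fun n => (n.+1%:R * u n) ^+ d * psi (u n) /
    (n%:R `^ ((1 - alpha) * d%:R) * ln n%:R `^ ((d%:R - 1) / 2))) @ \oo -->
  normal_peak 1 * Num.sqrt (2 * alpha * d%:R) ^+ d.-1.
Proof.
have h1 : (fun n => (n.+1%:R / n%:R) ^+ d) @ \oo --> (1 ^+ d : R).
  by apply: seq_cvgX; exact: cvg_count_ratio.
have h := seq_cvgM (seq_cvgM h1 (normal_tail_equiv level_cvg))
  (cvg_cst (normal_peak 1 * Num.sqrt (2 * alpha * d%:R) ^+ d.-1)).
rewrite expr1n !mul1r in h; apply: (eq_near_cvg _ (h _)); near=> n.
have n1 : (1 < n)%N by near: n; exact: nbhs_infty_gt.
have n0 : (0 < n)%N by exact: ltnW.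
have nR : 0 < n%:R :> R by rewrite ltr0n.
have l0 : 0 < ln n%:R :> R by rewrite ln_gt0// ltr1n.
have u0 : 0 < u n by rewrite sqrtr_gt0 mulr_gt0.
have phiE : normal_pdf 0 1 (u n) = normal_peak 1 * n%:R `^ (- (alpha * d%:R)).
  rewrite normal_pdf01E mulNr [_ / 2]mulrC expR_level//; congr (_ * (_ `^ _)).
  by field.
have lE : ln n%:R `^ ((d%:R - 1) / 2) = Num.sqrt (ln n%:R) ^+ d.-1 :> R.
  rewrite mulrC powRrM powR12_sqrt ?(ltW l0)// -powR_mulrn ?sqrtr_ge0//; congr (_ `^ _).
  by rewrite -subn1 natrB.
have nE : n%:R `^ ((1 - alpha) * d%:R) = n%:R ^+ d * n%:R `^ (- (alpha * d%:R)) :> R.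
  rewrite mulrBl mul1r powRD ?powR_mulrn// ?(ltW nR)//.
  by apply/implyP => _; rewrite gt_eqF.
have uE : u n ^+ d = u n * (Num.sqrt (2 * alpha * d%:R) ^+ d.-1 * Num.sqrt (ln n%:R) ^+ d.-1).
  have dE (x : R) : x ^+ d = x * x ^+ d.-1 by rewrite -exprS prednK.
  by rewrite dE -exprMn -sqrtrM// ltW.
rewrite -/(level alpha d n) phiE lE nE [(n.+1%:R * u n) ^+ d]exprMn uE expr_div_n.
have p0 : normal_peak 1 != 0 :> R.
  by have := normal_pdf01_gt0 (0 : R); rewrite normal_pdf01E => /lt0r_neq0; rewrite mulf_eq0 negb_or => /andP[].
have x0 : n%:R ^+ d != 0 :> R by rewrite expf_neq0// gt_eqF.
have y0 : n%:R `^ (- (alpha * d%:R)) != 0 :> R by rewrite gt_eqF// powR_gt0.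
have z0 : Num.sqrt (ln n%:R) ^+ d.-1 != 0 :> R by rewrite expf_neq0// gt_eqF// sqrtr_gt0.
have alg (a1 a2 a3 a4 a5 a6 a7 a8 : R) : a2 != 0 -> a3 != 0 -> a4 != 0 -> a6 != 0 ->
    a1 / a2 * (a7 * a8 / (a6 * a3)) * (a6 * a5) = a1 * (a7 * (a5 * a4)) * a8 / (a2 * a3 * a4).
  by move=> *; field; do !(apply/andP; split).
exact: alg.
Unshelve. all: by end_near. Qed.

End Level.

Unset Implicit Arguments.
Set Strict Implicit.

Theorem theorem2p6 (disp : measure_display) (Omega : measurableType disp)
    (R : realType) (P : probability Omega R) (d : nat) (d_gt0 : (0 < d)%N)
    (f : 'rV[R]_d -> {RV P >-> R})
    (f_C2 : smooth_paths f 2)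
    (f_gauss : gaussian_field f)
    (f_stat : stationary f)
    (f_mean : forall x, ('E_P[f x] = 0)%E)
    (f_var : forall x, ('V_P[f x] = 1)%E)
    (r_lim : cov_kernel f t @[t --> norm_infty R d] --> (0 : R))
    (alpha : R) (alpha_gt1 : 1 < alpha) :
  exists c0 : R, 0 < c0 /\
    tv_dist (pushforward P (exceedance f alpha n))
            (pushforward P (zero_process Omega d n))
      / (n%:R `^ ((1 - alpha) * d%:R) * ln n%:R `^ ((d%:R - 1) / 2))
      @[n --> \oo] --> c0.
Proof.
(* The midpoint of 1 / (2 alpha) and 1 / 2: above the former, distant pairs are negligible; below
   the latter, the exponent is attained with a positive correlation threshold. *)
pose kappa := (1 + alpha^-1) / 4; pose u := level alpha d.
have i0 : 0 < alpha^-1 by rewrite invr_gt0; lra.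
have i1 : alpha^-1 < 1 by rewrite invf_lt1//; lra.
have k0 : 0 < kappa by rewrite /kappa; lra.
have k1 : kappa < 2^-1 by rewrite /kappa; lra.
have uoo : u @ \oo --> +oo by exact: level_cvg.
have [c c0 hc] := cube_density_limit d_gt0 f_C2 f_gauss f_stat f_mean f_var r_lim k0 k1 uoo
  (const_mx (- 2^-1)) (level_growth d_gt0 alpha_gt1).
exists (c * (normal_peak 1 * Num.sqrt (2 * alpha * d%:R) ^+ d.-1)); split.
  rewrite !mulr_gt0 ?normal_peak_gt0 ?oner_neq0// exprn_gt0// sqrtr_gt0 !mulr_gt0 ?ltr0n//; lra.
apply: (eq_near_cvg _ (seq_cvgM hc (level_normalisation d_gt0 alpha_gt1))); near=> n.
have u0 : 0 < u n by near: n; exact: (cvgryPgt _).1.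
have p0 := normal_tail_gt0 (u n).
rewrite (tv_dist_exceedance f_C2) /cube_density mulrA divfK// gt_eqF// mulr_gt0// exprn_gt0//.
by rewrite mulr_gt0.
Unshelve. all: by end_near. Qed.
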